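(* There exists a real constant $c>0$ such that the following holds for any positive constant $C<1/9$. Let $k, n$ and $m$ be integers with $3 \leq k < n^{C}$ and $\sqrt{n}< m < \frac{c}{k}\binom nk$. Then there exists a set $\mathcal{W}$ that has probability $1-O(n^{-\omega(1)})$ in both $\mathcal{B}_{k}(n, m)$ and $\mathcal{D}_k(n, m)$, such that uniformly for all integers $k, m$ with $3 \leq k < n^{C}$ and $\sqrt{n}< m < \frac{c}{k}\binom nk$, and all $\mathbf{d} \in \mathcal{W}$, $$\Pr_{\mathcal{D}_k(n, m)}(\mathbf{d}) = \Pr_{\mathcal{B}_{k}(n, m)}(\mathbf{d}) (1 + o(1)).$$
   Context: $\mathcal{H}_k(n,m)$ is the uniform probability space of $k$-uniform hypergraphs on vertex set $[n]$ with $m$ edges, and $\mathcal{D}_k(n,m)$ is the probability space induced by the degree sequence of $\mathcal{H}_k(n,m)$, on the ground set $\Omega=\{\mathbf{d}\in\mathbb{Z}^n:\sum_v d_v=km\}$. $\mathcal{B}_k(n,m)$ is the probability space on $\Omega$ where each component $d_v$ is independently distributed as $\mathrm{Bin}(\binom{n-1}{k-1},p)$ for some $p\in(0,1)$, conditioned on $\sum_v d_v=km$; explicitly $\Pr_{\mathcal{B}_k(n,m)}(\mathbf{d})=\binom{n\binom{n-1}{k-1}}{km}^{-1}\prod_{v}\binom{\binom{n-1}{k-1}}{d_v}$. Asymptotics are as $n\to\infty$; $\omega(1)$ denotes a function tending to infinity. Uniform convergence means there is a fixed bound $g(n)\to0$ on the error for all $\mathbf{d}$ in the given set. *)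

(* Defs.v *)
From HB Require Import structures.
From mathcomp Require Import all_boot all_order all_algebra.
From mathcomp Require Import all_classical all_reals all_analysis.
From mathcomp Require Import Rstruct.
Unset Printing Implicit Defensive.
Notation R := Rdefinitions.R.
Import Order.TTheory GRing.Theory Num.Theory.
Local Open Scope ring_scope.

(* Degree sequences are functions [n] -> nat.  (Omega is a subset of Z^n, but
   sequences with a negative entry have probability 0 in both spaces.) *)
Notation degseq n := {ffun 'I_n -> nat}.

Definition khg (n k m : nat) : {set {set {set 'I_n}}} :=
  [set H : {set {set 'I_n}} | [forall e in H, #|e| == k] && (#|H| == m)].

Definition degs (n : nat) (H : {set {set 'I_n}}) : degseq n :=
  [ffun v => #|[set e in H | v \in e]|].

Definition inOmega (n k m : nat) (d : degseq n) : Prop :=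
  (\sum_(v < n) d v)%N = (k * m)%N.

Definition PrD (n k m : nat) (d : degseq n) : R :=
  (#|[set H in khg n k m | degs n H == d]|)%:R / (#|khg n k m|)%:R.

Definition PrD_ev (n k m : nat) (P : degseq n -> bool) : R :=
  (#|[set H in khg n k m | P (degs n H)]|)%:R / (#|khg n k m|)%:R.

Definition Nb (n k : nat) : nat := 'C(n.-1, k.-1).

Definition PrB (n k m : nat) (d : degseq n) : R :=
  (\prod_(v < n) 'C(Nb n k, d v))%:R / ('C(n * Nb n k, k * m))%:R.

(* Every d in the support of B_k(n,m) has entries in [0, N]; the event
   probability sums the point probabilities over Omega /\ P. *)
Definition lift_deg (n N : nat) (d : {ffun 'I_n -> 'I_N.+1}) : degseq n :=
  [ffun v => nat_of_ord (d v)].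

Definition PrB_ev (n k m : nat) (P : degseq n -> bool) : R :=
  \sum_(d : {ffun 'I_n -> 'I_(Nb n k).+1}
         | ((\sum_(v < n) (d v : nat))%N == (k * m)%N) && P (lift_deg n (Nb n k) d))
     PrB n k m (lift_deg n (Nb n k) d).

Definition admissible (c C : R) (n k m : nat) : Prop :=
  [/\ (3 <= k)%N, (k%:R : R) < powR (n%:R : R) C,
      Num.sqrt (n%:R : R) < m%:R & m%:R < c / k%:R * ('C(n, k))%:R].

(* Main.v *)
(** Write L(d) for the ratio of the probabilities of d in D_k(n,m) and B_k(n,m).  The model B_k(n,m)
   is the degree vector of a uniform km-subset U of n x N slots, N = C(n-1,k-1), so L becomes a function
   on a slice of the Boolean cube.  The slice has spectral gap of order 1/(km) for transpositions; applied to
   powers of F = L^(1/q), q a power of two, the Poincare inequality bounds the q-th moment of F - E F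
   by (km)^(q/2) times the average of |F(U) - F(U')|^q over neighbouring U, U'.

   Moving one vertex of one edge from a to c compares neighbouring degree sequences d, d': it
   gives L(d)(1 - u) = L(d')(1 - u') where u, u' are averages, over the hypergraphs realising d and d',
   of an explicit quantity depending on the number X of edges containing a that stay edges when a is
   replaced by c.  When the average degree is at most y^104 (n = y^144), the average of X is small by
   a second switching; when it is larger, X and the degrees are concentrated by Chernoff bounds in the
   model with independent edges.  In both cases |u| sqrt(km) is at most a negative power of n outside a
   superpolynomially small event, so F, and hence L, is within n^(-1/144) of 1 with failure
   probability O(n^(-A)) for every A.  A diagonal choice of q = q(n) concludes. *)

Require Import Defs.
From HB Require Import structures.
From mathcomp Require Import all_boot all_order all_algebra fingroup perm.
From mathcomp Require Import reals Rstruct.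
From mathcomp Require Import zify ring lra.
Set Implicit Arguments.
Unset Strict Implicit.
Import Order.TTheory GRing.Theory Num.Theory.
Local Open Scope ring_scope.

(** * The moment inequality on a slice *)

(** The comparison of neighbours says little at atypical sequences, where L may even vanish. The
    q-th root is chosen to cope with this: in the q-th moment of F(U) - F(U'), an error u enters as
    the average of u^q weighted by L, which is an average over uniform hypergraphs. No lower
    estimate of L is involved, and an atypical hypergraph costs only its probability times a trivial
    bound. The exponents come from the requirement that sqrt(km) |u| be small. With n = y^144, the
    hypotheses read k <= y^16 and m >= y^72; let D = km/n. If D <= y^104, then sqrt(km) <= y^124,
    and k sqrt(km) / n <= y^(-4) just fits. If D > y^104, deviations of size tau = y^18 give
    sqrt(km) |u| of order at most y^(9+72) tau / D <= y^(-5), so the same threshold serves. The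
    value y^18 is forced from the other side: the exceptional event is multiplied by powers of n^k,
    that is by exp(O(q y^17)), which exp(-tau) has to beat. *)

Lemma sqr_sum_le (K : realFieldType) (I : finType) (P : {pred I}) (f : I -> K) :
  (\sum_(i in P) f i) ^+ 2 <= #|P|%:R * \sum_(i in P) f i ^+ 2.
Proof.
set S := \sum_(i in P) f i.
have H : 0 <= \sum_(i in P) (#|P|%:R * f i - S) ^+ 2.
  by apply: sumr_ge0 => i _; apply: sqr_ge0.
have E : \sum_(i in P) (#|P|%:R * f i - S) ^+ 2 =
    #|P|%:R * (#|P|%:R * (\sum_(i in P) f i ^+ 2) - S ^+ 2).
  transitivity (\sum_(i in P) (#|P|%:R ^+ 2 * f i ^+ 2 - 2 * #|P|%:R * S * f i + S ^+ 2)).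
    by apply: eq_bigr => i _; ring.
  rewrite big_split sumrB /= -!mulr_sumr sumr_const -/S -(mulr_natr S); ring.
case: (posnP #|P|) => [c0|cp].
  suff -> : S = 0 by rewrite expr0n /= c0 mul0r.
  by apply: big1 => i; rewrite (card0_eq c0).
rewrite E pmulr_rge0 ?ltr0n // in H; lra.
Qed.

Lemma sqr_dev_sum (K : realFieldType) (I : finType) (P : {pred I}) (f : I -> K) (g m : K) :
  \sum_(i in P) f i = #|P|%:R * m ->
  \sum_(i in P) (f i - g) ^+ 2 = \sum_(i in P) (f i - m) ^+ 2 + #|P|%:R * (m - g) ^+ 2.
Proof.
move=> Hm.
transitivity (\sum_(i in P) ((f i - m) ^+ 2 + ((2 * (m - g)) * f i + (g ^+ 2 - m ^+ 2)))).
  by apply: eq_bigr => i _; ring.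
set V := \sum_(i in P) (_ - m) ^+ 2.
rewrite big_split big_split /= -/V sumr_const -(mulr_natr (g ^+ 2 - m ^+ 2)) -mulr_sumr Hm; ring.
Qed.

Lemma sqr_pair_sum (K : realFieldType) (I : finType) (P : {pred I}) (f : I -> K) (m : K) :
  \sum_(i in P) f i = #|P|%:R * m ->
  \sum_(i in P) \sum_(j in P) (f i - f j) ^+ 2 =
  2 * #|P|%:R * \sum_(i in P) (f i - m) ^+ 2.
Proof.
move=> Hm.
under eq_bigr => i _.
  have -> : \sum_(j in P) (f i - f j) ^+ 2 = \sum_(j in P) (f j - m) ^+ 2 + #|P|%:R * (f i - m) ^+ 2.
    rewrite -[(f i - m) ^+ 2]sqrrN opprB -(sqr_dev_sum _ Hm).
    by apply: eq_bigr => j _; ring.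
  over.
set V := \sum_(j in P) (f j - m) ^+ 2.
  rewrite big_split /= sumr_const -mulr_sumr -/V -(mulr_natr V); ring.
Qed.

Section Slice.
Variables (K : realFieldType) (T : finType) (M : nat).
Implicit Types (A U : {set T}) (x y : T) (F : {set T} -> K).

(** [A] is the part of the set already revealed; the Poincare inequality is proved by revealing one
    element at a time. *)
Definition slice A : {set {set T}} := [set U : {set T} | (A \subset U) && (#|U| == M)].

Definition swapset x y U : {set T} := tperm x y @: U.

(** For [h U V = (F U - F V) ^+ 2] this is an unnormalised Dirichlet form. The element given up
    ranges over [U :\: A], so that a swap never leaves the conditioned slice. *)
Definition swap_energy A (h : {set T} -> {set T} -> K) : K :=
  \sum_(U in slice A) \sum_(x in U :\: A) \sum_(y in ~: U) h U (swapset x y U).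

Lemma card_swapset x y U : #|swapset x y U| = #|U|.
Proof. by rewrite card_imset //; apply: perm_inj. Qed.

Lemma swapsetK x y : involutive (swapset x y).
Proof.
move=> U; rewrite /swapset -imset_comp -[RHS]imset_id.
by apply: eq_imset => z /=; rewrite tpermK.
Qed.

Lemma swapset_id x y U : x \in U -> y \in U -> swapset x y U = U.
Proof.
move=> xU yU; apply/eqP; rewrite eqEcard card_swapset leqnn andbT.
apply/subsetP => z /imsetP[w wU ->].
by case: tpermP.
Qed.

Lemma swapsetE x y U : x \in U -> y \notin U -> swapset x y U = y |: (U :\ x).
Proof.
move=> xU yU; apply/setP => z; rewrite !inE.
have -> : (z \in swapset x y U) = (tperm x y z \in U).
  by rewrite -{1}[z](tpermK x y) mem_imset //; apply: perm_inj.
case: tpermP => [->|->|/eqP zx /eqP zy].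
- by rewrite eqxx (negbTE yU) andFb orbF; apply/esym/eqP => xy; rewrite -xy xU in yU.
- by rewrite xU eqxx.
- by rewrite (negbTE zy) zx.
Qed.

Lemma slice_swap x y A U : x \notin A -> y \notin A ->
  (swapset x y U \in slice (y |: A)) = (U \in slice (x |: A)).
Proof.
move=> xA yA; rewrite !inE card_swapset; congr (_ && _).
have swA : swapset x y A = A.
  apply/eqP; rewrite eqEcard card_swapset leqnn andbT.
  apply/subsetP => z /imsetP[w wA ->]; case: tpermP => // e.
    by rewrite -e wA in xA.
  by rewrite -e wA in yA.
have -> : y |: A = swapset x y (x |: A).
  by rewrite /swapset imsetU1 tpermL -[imset _ _]/(swapset x y A) swA.
apply/idP/idP => [|sub]; last exact: imsetS.
by move=> /(imsetS (tperm x y)); rewrite -![imset _ _]/(swapset x y _) !swapsetK.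
Qed.

Lemma sum_slice_swap x y A F : x \notin A -> y \notin A ->
  \sum_(U in slice (y |: A)) F U = \sum_(U in slice (x |: A)) F (swapset x y U).
Proof.
move=> xA yA; rewrite (reindex_inj (inv_inj (swapsetK x y))).
by apply: eq_bigl => U; rewrite slice_swap.
Qed.

Lemma card_slice_swap x y A : x \notin A -> y \notin A ->
  #|slice (y |: A)| = #|slice (x |: A)|.
Proof.
move=> xA yA; rewrite -!sum1_card (reindex_inj (inv_inj (swapsetK x y))).
by apply: eq_bigl => U; rewrite slice_swap.
Qed.

Lemma slice_U1 x A U : x \notin A ->
  (U \in slice (x |: A)) = (U \in slice A) && (x \in U :\: A).
Proof. by move=> xA; rewrite !inE subUset sub1set xA /=; case: (x \in U); rewrite ?andbF ?andbT. Qed.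

(* Each U above A is reached from A through any of the elements of U \ A. *)
Lemma sum_slice_U1 A (h : T -> {set T} -> K) :
  \sum_(x in ~: A) \sum_(U in slice (x |: A)) h x U =
  \sum_(U in slice A) \sum_(x in U :\: A) h x U.
Proof.
rewrite (exchange_big_dep (mem (slice A))) /=; last first.
  by move=> x U; rewrite in_setC => xA; rewrite slice_U1 // => /andP[].
apply: eq_bigr => U UA; apply: eq_bigl => x; rewrite in_setC.
case: (boolP (x \in A)) => [xA|xA] /=; first by rewrite inE xA.
by rewrite slice_U1 // UA.
Qed.

Definition slice_mean A F : K := (\sum_(U in slice A) F U) / #|slice A|%:R.

Lemma slice_meanE A F : \sum_(U in slice A) F U = #|slice A|%:R * slice_mean A F.
Proof.
rewrite /slice_mean; case: (posnP #|slice A|) => [c0|cp].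
  by rewrite c0 mul0r big1 // => U; rewrite (card0_eq c0).
by rewrite mulrC divfK // pnatr_eq0 -lt0n.
Qed.

(** A swap that takes x out of U survives conditioning on every element of [U :\: A] except x
    itself, hence on j of the [j.+1] elements. *)
Lemma swap_energy_U1 A h j : (#|A| + j.+1 = M)%N ->
  \sum_(x in ~: A) swap_energy (x |: A) h = j%:R * swap_energy A h.
Proof.
move=> AM; rewrite /swap_energy sum_slice_U1 mulr_sumr; apply: eq_bigr => U.
rewrite inE => /andP[AU /eqP UM].
set f := fun x => \sum_(y in ~: U) h U (swapset x y U).
have cU : #|U :\: A| = j.+1.
  by rewrite cardsD (setIidPr AU) UM -AM addKn.
transitivity (\sum_(x in U :\: A) (\sum_(z in U :\: A) f z - f x)).
  apply: eq_bigr => x xU; rewrite [in RHS](big_setD1 x xU) /= addrAC subrr add0r.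
  by apply: eq_bigl => z; rewrite !inE negb_or andbA.
by rewrite sumrB sumr_const cU mulrS addrAC subrr add0r mulr_natl.
Qed.

(** Induction on the number j of unrevealed elements. Revealing one splits the variance into the
    variances inside the pieces [slice (x |: A)], treated by induction, and the variance of their
    means [gx], treated by transporting one piece onto another. The two parts use j shares and one
    share of the energy; as every U is counted [j.+1] times, the constant is the same at every
    stage. *)
Lemma slice_poincare j A F : (#|A| + j = M)%N -> (M < #|T|)%N ->
  \sum_(U in slice A) (F U - slice_mean A F) ^+ 2 <=
  swap_energy A (fun U V => (F U - F V) ^+ 2) / (2 * (#|T| - M)%:R).
Proof.
move=> AM MT; set e := fun U V => (F U - F V) ^+ 2.
have e0 B : 0 <= swap_energy B e.
  by do 3 (apply: sumr_ge0 => ? _); apply: sqr_ge0.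
have tM : (0 : K) < (#|T| - M)%:R by rewrite ltr0n subn_gt0.
elim: j A AM => [|j IH] A AM.
  rewrite big1 ?divr_ge0 ?mulr_ge0 // => U UA.
  have sA : slice A = [set A].
    apply/setP => V; rewrite !inE; apply/andP/eqP => [[AV /eqP VM]|->].
      by apply/esym/eqP; rewrite eqEcard AV VM -AM addn0 leqnn.
    by rewrite subxx -AM addn0 eqxx.
  rewrite sA inE in UA; rewrite (eqP UA) /slice_mean sA big_set1 cards1 divr1 subrr.
  by rewrite expr0n.
set s := #|~: A|.
have sE : s = (#|T| - #|A|)%N by rewrite /s cardsCs setCK.
have s0 : (0 < s)%N by rewrite sE subn_gt0 (leq_trans _ MT) // ltnS -AM leq_addr.
have sM : (#|T| - M <= s)%N by rewrite sE leq_sub2l // -AM leq_addr.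
have /card_gt0P[x0 x0A] : (0 < #|~: A|)%N by [].
set c := #|slice (x0 |: A)|.
have cE x : x \in ~: A -> #|slice (x |: A)| = c.
  by move=> xA; apply: card_slice_swap; rewrite -in_setC.
have cA : forall U, U \in slice A -> #|U :\: A| = j.+1.
  by move=> U; rewrite inE => /andP[AU /eqP UM]; rewrite cardsD (setIidPr AU) UM -AM addKn.
set g := slice_mean A F; set gx := fun x => slice_mean (x |: A) F.
have scA : (s%:R * c%:R = j.+1%:R * #|slice A|%:R :> K).
  have := sum_slice_U1 A (fun _ _ => 1).
  rewrite (eq_bigr (fun=> c%:R)) => [|x xA]; last by rewrite sumr_const cE.
  rewrite [in RHS](eq_bigr (fun=> j.+1%:R)) => [|U UA]; last by rewrite sumr_const cA.
  by rewrite !sumr_const -/s => sc; rewrite mulr_natl sc mulr_natr.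
have sumF : s%:R * (c%:R * g) = c%:R * \sum_(x in ~: A) gx x.
  rewrite mulrA scA -mulrA -slice_meanE [RHS]mulr_sumr.
  transitivity (\sum_(x in ~: A) \sum_(U in slice (x |: A)) F U); last first.
    by apply: eq_bigr => x xA; rewrite slice_meanE cE.
  rewrite (sum_slice_U1 A (fun _ U => F U)) mulr_sumr; apply: eq_bigr => U UA.
  by rewrite sumr_const cA // mulr_natl.
have jV : j.+1%:R * \sum_(U in slice A) (F U - g) ^+ 2 =
    \sum_(x in ~: A) \sum_(U in slice (x |: A)) (F U - gx x) ^+ 2 +
    c%:R * \sum_(x in ~: A) (gx x - g) ^+ 2.
  rewrite mulr_sumr.
  transitivity (\sum_(x in ~: A) \sum_(U in slice (x |: A)) (F U - g) ^+ 2).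
    rewrite (sum_slice_U1 A (fun _ U => (F U - g) ^+ 2)); apply: eq_bigr => U UA.
    by rewrite sumr_const cA // mulr_natl.
  rewrite mulr_sumr -big_split; apply: eq_bigr => x xA /=.
  by rewrite (@sqr_dev_sum _ _ _ _ _ (gx x)) ?cE // slice_meanE cE.
(* The transposition of x and y maps the piece above x onto the piece above y, so [gx x - gx y] is
   the mean of [F U - F (swapset x y U)], and Cauchy-Schwarz turns its square into energy. *)
have cv : c%:R * \sum_(x in ~: A) (gx x - g) ^+ 2 <= swap_energy A e / (2 * s%:R).
  case: (posnP c) => [c0|cp]; first by rewrite c0 mul0r divr_ge0 ?mulr_ge0.
  have cpR : (0 : K) < c%:R by rewrite ltr0n.
  have Hm : \sum_(x in ~: A) gx x = #|~: A|%:R * g.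
    by apply: (mulfI (lt0r_neq0 cpR)); rewrite -sumF; ring.
  rewrite ler_pdivlMr ?mulr_gt0 ?ltr0n //.
  have -> : c%:R * (\sum_(x in ~: A) (gx x - g) ^+ 2) * (2 * s%:R) =
     c%:R * (\sum_(x in ~: A) \sum_(y in ~: A) (gx x - gx y) ^+ 2).
    by rewrite (sqr_pair_sum Hm) -/s; ring.
  rewrite mulr_sumr.
  apply: (le_trans (y := \sum_(x in ~: A) \sum_(U in slice (x |: A)) \sum_(y in ~: A) e U (swapset x y U))).
    apply: ler_sum => x xA; rewrite exchange_big mulr_sumr /=; apply: ler_sum => y yA.
    rewrite -(ler_pM2l cpR) mulrA -expr2 -exprMn mulrBr.
    have -> : c%:R * gx x - c%:R * gx y = \sum_(U in slice (x |: A)) (F U - F (swapset x y U)).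
      rewrite -{1}(cE x xA) -(cE y yA) -!slice_meanE sumrB; congr (_ - _).
      by apply: sum_slice_swap; rewrite -in_setC.
    by rewrite -(cE x xA); apply: sqr_sum_le.
  rewrite (sum_slice_U1 A (fun x U => \sum_(y in ~: A) e U (swapset x y U))).
  apply: ler_sum => U UA; apply: ler_sum => x xU.
  (* If y lies in U as well, the swap fixes U and contributes nothing. *)
  rewrite (bigID (fun y => y \in U)) /= big1 ?add0r.
    rewrite le_eqVlt; apply/orP; left; apply/eqP; apply: eq_bigl => y.
    rewrite !inE; move: UA; rewrite inE => /andP[/subsetP AU _].
    by case: (boolP (y \in A)) => //= /AU ->.
  by move=> y /andP[_ yU]; rewrite swapset_id //; [rewrite /e subrr expr0n|move: xU; rewrite inE => /andP[]].
have IHs : \sum_(x in ~: A) \sum_(U in slice (x |: A)) (F U - gx x) ^+ 2 <=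
    j%:R * swap_energy A e / (2 * (#|T| - M)%:R).
  rewrite -(swap_energy_U1 _ AM) mulr_suml; apply: ler_sum => x xA.
  by apply: IH; rewrite cardsU1 -in_setC xA add1n addSn -addnS.
have cmp : swap_energy A e / (2 * s%:R) <= swap_energy A e / (2 * (#|T| - M)%:R).
  rewrite ler_wpM2l // lef_pV2 ?posrE ?mulr_gt0 ?ltr0n ?subn_gt0 //.
  by rewrite ler_pM2l // ler_nat.
have jp : (0 : K) < j.+1%:R by rewrite ltr0n.
rewrite -(ler_pM2l jp) jV -natr1 mulrDl mul1r mulrA.
apply: lerD; first exact: IHs.
exact: le_trans cv cmp.
Qed.

Lemma mem_slice0 U : (U \in slice set0) = (#|U| == M).
Proof. by rewrite inE sub0set. Qed.

Lemma swap_energy0E h : swap_energy set0 h =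
  \sum_x \sum_y \sum_(U : {set T} | [&& #|U| == M, x \in U & y \notin U]) h U (swapset x y U).
Proof.
rewrite /swap_energy.
transitivity (\sum_(U in slice set0) \sum_x \sum_y
   (if (x \in U) && (y \notin U) then h U (swapset x y U) else 0)).
  apply: eq_bigr => U _; rewrite setD0 [LHS]big_mkcond; apply: eq_bigr => x _.
  case: (boolP (x \in U)) => xU /=; last by rewrite big1.
  by rewrite big_mkcond; apply: eq_bigr => y _; rewrite in_setC.
rewrite exchange_big; apply: eq_bigr => x _; rewrite exchange_big; apply: eq_bigr => y _ /=.
by rewrite -big_mkcondr; apply: eq_bigl => U; rewrite mem_slice0.
Qed.

Lemma swap_energy_sym h : swap_energy set0 (fun U V => h V U) = swap_energy set0 h.
Proof.
rewrite !swap_energy0E exchange_big; apply: eq_bigr => x _; apply: eq_bigr => y _ /=.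
rewrite (reindex_inj (inv_inj (swapsetK x y))) /=; apply: eq_big => [U|U _].
  rewrite card_swapset; congr (_ && _).
  have memE z : (z \in swapset x y U) = (tperm x y z \in U).
    by rewrite -{1}[z](tpermK x y) mem_imset //; apply: perm_inj.
  by rewrite !memE tpermL tpermR andbC.
by rewrite {2}/swapset tpermC -/(swapset x y _) swapsetK.
Qed.

Lemma swap_energy_const (h : {set T} -> K) : (M <= #|T|)%N ->
  swap_energy set0 (fun U _ => h U) = (M * (#|T| - M))%:R * \sum_(U in slice set0) h U.
Proof.
move=> MT; rewrite /swap_energy mulr_sumr; apply: eq_bigr => U; rewrite mem_slice0 => /eqP UM.
by rewrite setD0 !sumr_const cardsCs setCK UM -mulrnA mulr_natl mulnC.
Qed.

Lemma ler_swap_energy A (h h' : {set T} -> {set T} -> K) :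
  (forall x y U, U \in slice A -> x \in U -> y \notin U ->
     h U (swapset x y U) <= h' U (swapset x y U)) ->
  swap_energy A h <= swap_energy A h'.
Proof.
move=> H; apply: ler_sum => U UA; apply: ler_sum => x; rewrite inE => /andP[_ xU].
by apply: ler_sum => y; rewrite inE => yU; apply: H.
Qed.

Lemma swap_energyD A (h h' : {set T} -> {set T} -> K) :
  swap_energy A (fun U V => h U V + h' U V) = swap_energy A h + swap_energy A h'.
Proof.
rewrite -big_split; apply: eq_bigr => U _; rewrite -big_split.
by apply: eq_bigr => x _; rewrite -big_split.
Qed.

Lemma swap_energyZ A c (h : {set T} -> {set T} -> K) :
  swap_energy A (fun U V => c * h U V) = c * swap_energy A h.
Proof.
rewrite mulr_sumr; apply: eq_bigr => U _; rewrite mulr_sumr.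
by apply: eq_bigr => x _; rewrite mulr_sumr.
Qed.

Definition slice_avg (h : {set T} -> K) : K := slice_mean set0 h.

Definition swap_avg h : K :=
  swap_energy set0 h / ((M * (#|T| - M))%:R * #|slice set0|%:R).

End Slice.

Lemma subrX_le (K : realFieldType) (a b A : K) n : `|a| <= A -> `|b| <= A ->
  `|a ^+ n - b ^+ n| <= n%:R * `|a - b| * A ^+ n.-1.
Proof.
move=> aA bA; case: n => [|n]; first by rewrite !expr0 subrr normr0 !mul0r.
rewrite subrXX normrM -mulrA [X in _ <= X]mulrCA ler_wpM2l //.
apply: (le_trans (ler_norm_sum _ _ _)).
have -> : n.+1%:R * A ^+ n = \sum_(i < n.+1) A ^+ n by rewrite sumr_const card_ord mulr_natl.
apply: ler_sum => i _.
have hi : (i <= n)%N by rewrite -ltnS.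
have A0 : 0 <= A by apply: le_trans aA.
have -> : A ^+ n = A ^+ (n - i) * A ^+ i by rewrite -exprD subnK.
rewrite normrM !normrX.
by apply: ler_pM; rewrite ?exprn_ge0 // lerXn2r ?nnegrE.
Qed.

(* Young's inequality with the constants needed to absorb the first term on the right. *)
Lemma sqr_subrX_le (K : realFieldType) (a b L : K) q : (0 < q)%N -> ~~ odd q -> 0 <= L ->
  L / 2 * (a ^+ q - b ^+ q) ^+ 2 <=
  (a ^+ (2 * q) + b ^+ (2 * q)) / 8 + (4 * q%:R ^+ 2) ^+ q * (L ^+ q * (a - b) ^+ (2 * q)).
Proof.
move=> q0 oq L0; set A : K := Num.max `|a| `|b|; set d : K := `|a - b|.
have A0 : 0 <= A by rewrite le_max normr_ge0.
have d0 : 0 <= d by apply: normr_ge0.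
have dq : (a - b) ^+ (2 * q) = (d ^+ 2) ^+ q by rewrite /d real_normK ?num_real // -exprM.
have hA : A ^+ (2 * q) <= a ^+ (2 * q) + b ^+ (2 * q).
  have aa : `|a| ^+ (2 * q) = a ^+ (2 * q) by rewrite exprM real_normK ?num_real // -exprM.
  have bb : `|b| ^+ (2 * q) = b ^+ (2 * q) by rewrite exprM real_normK ?num_real // -exprM.
  rewrite /A -aa -bb; case: (leP `|a| `|b|) => _; [rewrite lerDr|rewrite lerDl]; exact: exprn_ge0.
have h1 : (a ^+ q - b ^+ q) ^+ 2 <= q%:R ^+ 2 * d ^+ 2 * (A ^+ 2) ^+ q.-1.
  have h : `|a ^+ q - b ^+ q| <= q%:R * d * A ^+ q.-1.
    by apply: subrX_le; rewrite le_max lexx ?orbT.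
  rewrite -real_normK ?num_real // -exprM mulnC exprM -!exprMn.
  by rewrite lerXn2r ?nnegrE // (le_trans (normr_ge0 _) h).
set Y := 4 * (q%:R ^+ 2 * L * d ^+ 2).
have Y0 : 0 <= Y by rewrite /Y !mulr_ge0 ?sqr_ge0.
have YE : (4 * q%:R ^+ 2) ^+ q * (L ^+ q * (a - b) ^+ (2 * q)) = Y ^+ q.
  by rewrite dq -!exprMn; congr (_ ^+ _); rewrite /Y; ring.
have A20 : 0 <= A ^+ 2 by apply: sqr_ge0.
have h2 : L / 2 * (a ^+ q - b ^+ q) ^+ 2 <= Y * (A ^+ 2) ^+ q.-1 / 8.
  apply: (le_trans (ler_wpM2l _ h1)); first by rewrite divr_ge0.
  by rewrite /Y le_eqVlt; apply/orP; left; apply/eqP; field.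
apply: (le_trans h2); rewrite YE.
have yq : 0 <= Y ^+ q by rewrite exprn_ge0.
(* If Y is at most A^2, one factor Y is traded for A^2 and the factor 1/8 is kept; otherwise every
   A^2 is traded for Y and the whole is below Y^q. *)
have [YA|AY] := leP Y (A ^+ 2).
  apply: (@le_trans _ _ (A ^+ (2 * q) / 8)); last first.
    by rewrite -[X in X <= _]addr0; apply: lerD => //; rewrite ler_wpM2r // invr_ge0.
  rewrite ler_wpM2r ?invr_ge0 // exprM -[in X in _ <= X](prednK q0) (exprS (A ^+ 2)).
  by rewrite ler_wpM2r // exprn_ge0.
apply: (@le_trans _ _ (Y ^+ q)); last first.
  have ev c : 0 <= c ^+ (2 * q) :> K by rewrite exprM exprn_ge0 // sqr_ge0.
  by rewrite lerDr divr_ge0 // addr_ge0.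
rewrite -[in X in _ <= X](prednK q0) (exprS Y).
apply: (@le_trans _ _ (Y * (A ^+ 2) ^+ q.-1)).
  rewrite -[X in _ <= X]mulr1 ler_wpM2l ?mulr_ge0 ?exprn_ge0 // invf_le1 //; lra.
rewrite ler_wpM2l // lerXn2r ?nnegrE //; exact: ltW.
Qed.

(** * Averages over the slice and over its swaps *)

Section Moments.
Variables (K : realFieldType) (T : finType) (M : nat).
Hypotheses (M0 : (0 < M)%N) (MT : (M < #|T|)%N).
Implicit Types (F h : {set T} -> K).

Let Ex h := slice_avg M h.
Let Sw := @swap_avg K T M.

Lemma slice0_gt0 : (0 < #|slice (T := T) M set0|)%N.
Proof.
have e : slice M set0 = [set U : {set T} | #|U| == M].
  by apply/setP => U; rewrite mem_slice0 inE.
by rewrite e card_draws bin_gt0 ltnW.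
Qed.

Let c0 : (0 : K) < #|slice (T := T) M set0|%:R.
Proof. by rewrite ltr0n slice0_gt0. Qed.

Let MM0 : (0 : K) < (M * (#|T| - M))%:R.
Proof. by rewrite ltr0n muln_gt0 M0 subn_gt0. Qed.

Lemma slice_avgE h : Ex h = (\sum_(U in slice M set0) h U) / #|slice (T := T) M set0|%:R.
Proof. by []. Qed.

Lemma slice_avg_ge0 h : (forall U, 0 <= h U) -> 0 <= Ex h.
Proof. by move=> h0; apply: divr_ge0; [apply: sumr_ge0 => U _; exact: h0|exact: ler0n]. Qed.

Lemma ler_swap_avg (g h : {set T} -> {set T} -> K) :
  (forall x y (U : {set T}), #|U| = M -> x \in U -> y \notin U ->
     g U (swapset x y U) <= h U (swapset x y U)) -> Sw g <= Sw h.
Proof.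
move=> H; rewrite /Sw /swap_avg ler_wpM2r ?invr_ge0 ?mulr_ge0 //.
by apply: ler_swap_energy => x y U; rewrite mem_slice0 => /eqP; apply: H.
Qed.

Lemma swap_avg_ge0 (h : {set T} -> {set T} -> K) : (forall U V, 0 <= h U V) -> 0 <= Sw h.
Proof.
move=> h0; rewrite /Sw /swap_avg divr_ge0 ?mulr_ge0 //.
by do 3 (apply: sumr_ge0 => ? _); apply: h0.
Qed.

Lemma swap_avgZ c (h : {set T} -> {set T} -> K) : Sw (fun U V => c * h U V) = c * Sw h.
Proof. by rewrite /Sw /swap_avg swap_energyZ mulrA. Qed.

Lemma swap_avgD (g h : {set T} -> {set T} -> K) :
  Sw (fun U V => g U V + h U V) = Sw g + Sw h.
Proof. by rewrite /Sw /swap_avg swap_energyD mulrDl. Qed.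

Lemma swap_avgl h : Sw (fun U _ => h U) = Ex h.
Proof.
rewrite /Sw /swap_avg swap_energy_const ?(ltnW MT) //.
by rewrite -mulf_div divff ?lt0r_neq0 // mul1r.
Qed.

Lemma swap_avgr h : Sw (fun _ V => h V) = Ex h.
Proof. by rewrite -swap_avgl /Sw /swap_avg -swap_energy_sym. Qed.

Lemma slice_avg_poincare F :
  Ex (fun U => F U ^+ 2) <= M%:R / 2 * Sw (fun U V => (F U - F V) ^+ 2) + Ex F ^+ 2.
Proof.
have P := @slice_poincare K T M M set0 F; rewrite cards0 add0n in P.
have {P} := P erefl MT.
set E := swap_energy _ _ => P.
have D : Ex (fun U => F U ^+ 2) =
   (\sum_(U in slice M set0) (F U - slice_mean M set0 F) ^+ 2) / #|slice (T := T) M set0|%:R + Ex F ^+ 2.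
  rewrite slice_avgE.
  transitivity ((\sum_(U in slice M set0) (F U - 0) ^+ 2) / #|slice (T := T) M set0|%:R).
    by congr (_ / _); apply: eq_bigr => U _; rewrite subr0.
  rewrite (@sqr_dev_sum _ _ _ F 0 (slice_mean M set0 F)) ?slice_meanE // mulrDl subr0; congr (_ + _).
  by rewrite mulrAC divff ?lt0r_neq0 // mul1r.
rewrite D lerD2r /Sw /swap_avg -/E ler_pdivrMr //; apply: (le_trans P).
have t0 : (0 : K) < (#|T| - M)%:R by rewrite ltr0n subn_gt0.
have m0 : (0 : K) < M%:R by rewrite ltr0n.
rewrite natrM le_eqVlt; apply/orP; left; apply/eqP; field.
by rewrite !lt0r_neq0.
Qed.

Lemma sqr_swap_avg_le (h : {set T} -> {set T} -> K) : Sw h ^+ 2 <= Sw (fun U V => h U V ^+ 2).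
Proof.
set s := Sw h.
have := swap_avg_ge0 (h := fun U V => (h U V - s) ^+ 2) (fun U V => sqr_ge0 _).
have -> : Sw (fun U V => (h U V - s) ^+ 2) = Sw (fun U V => h U V ^+ 2) - s ^+ 2.
  have -> : Sw (fun U V => (h U V - s) ^+ 2) =
     Sw (fun U V => h U V ^+ 2 + (- (2 * s) * h U V + s ^+ 2)).
    rewrite /Sw /swap_avg /swap_energy; congr (_ / _).
    by do 3 (apply: eq_bigr => ? _); ring.
  have Es : Ex (fun=> s ^+ 2) = s ^+ 2.
    by rewrite slice_avgE sumr_const -(mulr_natr (s ^+ 2)) mulfK // lt0r_neq0.
  rewrite !swap_avgD swap_avgZ -/s (swap_avgl (fun=> s ^+ 2)) Es; ring.
by rewrite subr_ge0.
Qed.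

End Moments.

(** Doubling of the exponent: the Poincare inequality is applied to F^q. Its energy is split by
    [sqr_subrX_le], whose first term averages to a quarter of the moment being bounded and moves to
    the left. The squared mean of F^q that remains is bounded by the square of the inductive
    estimate, followed by Cauchy-Schwarz. *)
Lemma slice_moment (K : realFieldType) (j : nat) : exists2 C : K, 0 < C &
  forall (T : finType) (M : nat) (F : {set T} -> K), (0 < M)%N -> (M < #|T|)%N ->
  slice_avg M F = 0 ->
  slice_avg M (fun U => F U ^+ (2 ^ j.+1)) <=
  C * M%:R ^+ (2 ^ j) * swap_avg M (fun U V => (F U - F V) ^+ (2 ^ j.+1)).
Proof.
elim: j => [|j [C C0 IH]].
  exists 1 => // T M F M0 MT F0.
  rewrite expn1 expn0 expr1 mul1r; apply: (le_trans (slice_avg_poincare M0 MT F)).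
  rewrite F0 expr0n addr0 ler_wpM2r ?swap_avg_ge0 // => [U V|]; first exact: sqr_ge0.
  rewrite ler_pdivrMr // ler_peMr //; lra.
set q := (2 ^ j.+1)%N.
(* The first summand is the constant of [sqr_subrX_le], the second the squared inductive constant; 2
   exceeds the factor 4/3 lost by absorbing a quarter of the left side. *)
exists (2 * ((4 * q%:R ^+ 2) ^+ q + C ^+ 2)).
  by rewrite mulr_gt0 // ltr_wpDl ?exprn_ge0 ?mulr_ge0 ?sqr_ge0 ?exprn_gt0.
move=> T M F M0 MT F0.
have qq : (2 ^ j.+2 = 2 * q)%N by rewrite expnS.
have qh : (q = 2 * 2 ^ j)%N by rewrite /q expnS.
have q0 : (0 < q)%N by rewrite expn_gt0.
have oq : ~~ odd q by rewrite oddX.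
rewrite qq.
set y := slice_avg M _; set w := swap_avg M _.
have IH' := IH T M F M0 MT F0; rewrite -/q in IH'.
have P := slice_avg_poincare M0 MT (fun U => F U ^+ q).
have M2 : (0 : K) <= M%:R by [].
have y1 : y <= y / 4 + (4 * q%:R ^+ 2) ^+ q * (M%:R ^+ q * w) + (slice_avg M (fun U => F U ^+ q)) ^+ 2.
  have yE : y = slice_avg M (fun U => (F U ^+ q) ^+ 2).
    by rewrite /y /slice_avg /slice_mean; congr (_ / _); apply: eq_bigr => U _; rewrite -exprM mulnC.
  rewrite {1}yE; apply: (le_trans P); rewrite lerD2r -swap_avgZ.
  have -> : y / 4 + (4 * q%:R ^+ 2) ^+ q * (M%:R ^+ q * w) =
    swap_avg M (fun U V => (8^-1 * F U ^+ (2 * q) + 8^-1 * F V ^+ (2 * q)) +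
       ((4 * q%:R ^+ 2) ^+ q * M%:R ^+ q) * (F U - F V) ^+ (2 * q)).
    rewrite !swap_avgD !swap_avgZ -/w.
    rewrite (@swap_avgl K T M M0 MT (fun U => F U ^+ (2 * q))) (@swap_avgr K T M M0 MT (fun U => F U ^+ (2 * q))) -/y.
    by field.
  apply: ler_swap_avg => x z U _ _ _.
  rewrite -mulrDr [8^-1 * _]mulrC -(mulrA (_ ^+ q)).
  exact: sqr_subrX_le.
have y0 : 0 <= slice_avg M (fun U => F U ^+ q).
  by apply: slice_avg_ge0 => // U; rewrite qh exprM exprn_ge0 // sqr_ge0.
have w1 : (slice_avg M (fun U => F U ^+ q)) ^+ 2 <= C ^+ 2 * (M%:R ^+ q * w).
  have Cw : 0 <= C * M%:R ^+ (2 ^ j) * swap_avg M (fun U V => (F U - F V) ^+ q).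
    exact: le_trans y0 IH'.
  apply: (le_trans (lerXn2r 2 _ _ IH')) => //.
  set sw := swap_avg _ _; rewrite exprMn exprMn -exprM -mulrA mulnC -qh ler_wpM2l ?sqr_ge0 // ler_wpM2l ?exprn_ge0 //.
  apply: (le_trans (sqr_swap_avg_le M0 MT _)).
  by apply: ler_swap_avg => // x z U _ _ _; rewrite -exprM mulnC.
have Z0 : 0 <= M%:R ^+ q * w.
  rewrite mulr_ge0 ?exprn_ge0 // swap_avg_ge0 // => U V.
  by rewrite exprM exprn_ge0 // sqr_ge0.
have K0 : 0 <= (4 * q%:R ^+ 2 : K) ^+ q by rewrite exprn_ge0 // mulr_ge0 // sqr_ge0.
rewrite -mulrA; set Z := M%:R ^+ q * w in y1 w1 Z0 *.
set k1 := (4 * _) ^+ q in y1 K0 *.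
have k1Z : 0 <= k1 * Z by rewrite mulr_ge0.
have c2Z : 0 <= C ^+ 2 * Z by rewrite mulr_ge0 // sqr_ge0.
have -> : 2 * (k1 + C ^+ 2) * Z = 2 * (k1 * Z) + 2 * (C ^+ 2 * Z) by ring.
lra.
Qed.

(** * Switching one vertex of one edge *)

Lemma mem_swapset (T : finType) (x y z : T) (U : {set T}) :
  (z \in swapset x y U) = (tperm x y z \in U).
Proof. by rewrite -{1}[z](tpermK x y) mem_imset //; apply: perm_inj. Qed.

Lemma swapsetC (T : finType) (x y : T) : swapset x y =1 swapset y x.
Proof. by move=> U; rewrite /swapset tpermC. Qed.

(* Edges through a that stay in H when a is replaced by b, the edges containing both included. *)
Definition fixed_deg (V : finType) (a b : V) (H : {set {set V}}) : nat :=
  #|[set f in H | (a \in f) && (swapset a b f \in H)]|.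

Lemma fixed_degC (V : finType) (a b : V) (H : {set {set V}}) :
  fixed_deg a b H = fixed_deg b a H.
Proof.
rewrite /fixed_deg -(card_imset _ (inv_inj (swapsetK a b))); apply: eq_card => f.
rewrite !inE -{1}[f](swapsetK a b) (mem_imset _ _ (inv_inj (swapsetK a b))) !inE.
rewrite mem_swapset tpermL swapsetK swapsetC.
by case: (_ \in H); case: (_ \in H); rewrite ?andbT ?andbF.
Qed.

Definition movable (V : finType) (a b : V) (H : {set {set V}}) : {set {set V}} :=
  [set f in H | (a \in f) && (swapset a b f \notin H)].

Lemma card_movable n (a b : 'I_n) (H : {set {set 'I_n}}) :
  (#|movable a b H| + fixed_deg a b H = degs n H a)%N.
Proof.
rewrite /degs ffunE -[RHS](cardsID [set f | swapset a b f \in H]) addnC.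
by congr (_ + _)%N; apply: eq_card => f; rewrite !inE; do ! case: (_ \in _).
Qed.

Lemma fixed_deg_le n (a b : 'I_n) (H : {set {set 'I_n}}) : (fixed_deg a b H <= degs n H a)%N.
Proof. by rewrite -(card_movable a b) leq_addl. Qed.

Lemma degs_exchange n (H : {set {set 'I_n}}) (f g : {set 'I_n}) (v : 'I_n) :
  f \in H -> g \notin H ->
  (degs n (g |: H :\ f) v + (v \in f) = degs n H v + (v \in g))%N.
Proof.
move=> fH gH; rewrite /degs !ffunE.
have gf : g != f by apply: contraNneq gH => ->.
pose B := [set e in H :\ f | v \in e].
have -> : #|[set e in H | v \in e]| = ((v \in f) + #|B|)%N.
  rewrite (cardsD1 f) inE fH; congr (_ + _)%N; apply: eq_card => e.
  by rewrite !inE andbA.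
have -> : #|[set e in g |: H :\ f | v \in e]| = ((v \in g) + #|B|)%N.
  rewrite (cardsD1 g) !inE eqxx /=; congr (_ + _)%N; apply: eq_card => e; rewrite !inE.
  by case: eqP => [->|] //=; rewrite (negbTE gH) !andbF.
by lia.
Qed.


Lemma mem_khg n k m (H : {set {set 'I_n}}) :
  (H \in khg n k m) = [forall e in H, #|e| == k] && (#|H| == m).
Proof. by rewrite inE. Qed.

Lemma khg_exchange n k m (H : {set {set 'I_n}}) (f g : {set 'I_n}) : f \in H -> g \notin H ->
  #|g| = #|f| -> H \in khg n k m -> g |: H :\ f \in khg n k m.
Proof.
move=> fH gH gf; rewrite !mem_khg => /andP[/forall_inP Hk /eqP Hm]; apply/andP; split.
  apply/forall_inP => e; rewrite !inE => /orP[/eqP ->|/andP[_ /Hk]] //.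
  by rewrite gf; apply: Hk.
rewrite cardsU1 !inE (negbTE gH) andbF /= add1n -Hm.
by rewrite [in X in _ == X](cardsD1 f H) fH.
Qed.

Section OneSwitch.
Variables (n k m : nat).
Implicit Types (a b : 'I_n) (d : degseq n) (p : {set {set 'I_n}} * {set 'I_n}).

Let exch a b p := (swapset a b p.2 |: p.1 :\ p.2, swapset a b p.2).

Let moved a b d p := ((p.1 \in khg n k m) && (degs n p.1 == d)) && (p.2 \in movable a b p.1).

Let exchC a b p : exch a b p = exch b a p.
Proof. by rewrite /exch swapsetC. Qed.

Let exchK a b d p : moved a b d p -> exch a b (exch a b p) = p.
Proof.
case: p => H f /andP[_ /=]; rewrite inE => /and3P[fH cf gH]; rewrite /exch /= swapsetK.
congr (_, _); apply/setP => e; rewrite !inE.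
case: (eqVneq e f) => [->|ef] /=; first by rewrite fH.
by case: (eqVneq e (swapset a b f)) => [->|] //=; rewrite (negbTE gH).
Qed.

Let target_notin a b (H : {set {set 'I_n}}) (f : {set 'I_n}) :
  f \in H -> a \in f -> swapset a b f \notin H -> b \notin f.
Proof.
by move=> fH af gH; apply: contraNN gH => bf; rewrite swapset_id.
Qed.

Let moved_exch a b d d' p : a != b ->
  (forall v, (d' v + (v == a) = d v + (v == b))%N) -> moved a b d p -> moved b a d' (exch a b p).
Proof.
case: p => H f ab dd /andP[/= /andP[HK /eqP dH]]; rewrite inE => /and3P[fH af gH].
have bf := target_notin fH af gH.
rewrite /moved /exch /= khg_exchange ?card_swapset //= !inE mem_swapset tpermR af eqxx /=.
rewrite (swapsetC b a) swapsetK eqxx /= orbF.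
have -> : (f == swapset a b f) = false by apply/negbTE; apply: contraNneq gH => <-.
rewrite andbT; apply/eqP/ffunP => v.
have := degs_exchange v fH gH; rewrite mem_swapset => e.
have := dd v; rewrite -dH; move: e.
move: (degs n H v) (degs n _ v) (d' v) => x1 x2 x3.
case: (eqVneq v a) => [->|va].
  rewrite tpermL af (negbTE bf) (negbTE ab) /=.
  lia.
case: (eqVneq v b) => [->|vb].
  by rewrite tpermR af (negbTE bf) /=; lia.
have -> : tperm a b v = v by apply: tpermD; rewrite eq_sym.
by case: (v \in f) => /=; lia.
Qed.

(** Only f and its image change membership, and neither is ever counted: before the move the image
    of f is missing, after it f is. *)
Let fixed_exch a b d p : moved a b d p -> fixed_deg a b (exch a b p).1 = fixed_deg a b p.1.
Proof.
case: p => H f /andP[_ /=]; rewrite inE => /and3P[fH af gH]; rewrite /exch /=.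
have bf := target_notin fH af gH.
have aS : a \notin swapset a b f by rewrite mem_swapset tpermL.
apply: eq_card => e; rewrite !inE.
case: (boolP (a \in e)) => ae; last by rewrite !andbF.
have -> : (e == swapset a b f) = false by apply/negbTE; apply: contraNneq aS => <-.
have -> : (swapset a b e == swapset a b f) = (e == f) by rewrite (inj_eq (inv_inj (swapsetK a b))).
have efH : e == f -> (swapset a b e \in H) = false by move=> /eqP ->; apply: negbTE.
have sfH : swapset a b e == f -> (e \in H) = false.
  by move=> /eqP sf; rewrite -(swapsetK a b e) sf; apply: negbTE.
move: efH sfH; case: (e == f); case: (swapset a b e == f) => /= h1 h2; by rewrite ?(h1 isT) ?(h2 isT) ?andbF.
Qed.

(** Replacing a movable edge by its image is a bijection between the movable edges over d and those
    over d', inverted by the same map. Each hypergraph has degree minus [fixed_deg] of them. Since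
    the move preserves [fixed_deg], an arbitrary weight [phi] of it can be carried along, a freedom
    used later to truncate. *)
Lemma one_switch (K : realFieldType) a b (d d' : degseq n) (phi : nat -> K) : a != b ->
  (forall v, (d' v + (v == a) = d v + (v == b))%N) ->
  \sum_(H in khg n k m | degs n H == d) phi (fixed_deg a b H) * (d a)%:R
     - \sum_(H in khg n k m | degs n H == d) phi (fixed_deg a b H) * (fixed_deg a b H)%:R =
  \sum_(H in khg n k m | degs n H == d') phi (fixed_deg a b H) * (d' b)%:R
     - \sum_(H in khg n k m | degs n H == d') phi (fixed_deg a b H) * (fixed_deg a b H)%:R.
Proof.
move=> ab dd.
have side a1 b1 d1 : \sum_(H in khg n k m | degs n H == d1) phi (fixed_deg a1 b1 H) * (d1 a1)%:R
     - \sum_(H in khg n k m | degs n H == d1) phi (fixed_deg a1 b1 H) * (fixed_deg a1 b1 H)%:R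
  = \sum_(p | moved a1 b1 d1 p) phi (fixed_deg a1 b1 p.1).
  rewrite -sumrB -(pair_big_dep (fun H => (H \in khg n k m) && (degs n H == d1))
    (fun H f => f \in movable a1 b1 H) (fun H f => phi (fixed_deg a1 b1 H))) /=.
  apply: eq_bigr => H /andP[_ /eqP dH].
  by rewrite sumr_const -mulrBr -dH -(card_movable a1 b1) natrD addrK mulr_natr.
under [in RHS]eq_bigr => H _ do rewrite fixed_degC.
under [X in _ = _ - X]eq_bigr => H _ do rewrite fixed_degC.
rewrite !side (reindex_onto (exch b a) (exch a b)) => [|p mp]; last first.
  by rewrite (exchC b a) (exchK mp).
have dd' v : (d v + (v == b) = d' v + (v == a))%N by rewrite dd.
apply: eq_big => [p|p /andP[mp /eqP e]].
  apply/andP/idP => [[mp /eqP e]|mp].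
    by rewrite -e; apply: moved_exch mp.
  split; first by apply: moved_exch mp => //; rewrite eq_sym.
  by rewrite (exchC a b) (exchK mp).
rewrite -[in RHS]e [in RHS]fixed_degC (fixed_exch mp).
by [].
Qed.

End OneSwitch.

Local Close Scope ring_scope.

(** * Switching two edges *)

Lemma card_dep_le (A B : finType) (P : pred A) (Q : A -> pred B) c :
  (forall a, P a -> #|[set b | Q a b]| <= c) ->
  #|[set p | P p.1 && Q p.1 p.2]| <= #|[set a | P a]| * c.
Proof.
move=> H; rewrite -sum1_card.
rewrite (eq_bigl (fun p => P p.1 && Q p.1 p.2)) => [|p]; last by rewrite inE.
rewrite -(pair_big_dep P Q (fun _ _ => 1)) /= -sum1dep_card big_distrl /=.
apply: leq_sum => a Pa; rewrite mul1n; apply: leq_trans (H a Pa).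
by rewrite sum1dep_card.
Qed.

Lemma card_dep_ge (A B : finType) (P : pred A) (Q : A -> pred B) c :
  (forall a, P a -> c <= #|[set b | Q a b]|) ->
  #|[set a | P a]| * c <= #|[set p | P p.1 && Q p.1 p.2]|.
Proof.
move=> H; rewrite -[X in _ <= X]sum1_card.
rewrite [X in _ <= X](eq_bigl (fun p => P p.1 && Q p.1 p.2)) => [|p]; last by rewrite inE.
rewrite -(pair_big_dep P Q (fun _ _ => 1)) /= -sum1dep_card big_distrl /=.
apply: leq_sum => a Pa; rewrite mul1n; apply: leq_trans (H a Pa) _.
by rewrite sum1dep_card.
Qed.

Section TwoSwitch.
Variables (n k m Delta : nat) (d : degseq n).
Let V : finType := 'I_n.
Implicit Types (H : {set {set V}}) (e f g : {set V}) (p q : {set V} * V).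

Definition realizations : {set {set {set V}}} := [set H in khg n k m | degs n H == d].

(** An edge with a marked vertex. Two flags are switched by exchanging their marked vertices, which
    leaves every degree unchanged. *)
Definition flags H : {set {set V} * V} := [set p | (p.1 \in H) && (p.2 \in p.1)].

Definition exflag p q : {set V} * V := (q.2 |: p.1 :\ p.2, q.2).

Definition swappable H p q : bool :=
  [&& q \in flags H, q.2 \notin p.1, p.2 \notin q.1,
      (exflag p q).1 \notin H & (exflag q p).1 \notin H].

Definition swap2 H p q : {set {set V}} :=
  (exflag p q).1 |: ((exflag q p).1 |: H :\ q.1) :\ p.1.

Lemma exflagK p q : p.2 \in p.1 -> q.2 \notin p.1 -> exflag (exflag p q) (exflag q p) = p.
Proof.
case: p q => [e w] [g w'] /= we w'e; congr (_, _); apply/setP => z; rewrite !inE.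
have ww' : w != w' by apply: contraNneq w'e => <-.
case: (eqVneq z w) => [->|zw] /=; first by rewrite we.
by case: (eqVneq z w') => [->|] //=; rewrite (negbTE w'e).
Qed.

Lemma card_exflag p q : p.2 \in p.1 -> q.2 \notin p.1 -> #|(exflag p q).1| = #|p.1|.
Proof.
move=> wp qp; rewrite cardsU1 !inE (negbTE qp) andbF /=.
by rewrite [in RHS](cardsD1 p.2) wp.
Qed.

Lemma exflag_count p q v : q.2 \notin p.1 -> p.2 \in p.1 ->
  ((v \in (exflag p q).1) + (v == p.2) = (v \in p.1) + (v == q.2))%N.
Proof.
move=> qp pp; rewrite !inE; case: (eqVneq v p.2) => [->|vp].
  by rewrite pp (_ : (p.2 == q.2) = false) //; apply/negbTE; apply: contraNneq qp => <-.
by case: (eqVneq v q.2) => [->|vq]; rewrite ?(negbTE qp).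
Qed.

Lemma khg_card H e : H \in khg n k m -> e \in H -> #|e| = k.
Proof. by rewrite inE => /andP[/forall_inP Hk _] /Hk/eqP. Qed.

Section Step.
Variables (H : {set {set V}}) (p q : {set V} * V).
Hypotheses (HR : H \in realizations) (pH : p \in flags H) (sw : swappable H p q).

Let qH : q \in flags H. Proof. by case/and5P: sw. Qed.
Let qp : q.2 \notin p.1. Proof. by case/and5P: sw. Qed.
Let pq : p.2 \notin q.1. Proof. by case/and5P: sw. Qed.
Let e1H : (exflag p q).1 \notin H. Proof. by case/and5P: sw. Qed.
Let g1H : (exflag q p).1 \notin H. Proof. by case/and5P: sw. Qed.
Let eH : p.1 \in H. Proof. by move: pH; rewrite inE => /andP[]. Qed.
Let we : p.2 \in p.1. Proof. by move: pH; rewrite inE => /andP[]. Qed.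
Let gH : q.1 \in H. Proof. by move: qH; rewrite inE => /andP[]. Qed.
Let wg : q.2 \in q.1. Proof. by move: qH; rewrite inE => /andP[]. Qed.
Let eg : p.1 != q.1. Proof. by apply: contraNneq pq => <-. Qed.
Let ww : p.2 != q.2. Proof. by apply: contraNneq qp => <-. Qed.
Let e1g1 : (exflag p q).1 != (exflag q p).1.
Proof.
apply/eqP => /setP /(_ q.2); rewrite !inE eqxx /= (eq_sym q.2) (negbTE ww) /=.
by [].
Qed.
Let eH1 : p.1 \in (exflag q p).1 |: H :\ q.1.
Proof. by rewrite !inE eH eg orbT. Qed.
Let e1H1 : (exflag p q).1 \notin (exflag q p).1 |: H :\ q.1.
Proof. by rewrite !inE negb_or e1g1 negb_and e1H orbT. Qed.

Lemma swap2_realization : swap2 H p q \in realizations.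
Proof.
move: HR; rewrite !inE => /andP[HK /eqP dH].
have HK1 : (exflag q p).1 |: H :\ q.1 \in khg n k m.
  by apply: khg_exchange => //; [rewrite card_exflag|rewrite inE].
have := khg_exchange eH1 e1H1 (card_exflag we qp) HK1; rewrite !inE => -> /=.
apply/eqP/ffunP => v.
have := degs_exchange v eH1 e1H1; have := degs_exchange v gH g1H.
rewrite -dH -/(swap2 H p q).
have := exflag_count v pq wg; have := exflag_count v qp we.
move: (degs n H v) (degs n (_ |: _) v) (degs n (swap2 H p q) v) => x1 x2 x3.
move: (nat_of_bool (v == p.2)) (nat_of_bool (v == q.2)) (nat_of_bool (v \in p.1)) => x4 x5 x6.
move: (nat_of_bool (v \in q.1)) (nat_of_bool (v \in _)) (nat_of_bool (v \in _)) => x7 x8 x9.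
by clear; lia.
Qed.

Lemma mem_swap2 f : f \in H -> f != p.1 -> f != q.1 -> f \in swap2 H p q.
Proof. by move=> fH fp fq; rewrite !inE fH fp fq !orbT. Qed.

Lemma exflag_mem : exflag p q \in flags (swap2 H p q).
Proof. by rewrite !inE !eqxx. Qed.

Lemma exflag_mem' : exflag q p \in flags (swap2 H p q).
Proof.
rewrite inE; apply/andP; split; last by rewrite /exflag /= !inE eqxx.
rewrite in_setU1 in_setD1 in_setU1 eqxx /= andbT; apply/orP; right.
by apply: contraNneq g1H => e0; rewrite /exflag /= e0.
Qed.

Lemma swap2K : swap2 (swap2 H p q) (exflag p q) (exflag q p) = H.
Proof.
rewrite {1}/swap2 !exflagK //; apply/setP => f; rewrite !inE.
case: (eqVneq f p.1) => [->|fp] /=; first by rewrite eH.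
case: (eqVneq f (exflag p q).1) => [->|fe1] /=; first by rewrite (negbTE e1H).
case: (eqVneq f q.1) => [->|fq] /=; first by rewrite gH.
by case: (eqVneq f (exflag q p).1) => [->|fg1] //=; rewrite (negbTE g1H).
Qed.

End Step.

Hypothesis degD : forall v, d v <= Delta.
Hypothesis k2 : 1 < k.

Lemma deg_flags H v : H \in realizations -> #|[set e in H | v \in e]| = d v.
Proof. by rewrite inE => /andP[_ /eqP <-]; rewrite /degs ffunE. Qed.

Lemma realization_card H e : H \in realizations -> e \in H -> #|e| = k.
Proof. by rewrite inE => /andP[HK _]; apply: khg_card. Qed.

Lemma card_flags_at H v : H \in realizations ->
  #|[set p in flags H | v \in p.1]| <= d v * k.
Proof.
move=> HR; rewrite -(deg_flags v HR).
have -> : [set p in flags H | v \in p.1] =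
   [set p | [pred e | (e \in H) && (v \in e)] p.1 && (p.2 \in p.1)].
  by apply/setP => p; rewrite !inE -!andbA; case: (p.1 \in H); rewrite //= andbC.
apply: card_dep_le => e /andP[eH _].
by rewrite -(realization_card HR eH) subset_leq_card //; apply/subsetP => z; rewrite inE.
Qed.

Lemma card_flags_to H v : H \in realizations -> #|[set p in flags H | p.2 == v]| <= d v.
Proof.
move=> HR; rewrite -(deg_flags v HR) -(card_in_imset (f := fun p : {set V} * V => p.1)).
  apply/subset_leq_card/subsetP => e /imsetP[[f w]]; rewrite !inE /= => /andP[/andP[fH wf] /eqP wv] ->.
  by rewrite fH -wv.
by move=> [f w] [f' w']; rewrite !inE /= => /andP[_ /eqP ->] /andP[_ /eqP ->] ->.
Qed.

Lemma card_flags H : H \in realizations -> k * m <= #|flags H|.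
Proof.
move=> HR; have /andP[_ /eqP Hm] : [forall e in H, #|e| == k] && (#|H| == m).
  by move: HR; rewrite !inE => /andP[].
have e : #|[set e | e \in H]| = m by rewrite -Hm; apply: eq_card => e; rewrite inE.
rewrite mulnC -e; apply: card_dep_ge => f fH.
by rewrite -(realization_card HR fH) subset_leq_card //; apply/subsetP => z; rewrite inE.
Qed.

(** A chosen vertex of e other than w; for an edge of size k > 1 the default w is never the
    value. *)
Definition elt_but e w : V := odflt w [pick u in e :\ w].

Lemma elt_butP e w : #|e| = k -> elt_but e w \in e :\ w.
Proof.
move=> ek; rewrite /elt_but; case: pickP => //= e0.
have c0 : #|e :\ w| = 0 by apply: eq_card0.
by have := cardsD1 w e; rewrite ek c0; move: k2; case: (w \in e); clear; lia.
Qed.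

(* Four ways for a flag to be excluded; edges meeting a prescribed (k-1)-set are
   counted through one of its vertices, which costs a factor Delta only. *)
Lemma card_swappable H p : H \in realizations -> p \in flags H ->
  k * m <= #|[set q | swappable H p q]| + (2 * (k * Delta) + 2 * Delta ^ 2).
Proof.
move=> HR; rewrite inE => /andP[eH we].
set e := p.1 in eH we; set w := p.2 in we.
pose I1 := [set q in flags H | q.2 \in e].
pose I2 := [set q in flags H | w \in q.1].
pose I3 := [set q in flags H | (q.2 \notin e) && ((exflag p q).1 \in H)].
pose I4 := [set q in flags H | (w \notin q.1) && ((exflag q p).1 \in H)].
have sub : flags H \subset [set q | swappable H p q] :|: (I1 :|: I2 :|: (I3 :|: I4)).
  apply/subsetP => q qF; rewrite !inE /swappable qF; rewrite inE in qF; rewrite qF /= -/e -/w.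
  by case: (q.2 \in e); case: (w \in q.1); case: (_ |: _ \in H); case: (_ |: _ \in H);
    rewrite ?orbT ?andbT.
have by_tip (B : {set V}) (I : {set {set V} * V}) :
    (forall q, q \in I -> (q \in flags H) && (q.2 \in B)) -> #|I| <= #|B| * Delta.
  move=> HI; rewrite -sum1_card (partition_big (fun q => q.2) (mem B)) => [|q /HI /andP[]] //=.
  rewrite -sum_nat_const; apply: leq_sum => v _; apply: leq_trans (degD v).
  apply: leq_trans (card_flags_to v HR); rewrite sum1dep_card subset_leq_card //.
  by apply/subsetP => q; rewrite !inE => /andP[/HI /andP[]]; rewrite inE => -> _ ->.
have c1 : #|I1| <= k * Delta.
  by rewrite -(realization_card HR eH); apply: by_tip => q; rewrite !inE.
have c2 : #|I2| <= k * Delta.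
  by rewrite mulnC (leq_trans (card_flags_at w HR)) // leq_mul2r degD orbT.
have c3 : #|I3| <= Delta ^ 2.
  pose B := [set v | (v \notin e) && (v |: e :\ w \in H)].
  apply: (@leq_trans (#|B| * Delta)).
    by apply: by_tip => q; rewrite !inE => /and3P[-> -> /=].
  rewrite leq_mul2r; apply/orP; right.
  apply: leq_trans (degD (elt_but e w)); rewrite -(deg_flags _ HR).
  rewrite -(card_in_imset (f := fun v => v |: e :\ w)).
    apply/subset_leq_card/subsetP => f /imsetP[v]; rewrite inE => /andP[ve vH] ->.
    by rewrite inE vH in_setU1 (elt_butP w (realization_card HR eH)) orbT.
  move=> v v'; rewrite !inE => /andP[ve _] _ /setP /(_ v); rewrite !inE eqxx (negbTE ve) andbF.
  by move=> /esym; rewrite orbF => /eqP.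
(* The created edge h contains w, and the old edge g contains [h :\ w], in particular [elt_but h w].
   The pair (h, g) determines the flag: its marked vertex is the element of g missing from h. *)
have c4 : #|I4| <= Delta ^ 2.
  pose J := [set P : {set V} * {set V} | [pred h | (h \in H) && (w \in h)] P.1 &&
                  [pred g | (g \in H) && (elt_but P.1 w \in g)] P.2].
  apply: (@leq_trans #|J|); last first.
    apply: (@leq_trans (#|[set h in H | w \in h]| * Delta)).
      apply: (card_dep_le (P := [pred h | (h \in H) && (w \in h)])
        (Q := fun h => [pred g | (g \in H) && (elt_but h w \in g)])) => h _.
      by apply: leq_trans (degD (elt_but h w)); rewrite -(deg_flags _ HR).
    by rewrite (deg_flags w HR) leq_mul2r degD orbT.
  rewrite -(card_in_imset (f := fun q : {set V} * V => ((exflag q p).1, q.1))).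
    apply/subset_leq_card/subsetP => P /imsetP[[g w']]; rewrite !inE /= => /andP[/andP[gH wg] /andP[wng g1H]] ->.
    rewrite !inE /= g1H eqxx gH /=.
    have := elt_butP w (realization_card HR g1H).
    by rewrite !inE => /andP[/negbTE -> /andP[]].
  move=> [g w'] [g' w'']; rewrite !inE /= => /andP[/andP[_ wg] /andP[wng _]] /andP[/andP[_ wg'] _].
  move=> [/setP /(_ w') eq1 gg']; rewrite -gg' in eq1 wg' *; congr (_, _).
  move: eq1; rewrite !inE eqxx wg /= orbF andbT -/w.
  have -> : (w' == w) = false by apply/negbTE; apply: contraNneq wng => <-.
  by move=> /esym/negbT; rewrite negbK => /eqP.
apply: leq_trans (card_flags HR) _; apply: leq_trans (subset_leq_card sub) _.
apply: leq_trans (leq_card_setU _ _) _; rewrite leq_add2l.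
apply: leq_trans (leq_card_setU _ _) _; apply: leq_add; apply: leq_trans (leq_card_setU _ _) _.
  by rewrite mul2n -addnn leq_add.
by rewrite mul2n -addnn leq_add.
Qed.

Hypothesis sparse : 2 * (2 * (k * Delta) + 2 * Delta ^ 2) <= k * m.

(* Double counting of the swaps (H, p, q) -> (swap2 H p q, exflag p q, exflag q p). *)
Lemma two_switch (X : finType) (Q : {set {set V}} -> {set V} * V -> X -> bool)
  (P : {set {set V}} -> ({set V} * V) * ({set V} * V) * X -> bool) :
  (forall H p q x, H \in realizations -> p \in flags H -> Q H p x -> swappable H p q ->
     P (swap2 H p q) (exflag p q, exflag q p, x)) ->
  k * m * #|[set t : {set {set V}} * (({set V} * V) * X) |
        (t.1 \in realizations) && ((t.2.1 \in flags t.1) && Q t.1 t.2.1 t.2.2)]| <=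
  2 * #|[set t : {set {set V}} * (({set V} * V) * ({set V} * V) * X) |
        (t.1 \in realizations) && [&& t.2.1.1 \in flags t.1, t.2.1.2 \in flags t.1 & P t.1 t.2]]|.
Proof.
move=> QP.
set A := [set t | _]; set B := [set t | _].
pose C := [set s : ({set {set V}} * (({set V} * V) * X)) * ({set V} * V) |
             (s.1 \in A) && swappable s.1.1 s.1.2.1 s.2].
have AC : k * m * #|A| <= 2 * #|C|.
  (* By [sparse] at most half of the km flags are excluded, so each flag has at least
     [uphalf (k * m)] partners; rounding up keeps the factor 2 valid for odd km. *)
  have H2 : #|[set a | a \in A]| * uphalf (k * m) <= #|C|.
    apply: (card_dep_ge (P := [pred a | a \in A])
      (Q := fun a => [pred q | swappable a.1 a.2.1 q])) => -[H [p x]].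
    rewrite inE inE /= => /and3P[HR pH _].
    have h := card_swappable HR pH.
    have -> : [set b | [pred q | swappable H p q] b] = [set q | swappable H p q].
      by apply/setP => q; rewrite !inE.
    rewrite uphalf_half; move: (odd_double_half (k * m)) sparse h.
    move: (k * m) (odd _) ((k * m)./2) (#|_|) (2 * (k * Delta) + 2 * Delta ^ 2) => z1 [] z3 z4 z5;
      by clear; lia.
  have e : [set a | a \in A] = A by apply/setP => a; rewrite inE.
  rewrite e in H2; apply: (@leq_trans (2 * (#|A| * uphalf (k * m)))); last by rewrite leq_mul2l H2 orbT.
  rewrite mulnCA [X in X <= _]mulnC leq_mul2l; apply/orP; right.
  rewrite uphalf_half -[X in X <= _]odd_double_half.
  by move: (odd _) ((k * m)./2) => [] z; clear; lia.
apply: leq_trans AC _; rewrite leq_mul2l /=.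
pose phi (s : ({set {set V}} * (({set V} * V) * X)) * ({set V} * V)) :=
  (swap2 s.1.1 s.1.2.1 s.2, ((exflag s.1.2.1 s.2, exflag s.2 s.1.2.1), s.1.2.2)).
rewrite -(card_in_imset (f := phi)).
  apply/subset_leq_card/subsetP => t /imsetP[[[H [p x]] q]]; rewrite inE => /andP[].
  rewrite inE => /and3P[/= HR pH Qx] sw ->; rewrite inE /=.
  rewrite swap2_realization //= exflag_mem' // exflag_mem /=.
  exact: QP.
move=> [[H [p x]] q] [[H' [p' x']] q'] /[1!inE] /andP[/[1!inE] /and3P[/= HR pH _] sw].
move=> /[1!inE] /andP[/[1!inE] /and3P[/= HR' pH' _] sw'].
move=> E; have e1 : swap2 H p q = swap2 H' p' q' := congr1 (fun t => t.1) E.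
have e2 : exflag p q = exflag p' q' := congr1 (fun t => t.2.1.1) E.
have e3 : exflag q p = exflag q' p' := congr1 (fun t => t.2.1.2) E.
have e4 : x = x' := congr1 (fun t => t.2.2) E.
have hp : p = p'.
  move: (sw) (sw') => /and5P[_ h _ _ _] /and5P[_ h' _ _ _].
  have pp : p.2 \in p.1 by move: pH; rewrite inE => /andP[].
  have pp' : p'.2 \in p'.1 by move: pH'; rewrite inE => /andP[].
  by rewrite -(exflagK pp h) -(exflagK pp' h') e2 e3.
have hq : q = q'.
  move: (sw) (sw') => /and5P[qF _ h _ _] /and5P[qF' _ h' _ _].
  have pp : q.2 \in q.1 by move: qF; rewrite inE => /andP[].
  have pp' : q'.2 \in q'.1 by move: qF'; rewrite inE => /andP[].
  by rewrite -(exflagK pp h) -(exflagK pp' h') e2 e3.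
have hH : H = H' by rewrite -(swap2K pH sw) -(swap2K pH' sw') e1 e2 e3.
by rewrite hH hp hq e4.
Qed.

End TwoSwitch.

(** * Average number of edges fixed by a switching, sparse case *)

Lemma card_dep_sum (A B : finType) (P : pred A) (Q : A -> pred B) :
  #|[set p | P p.1 && Q p.1 p.2]| = \sum_(a | P a) #|[set b | Q a b]|.
Proof.
rewrite -sum1_card.
rewrite (eq_bigl (fun p => P p.1 && Q p.1 p.2)) => [|p]; last by rewrite inE.
rewrite -(pair_big_dep P Q (fun _ _ => 1)) /=; apply: eq_bigr => a _.
by rewrite sum1dep_card.
Qed.

Section Sparse.
Variables (n k m Delta : nat) (d : degseq n) (a c : 'I_n).
Let V : finType := 'I_n.
Implicit Types (H : {set {set V}}) (e f g : {set V}) (p q : {set V} * V).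
Hypothesis degD : forall v, d v <= Delta.
Hypothesis k3 : 2 < k.
Hypothesis sparse : 2 * (2 * (k * Delta) + 2 * Delta ^ 2) <= k * m.
Hypothesis ac : a != c.

Let Rd : {set {set {set V}}} := realizations k m d.
Let k2 : 1 < k := ltnW k3.

Let codeg H := #|[set e in H | (a \in e) && (c \in e)]|.

(** Triples [((e, s), f)] in which the edge e through a and the edge f through c meet in s. They are
    what is left of a pair counted by [path] after one switching, and a second switching removes
    s. *)
Let touching H : {set ({set V} * V) * {set V}} :=
  [set t | [&& t.1 \in flags H, t.2 \in H, a \in t.1.1, c \in t.2, t.1.2 \in t.2,
               t.1.2 != a & t.1.1 != t.2]].

Let path H := #|[set e in H | [&& a \in e, c \notin e & swapset a c e \in H]]|.

Lemma card_flags_into H f : H \in Rd -> f \in H -> #|[set q in flags H | q.2 \in f]| <= k * Delta.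
Proof.
move=> HR fH; rewrite -(realization_card HR fH) -sum1_card.
rewrite (partition_big (fun q => q.2) (mem f)) => [|q]; last by rewrite inE => /andP[].
rewrite -sum_nat_const; apply: leq_sum => v _; apply: leq_trans (degD v).
apply: leq_trans (card_flags_to v HR); rewrite sum1dep_card subset_leq_card //.
by apply/subsetP => q; rewrite !inE => /andP[/andP[-> _] ->].
Qed.

Lemma codeg_sum : k * m * (\sum_(H in Rd) codeg H) <= 2 * (#|Rd| * (d a * k * d c)).
Proof.
have := two_switch (X := unit) degD k2 sparse (Q := fun H p _ => (a \in p.1) && (p.2 == c))
   (P := fun H t => (a \in t.1.1.1) && (t.1.2.2 == c)).
case/(_ _)/Wrap => [|tw].
  move=> H p q [] HR pH /andP[ap /eqP pc] _ /=; rewrite pc eqxx andbT.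
  by rewrite !inE ap ac orbT.
apply: leq_trans (leq_trans _ tw) _.
  rewrite leq_mul2l; apply/orP; right.
  rewrite (card_dep_sum [pred H | H \in Rd] (fun H (t : ({set V} * V) * unit) =>
     (t.1 \in flags H) && ((a \in t.1.1) && (t.1.2 == c)))).
  apply: leq_sum => H HR; rewrite /codeg -(card_imset (f := fun e => ((e, c), tt))).
    apply/subset_leq_card/subsetP => t /imsetP[e]; rewrite !inE => /and3P[eH ae ce] ->.
    by rewrite /= eH ae ce eqxx.
  by move=> e e' [].
rewrite leq_mul2l; apply/orP; right.
apply: leq_trans (card_dep_le (P := [pred H | H \in Rd]) (Q := fun H t => [&& t.1.1 \in flags H,
   t.1.2 \in flags H & (a \in t.1.1.1) && (t.1.2.2 == c)]) (c := d a * k * d c) _) _; last first.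
  by rewrite leq_mul2r; apply/orP; right; rewrite subset_leq_card //; apply/subsetP => H; rewrite inE.
move=> H HR /=.
apply: (@leq_trans #|setX (setX [set p in flags H | a \in p.1] [set p in flags H | p.2 == c]) [set: unit]|).
  by apply/subset_leq_card/subsetP => t; rewrite !inE => /and3P[/= -> -> /andP[-> ->]].
rewrite !cardsX cardsT card_unit muln1 leq_mul //; first exact: card_flags_at HR.
exact: card_flags_to HR.
Qed.

(** Switching the marked vertex out of e breaks the contact. What can be seen afterwards is an edge
    through a, the edge f through c, and a flag whose marked vertex lies in f. *)
Lemma touching_sum : k * m * (\sum_(H in Rd) #|touching H|) <=
  2 * (#|Rd| * (d a * k * (d c * (k * Delta)))).
Proof.
have := two_switch (X := {set V}) degD k2 sparse
   (Q := fun H p f => [&& f \in H, a \in p.1, c \in f, p.2 \in f, p.2 != a & p.1 != f])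
   (P := fun H t => [&& a \in t.1.1.1, t.2 \in H, c \in t.2 & t.1.2.2 \in t.2]).
case/(_ _)/Wrap => [|tw].
  move=> H p q f HR pH /and5P[fH ap cf pf /andP[pa pnf]] sw /=.
  rewrite pf cf mem_swap2 //; last first.
  - by apply: contraTneq pf => ->; case/and5P: sw.
  - by rewrite eq_sym.
  by rewrite /exflag /= !inE ap (eq_sym a p.2) pa !orbT.
apply: leq_trans (leq_trans _ tw) _.
  rewrite leq_mul2l; apply/orP; right.
  rewrite (card_dep_sum [pred H | H \in Rd] (fun H (t : ({set V} * V) * {set V}) =>
     (t.1 \in flags H) && [&& t.2 \in H, a \in t.1.1, c \in t.2, t.1.2 \in t.2, t.1.2 != a & t.1.1 != t.2])).
  by apply: leq_sum => H HR; apply/subset_leq_card/subsetP => t; rewrite !inE.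
rewrite leq_mul2l; apply/orP; right.
apply: leq_trans (card_dep_le (P := [pred H | H \in Rd]) (Q := fun H t => [&& t.1.1 \in flags H,
   t.1.2 \in flags H & [&& a \in t.1.1.1, t.2 \in H, c \in t.2 & t.1.2.2 \in t.2]])
   (c := d a * k * (d c * (k * Delta))) _) _; last first.
  by rewrite leq_mul2r; apply/orP; right; rewrite subset_leq_card //; apply/subsetP => H; rewrite inE.
move=> H HR /=.
pose A := [set p in flags H | a \in p.1].
pose B := [set t : {set V} * ({set V} * V) | [pred f | (f \in H) && (c \in f)] t.1 &&
    [pred q | (q \in flags H) && (q.2 \in t.1)] t.2].
rewrite -(card_imset (f := fun t : ({set V} * V) * ({set V} * V) * {set V} => (t.1.1, (t.2, t.1.2)))).
  apply: (@leq_trans #|setX A B|).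
    apply/subset_leq_card/subsetP => t /imsetP[[[p q] f]].
    by rewrite !inE /= => /and3P[h1 h2 /and4P[h3 h4 h5 h6]] ->; rewrite /= h1 h3 h4 h5 h2 h6.
  rewrite cardsX leq_mul //; first exact: card_flags_at HR.
  rewrite -(deg_flags c HR).
  apply: (card_dep_le (P := [pred f | (f \in H) && (c \in f)])
     (Q := fun f => [pred q | (q \in flags H) && (q.2 \in f)])) => f /andP[fH _].
  exact: card_flags_into.
move=> [[p q] f] [[p' q'] f'] E.
have e1 : p = p' := congr1 (fun t => t.1) E.
have e2 : f = f' := congr1 (fun t => t.2.1) E.
have e3 : q = q' := congr1 (fun t => t.2.2) E.
by rewrite e1 e2 e3.
Qed.

(** A vertex of the edge besides a and the marked one, available because k > 2. The switching keeps
    it in the edge, so it stays as a point of contact. *)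
Let other p : V := odflt p.2 [pick s in p.1 :\ a :\ p.2].

Lemma otherP H p : H \in Rd -> p \in flags H -> a \in p.1 -> other p \in p.1 :\ a :\ p.2.
Proof.
move=> HR pF ap; rewrite /other; case: pickP => //= e0.
have c0 : #|p.1 :\ a :\ p.2| = 0 by apply: eq_card0.
have pH : p.1 \in H by move: pF; rewrite inE => /andP[].
have := cardsD1 a p.1; have := cardsD1 p.2 (p.1 :\ a); rewrite c0 ap (realization_card HR pH) addn0 => ->.
by move=> kE; move: k3; rewrite kE; case: (_ \in _).
Qed.

(** An edge through a and its image share [k.-1] vertices. Each may be switched out of the first
    edge while [other] still ties it to the image, and a triple of [touching] results. Given the
    triple, the vertex received has k possibilities, and the new flag holding the lost vertex, which
    lies in f, has at most k Delta. *)
Lemma path_sum : k * m * (k.-1 * \sum_(H in Rd) path H) <=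
  2 * (k * (k * Delta) * \sum_(H in Rd) #|touching H|).
Proof.
have := two_switch (X := ({set V} * V)%type) degD k2 sparse
   (Q := fun H p t => [&& a \in p.1, c \notin p.1, p.2 != a, t.1 == swapset a c p.1, t.1 \in H & t.2 == other p])
   (P := fun H t => (((t.1.1.1, t.2.2), t.2.1) \in touching H) && (t.1.2.2 \in t.2.1)).
case/(_ _)/Wrap => [|tw].
  move=> H p q [f s] HR pH /= /and5P[ap cp pa /eqP fE /andP[fH /eqP sE]] sw.
  have pp : p.2 \in p.1 by move: pH; rewrite inE => /andP[].
  have /and3P[sp sa s1] : [&& s != p.2, s != a & s \in p.1].
    by have := otherP HR pH ap; rewrite -sE !inE.
  have ca : c != a by rewrite eq_sym.
  have keep v : v \in p.1 -> v != a -> v \in f.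
    move=> vp va; rewrite fE mem_swapset tpermD 1?eq_sym //.
    by apply: contraNneq cp => <-.
  have pf := keep _ pp pa; have sf := keep _ s1 sa.
  have af : a \notin f by rewrite fE mem_swapset tpermL.
  have cf : c \in f by rewrite fE mem_swapset tpermR.
  have fp : f != p.1 by apply: contraNneq af => ->.
  have fq : f != q.1 by apply: contraTneq pf => ->; case/and5P: sw.
  have fS := mem_swap2 fH fp fq.
  have eS := exflag_mem H p q.
  have e1 : (exflag p q).1 \in swap2 H p q by move: eS; rewrite inE => /andP[].
  have ae : a \in (exflag p q).1 by rewrite /exflag /= !inE ap (eq_sym a p.2) pa orbT.
  have se : s \in (exflag p q).1 by rewrite /exflag /= !inE s1 sp orbT.
  have ef : (exflag p q).1 != f by apply: contraNneq af => <-.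
  apply/andP; split; last exact: pf.
  rewrite /touching in_set; apply/and5P; split => //.
    by rewrite in_set; apply/andP; split.
  by apply/and3P; split.
apply: leq_trans (leq_trans _ tw) _.
  rewrite leq_mul2l; apply/orP; right.
  rewrite (card_dep_sum [pred H | H \in Rd] (fun H (t : ({set V} * V) * ({set V} * V)) =>
     (t.1 \in flags H) && [&& a \in t.1.1, c \notin t.1.1, t.1.2 != a, t.2.1 == swapset a c t.1.1,
       t.2.1 \in H & t.2.2 == other t.1])).
  rewrite big_distrr /=; apply: leq_sum => H HR.
  pose S := [set p : {set V} * V | [pred e | (e \in H) && [&& a \in e, c \notin e & swapset a c e \in H]] p.1
     && [pred v | v \in p.1 :\ a] p.2].
  apply: (@leq_trans #|S|).
    rewrite /path mulnC; apply: (card_dep_ge (P := [pred e | (e \in H) && [&& a \in e, c \notin e & swapset a c e \in H]])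
      (Q := fun e => [pred v | v \in e :\ a])) => e /andP[eH /andP[ae _]].
    have -> : [set b | [pred v | v \in e :\ a] b] = e :\ a by apply/setP => v; rewrite !inE.
    by rewrite -(realization_card HR eH) (cardsD1 a) ae.
  rewrite -(card_imset (f := fun p => (p, (swapset a c p.1, other p)))); last by move=> p p' E; exact: (congr1 (fun t => t.1) E).
  apply/subset_leq_card/subsetP => t /imsetP[[e w]].
  rewrite !inE /= => /andP[/and4P[eH ae ce sH] /andP[wa we]] ->.
  by rewrite /= eH we ae ce wa sH !eqxx.
rewrite leq_mul2l; apply/orP; right.
rewrite (card_dep_sum [pred H | H \in Rd] (fun H (t : ({set V} * V) * ({set V} * V) * ({set V} * V)) =>
   [&& t.1.1 \in flags H, t.1.2 \in flags H &
   (((t.1.1.1, t.2.2), t.2.1) \in touching H) && (t.1.2.2 \in t.2.1)])).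
rewrite big_distrr /=; apply: leq_sum => H HR.
pose g (t : ({set V} * V) * ({set V} * V) * ({set V} * V)) :=
  (((t.1.1.1, t.2.2), t.2.1), (t.1.1.2, t.1.2)).
rewrite -(card_imset (f := g)); last first.
  move=> [[[e w] q] [f s]] [[[e' w'] q'] [f' s']] E.
  have e1 : e = e' := congr1 (fun t => t.1.1.1) E.
  have e2 : s = s' := congr1 (fun t => t.1.1.2) E.
  have e3 : f = f' := congr1 (fun t => t.1.2) E.
  have e4 : w = w' := congr1 (fun t => t.2.1) E.
  have e5 : q = q' := congr1 (fun t => t.2.2) E.
  by rewrite e1 e2 e3 e4 e5.
pose Z := [set t : (({set V} * V) * {set V}) * (V * ({set V} * V)) |
   [pred u | u \in touching H] t.1 &&
   [pred u | (u.1 \in t.1.1.1) && ((u.2 \in flags H) && (u.2.2 \in t.1.2))] t.2].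
apply: (@leq_trans #|Z|).
  apply/subset_leq_card/subsetP => t /imsetP[[[p q] [f s]]].
  rewrite inE => /and3P[/= pF qF /andP[tH qf]] ->; rewrite inE /= tH qF qf !andbT /=.
  by move: pF; rewrite inE => /andP[].
rewrite mulnC; apply: leq_trans (card_dep_le (P := [pred u | u \in touching H])
  (Q := fun v => [pred u | (u.1 \in v.1.1) && ((u.2 \in flags H) && (u.2.2 \in v.2))])
  (c := k * (k * Delta)) _) _; last first.
  by rewrite leq_mul2r; apply/orP; right; rewrite subset_leq_card //; apply/subsetP => t; rewrite inE.
move=> [[e s] f] /[1!inE]; rewrite /touching in_set => /and5P[/= eF fH _ _ _].
have eH : e \in H by move: eF; rewrite inE => /andP[].
apply: (@leq_trans #|setX e [set q in flags H | q.2 \in f]|).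
  by apply/subset_leq_card/subsetP => t; rewrite !inE.
by rewrite cardsX (realization_card HR eH) leq_mul // card_flags_into.
Qed.

(** A fixed edge either contains c too or differs from its image: [codeg] and [path] count the two
    kinds. The second kind costs two switchings, hence the squared km on the left. *)
Lemma sum_fixed_deg_le :
  k * m * (k * m) * (k.-1 * \sum_(H in Rd) fixed_deg a c H) <=
  #|Rd| * (d a * d c) * (2 * k * k.-1 * (k * m) + 4 * k ^ 4 * Delta ^ 2).
Proof.
have fE H : fixed_deg a c H <= codeg H + path H.
  rewrite /fixed_deg; apply: leq_trans (leq_card_setU _ _).
  apply/subset_leq_card/subsetP => f; rewrite !inE => /and3P[-> -> ->].
  by case: (c \in f).
have S : \sum_(H in Rd) fixed_deg a c H <= \sum_(H in Rd) codeg H + \sum_(H in Rd) path H.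
  by rewrite -big_split; apply: leq_sum.
move: codeg_sum touching_sum path_sum S.
move: (\sum_(H in Rd) codeg H) (\sum_(H in Rd) #|touching H|) (\sum_(H in Rd) path H)
  (\sum_(H in Rd) fixed_deg a c H) #|Rd| (d a) (d c) (k.-1) (k * m) => s1 s2 s3 s4 r da dc k1 M.
move=> h1 h2 h3 h4.
apply: (@leq_trans (M * M * (k1 * (s1 + s3)))); first by rewrite !leq_mul2l h4 !orbT.
have e1 : M * k1 * (M * s1) <= M * k1 * (2 * (r * (da * k * dc))) by rewrite leq_mul2l h1 orbT.
have e3 : M * (M * (k1 * s3)) <= M * (2 * (k * (k * Delta) * s2)) by rewrite leq_mul2l h3 orbT.
have e2 : 2 * (k * (k * Delta)) * (M * s2) <= 2 * (k * (k * Delta)) * (2 * (r * (da * k * (dc * (k * Delta))))).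
  by rewrite leq_mul2l h2 orbT.
apply: (@leq_trans (M * k1 * (2 * (r * (da * k * dc))) + 2 * (k * (k * Delta)) * (2 * (r * (da * k * (dc * (k * Delta))))))).
  apply: leq_trans (leq_add e1 (leq_trans e3 _)).
    by rewrite leq_eqVlt; apply/orP; left; apply/eqP; ring.
  by apply: leq_trans e2; rewrite leq_eqVlt; apply/orP; left; apply/eqP; ring.
by rewrite leq_eqVlt; apply/orP; left; apply/eqP; ring.
Qed.

End Sparse.

Local Open Scope ring_scope.

(** * Independent edges *)

Section Subsets.
Variables (K : realFieldType) (T : finType).
Implicit Types (A B D H : {set T}).

Lemma sum_subset_prod (D : {set T}) (x y : T -> K) :
  \sum_(H : {set T} | H \subset D) \prod_(e in D) (if e \in H then x e else y e) =
  \prod_(e in D) (x e + y e).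
Proof.
pose F e := if e \in D then x e else 0; pose G e := if e \in D then y e else 1.
have : \prod_i (F i + G i) = \sum_(J : {set T}) \prod_i (if i \in J then F i else G i).
  by rewrite bigA_distr; apply: eq_bigl.
rewrite (bigID (mem D)) /=.
rewrite [X in _ * X = _]big1 ?mulr1; last first.
  by move=> e eD; rewrite /F /G (negbTE eD) add0r.
rewrite (eq_bigr (fun e => x e + y e)); last by move=> e eD; rewrite /F /G eD.
move=> ->; rewrite big_mkcond /=; apply: eq_bigr => H _.
case: ifP => [/subsetP HD|/negbT].
  rewrite [RHS](bigID (mem D)) /= [X in _ = _ * X]big1 ?mulr1.
    by apply: eq_bigr => e eD; rewrite /F /G eD.
  move=> e eD; rewrite /F /G (negbTE eD); case: (boolP (e \in H)) => // /HD.
  by rewrite (negbTE eD).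
case/subsetPn => e eH eD; rewrite (bigD1 e) //= eH /F (negbTE eD) mul0r //.
Qed.

Lemma sum_subset_split D D' (g : {set T} -> K) : [disjoint D & D'] ->
  \sum_(H : {set T} | H \subset D :|: D') g H =
  \sum_(A : {set T} | A \subset D) \sum_(B : {set T} | B \subset D') g (A :|: B).
Proof.
move=> dis; rewrite pair_big /=.
rewrite (reindex_onto (fun p : {set T} * {set T} => p.1 :|: p.2) (fun H => (H :&: D, H :&: D'))) /=.
  apply: eq_bigl => -[A B] /=; apply/andP/andP => [[_ /eqP [<- <-]]|[AD BD]].
    by rewrite !subsetIr.
  split; first exact: setUSS.
  have AD' : A :&: D' = set0.
    by apply/eqP; rewrite setI_eq0; apply: disjointWl dis.
  have BD' : B :&: D = set0.
    by apply/eqP; rewrite setI_eq0 disjoint_sym; apply: disjointWr dis.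
  rewrite !setIUl AD' BD' setU0 set0U; apply/eqP.
  by congr (_, _); apply/setIidPl.
by move=> H HD; rewrite -setIUr; apply/setIidPl.
Qed.

Definition bweight (p : K) (D H : {set T}) : K := \prod_(e in D) (if e \in H then p else 1 - p).

Lemma bweight_ge0 p D H : 0 <= p <= 1 -> 0 <= bweight p D H.
Proof. by case/andP=> p0 p1; apply: prodr_ge0 => e _; case: ifP => // _; rewrite subr_ge0. Qed.

Lemma bweight_card p D H : H \subset D -> bweight p D H = p ^+ #|H| * (1 - p) ^+ (#|D| - #|H|).
Proof.
move=> HD; rewrite /bweight (big_setID H) /= (setIidPr HD).
rewrite (eq_bigr (fun=> p)) => [|e ->] //; rewrite prodr_const; congr (_ * _).
rewrite (eq_bigr (fun=> 1 - p)) => [|e]; last by rewrite inE => /andP[/negbTE ->].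
by rewrite prodr_const cardsD (setIidPr HD).
Qed.

Lemma bweight_mgf p D (x : T -> K) :
  \sum_(H : {set T} | H \subset D) bweight p D H * \prod_(e in D) (if e \in H then x e else 1) =
  \prod_(e in D) (1 + p * (x e - 1)).
Proof.
transitivity (\prod_(e in D) (p * x e + (1 - p))); last by apply: eq_bigr => e _; ring.
rewrite -sum_subset_prod; apply: eq_bigr => H _; rewrite /bweight -big_split /=.
by apply: eq_bigr => e _; case: ifP; rewrite ?mulr1.
Qed.

Lemma prod_indicator (D H S : {set T}) (t : K) : H \subset D ->
  \prod_(e in D) (if e \in H then (if e \in S then t else 1) else 1) = t ^+ #|H :&: S|.
Proof.
move=> HD; rewrite -prodr_const (bigID (fun e => e \in H :&: S)) /= [X in _ * X]big1 ?mulr1.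
  apply: eq_big => [e|e /andP[_]]; last by rewrite inE => /andP[-> ->].
  by rewrite andb_idl // inE => /andP[/(subsetP HD)].
by move=> e /andP[_]; rewrite inE; case: (e \in H) => //= /negbTE ->.
Qed.

Lemma bweight_mgf_card p (D S : {set T}) (t : K) :
  \sum_(H : {set T} | H \subset D) bweight p D H * t ^+ #|H :&: S| =
  (1 + p * (t - 1)) ^+ #|D :&: S|.
Proof.
transitivity (\sum_(H : {set T} | H \subset D) bweight p D H *
   \prod_(e in D) (if e \in H then (if e \in S then t else 1) else 1)).
  by apply: eq_bigr => H HD; rewrite prod_indicator.
rewrite bweight_mgf -(prod_indicator S (1 + p * (t - 1)) (subxx D)); apply: eq_bigr => e eD.
by rewrite eD; case: ifP; rewrite // subrr mulr0 addr0.
Qed.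

Lemma bweightU p (D D' A B : {set T}) : [disjoint D & D'] -> A \subset D -> B \subset D' ->
  bweight p (D :|: D') (A :|: B) = bweight p D A * bweight p D' B.
Proof.
move=> dis AD BD; rewrite {1}/bweight (eq_bigl [predU D & D']) => [|e]; last by rewrite !inE.
rewrite bigU //=.
congr (_ * _); apply: eq_bigr => e eD; rewrite inE.
  suff /negbTE -> : e \notin B by rewrite orbF.
  by apply/negP => /(subsetP BD); rewrite (disjointFr dis eD).
suff /negbTE -> : e \notin A by [].
by apply/negP => /(subsetP AD); rewrite (disjointFl dis eD).
Qed.

End Subsets.

(** * Generating functions of degrees and of fixed edges *)

Section EdgeMGF.
Variables (K : realFieldType) (n k : nat).
Implicit Types (a b v : 'I_n) (e f : {set 'I_n}).

Definition edges : {set {set 'I_n}} := [set e : {set 'I_n} | #|e| == k].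
Definition edges_at v : {set {set 'I_n}} := [set e in edges | v \in e].
Definition edges_both a b : {set {set 'I_n}} := [set e in edges | (a \in e) && (b \in e)].
Definition edges_but a b : {set {set 'I_n}} := [set e in edges | (a \in e) && (b \notin e)].

Lemma degs_mgf (p t : K) v :
  \sum_(H : {set {set 'I_n}} | H \subset edges) bweight p edges H * t ^+ degs n H v =
  (1 + p * (t - 1)) ^+ #|edges_at v|.
Proof.
have -> : edges_at v = edges :&: edges_at v by apply/setP => e; rewrite !inE andbA andbb.
rewrite -bweight_mgf_card; apply: eq_bigr => H /subsetP HD.
rewrite /degs ffunE; congr (_ * _ ^+ _); apply: eq_card => e; rewrite !inE.
by case: (boolP (e \in H)) => //= /HD; rewrite inE => ->.
Qed.

Lemma fixed_deg_split a b (A B : {set {set 'I_n}}) : a != b ->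
  A \subset edges :\: edges_but b a -> B \subset edges_but b a ->
  fixed_deg a b (A :|: B) =
  (#|A :&: edges_both a b| + #|B :&: (swapset a b @: (A :&: edges_but a b))|)%N.
Proof.
move=> ab /subsetP AD /subsetP BD.
have inA e : e \in A -> (#|e| == k) && ~~ ((b \in e) && (a \notin e)).
  by move=> /AD; rewrite !inE; case: (#|e| == k); case: (b \in e); case: (a \in e).
have inB e : e \in B -> [&& #|e| == k, b \in e & a \notin e] by move=> /BD; rewrite !inE.
rewrite /fixed_deg -(cardsID [set e : {set 'I_n} | b \in e]); congr (_ + _)%N.
  apply: eq_card => e; rewrite !inE.
  case: (boolP (a \in e)) => ae; last by rewrite !andbF.
  case: (boolP (b \in e)) => be; last by rewrite !andbF.
  have eB : (e \in B) = false by apply/negP => /inB; rewrite ae !andbF.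
  rewrite swapset_id // eB orbF !andbT /=.
  by case: (boolP (e \in A)) => //= /inA /andP[->].
rewrite -[RHS](card_imset _ (inv_inj (swapsetK a b))); apply: eq_card => e.
rewrite -{2}[e](swapsetK a b) (mem_imset _ _ (inv_inj (swapsetK a b))) in_setI.
rewrite (mem_imset _ _ (inv_inj (swapsetK a b))) !inE.
case: (boolP (a \in e)) => ae; last by rewrite !andbF.
case: (boolP (b \in e)) => be; first by rewrite /= !andbF.
have eB : (e \in B) = false by apply/negP => /inB; rewrite ae !andbF.
have sA : (swapset a b e \in A) = false.
  by apply/negP => /inA; rewrite !mem_swapset tpermL tpermR (negbTE be) ae andbF.
rewrite eB sA orbF /= andbT.
case: (boolP (e \in A)) => [/inA/andP[-> _]|] /=; rewrite ?andbT ?andbF //.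
Qed.

(** Once the edges outside [edges_but b a] are known, what remains is the number of independent
    edges landing in a known set of images; summing them out gives a factor [s] for each present
    edge through a but not b. The formula exhibits [fixed_deg] as a sum of independent indicators,
    of probability p for edges containing both vertices and p^2 for the others. *)
Lemma fixed_deg_mgf (p t : K) a b : a != b ->
  \sum_(H : {set {set 'I_n}} | H \subset edges) bweight p edges H * t ^+ fixed_deg a b H =
  (1 + p * (t - 1)) ^+ #|edges_both a b| * (1 + p * (p * (t - 1))) ^+ #|edges_but a b|.
Proof.
move=> ab; set D2 := edges_but b a; set D1 := edges :\: D2.
have D2E : D2 \subset edges by apply/subsetP => e; rewrite inE => /andP[].
have dis : [disjoint D1 & D2].
  by rewrite -setI_eq0; apply/eqP/setP => e; rewrite !inE; case: (#|e| == k); case: (a \in e); case: (b \in e).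
have DE : edges = D1 :|: D2.
  by apply/setP => e; rewrite !inE; case: (#|e| == k); case: (a \in e); case: (b \in e).
rewrite {1 2}DE (sum_subset_split _ dis).
pose s : K := 1 + p * (t - 1).
pose x (e : {set 'I_n}) : K := if e \in edges_both a b then t else if e \in edges_but a b then s else 1.
transitivity (\sum_(A : {set {set 'I_n}} | A \subset D1)
   bweight p D1 A * \prod_(e in D1) (if e \in A then x e else 1)).
  apply: eq_bigr => A AD.
  transitivity (bweight p D1 A * t ^+ #|A :&: edges_both a b| *
    \sum_(B : {set {set 'I_n}} | B \subset D2) bweight p D2 B *
      t ^+ #|B :&: (swapset a b @: (A :&: edges_but a b))|).
    rewrite mulr_sumr; apply: eq_bigr => B BD.
    rewrite (bweightU p dis AD BD).
    rewrite (fixed_deg_split ab AD BD).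
    by rewrite exprD mulrACA.
  have sub : swapset a b @: (A :&: edges_but a b) \subset D2.
    apply/subsetP => e /imsetP[f fI ->]; move: fI; rewrite !inE => /andP[_ /and3P[/eqP fk af bf]].
    by rewrite card_swapset fk eqxx !mem_swapset tpermL tpermR af bf.
  rewrite bweight_mgf_card -/s (setIidPr sub).
  rewrite card_imset; last exact: inv_inj (swapsetK a b).
  rewrite -mulrA -(prod_indicator (edges_both a b) t AD) -(prod_indicator (edges_but a b) s AD) -big_split /=.
  congr (_ * _); apply: eq_bigr => e _; rewrite /x; case: (e \in A); rewrite ?mulr1 //.
  rewrite !inE; case: (#|e| == k); case: (a \in e); case: (b \in e); rewrite /= ?mulr1 ?mul1r //.
rewrite bweight_mgf.
have -> : edges_both a b = D1 :&: edges_both a b.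
  by apply/setP => e; rewrite !inE; case: (#|e| == k); case: (a \in e); case: (b \in e).
have -> : edges_but a b = D1 :&: edges_but a b.
  by apply/setP => e; rewrite !inE; case: (#|e| == k); case: (a \in e); case: (b \in e).
rewrite -(prod_indicator (edges_both a b) _ (subxx D1)) -(prod_indicator (edges_but a b) _ (subxx D1)).
rewrite -big_split /=; apply: eq_bigr => e eD; rewrite eD /x /s !inE.
by case: (#|e| == k); case: (a \in e); case: (b \in e); rewrite /= ?mulr1 ?mul1r ?subrr ?mulr0 ?addr0 //; ring.
Qed.

Lemma card_edges : #|edges| = 'C(n, k).
Proof. by rewrite card_draws card_ord. Qed.

Lemma card_edges_at v : (n * #|edges_at v| = k * 'C(n, k))%N.
Proof.
have eqv w : #|edges_at w| = #|edges_at v|.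
  rewrite -(card_imset _ (inv_inj (swapsetK v w))); apply: eq_card => e.
  rewrite -{1}[e](swapsetK v w) (mem_imset _ _ (inv_inj (swapsetK v w))) !inE.
  by rewrite card_swapset mem_swapset tpermR.
transitivity (\sum_w #|edges_at w|)%N.
  by rewrite (eq_bigr (fun=> #|edges_at v|)) // sum_nat_const card_ord.
transitivity (\sum_(e in edges) #|e|)%N.
  rewrite (eq_bigr (fun w => \sum_(e in edges | w \in e) 1)%N) => [|w _].
    rewrite (exchange_big_dep (mem edges)) /= => [|w e _ /andP[]] //.
    apply: eq_bigr => e eE; rewrite -sum1_card; apply: eq_bigl => w; by rewrite eE.
  by rewrite -sum1_card; apply: eq_bigl => e; rewrite !inE.
rewrite (eq_bigr (fun=> k)) => [|e]; last by rewrite inE => /eqP.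
by rewrite sum_nat_const card_edges mulnC.
Qed.

Lemma card_edges_both a b : a != b -> (n.-1 * #|edges_both a b| = k.-1 * #|edges_at a|)%N.
Proof.
move=> ab.
have eqb w : w != a -> #|edges_both a w| = #|edges_both a b|.
  move=> wa; rewrite -(card_imset _ (inv_inj (swapsetK b w))); apply: eq_card => e.
  rewrite -{1}[e](swapsetK b w) (mem_imset _ _ (inv_inj (swapsetK b w))) !inE.
  by rewrite card_swapset !mem_swapset tpermR tpermD // eq_sym.
transitivity (\sum_(w | w != a) #|edges_both a w|)%N.
  rewrite (eq_bigr (fun=> #|edges_both a b|)) => [|w]; last exact: eqb.
  by rewrite sum_nat_const cardC1 card_ord.
transitivity (\sum_(e in edges_at a) #|e :\ a|)%N.
  rewrite (eq_bigr (fun w => \sum_(e in edges_at a | w \in e) 1)%N) => [|w _].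
    rewrite (exchange_big_dep (mem (edges_at a))) /= => [|w e _ /andP[]] //.
    apply: eq_bigr => e eE; rewrite -sum1_card; apply: eq_bigl => w.
    by rewrite eE !inE.
  by rewrite -sum1_card; apply: eq_bigl => e; rewrite !inE andbA.
rewrite (eq_bigr (fun=> k.-1)) => [|e]; last first.
  by rewrite !inE => /andP[/eqP <- ae]; rewrite (cardsD1 a e) ae.
by rewrite sum_nat_const mulnC.
Qed.

Lemma card_edges_but a b : (#|edges_both a b| + #|edges_but a b| = #|edges_at a|)%N.
Proof.
rewrite -(cardsID [set e : {set 'I_n} | b \in e] (edges_at a)).
by congr (_ + _)%N; apply: eq_card => e; rewrite !inE; case: (#|e| == k); case: (a \in e); case: (b \in e).
Qed.

End EdgeMGF.

(** * The likelihood ratio *)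

(* B_k(n,m) is the law of slot_deg U for U a uniform km-subset of the n * N slots. *)
Definition slot_deg n N (U : {set 'I_n * 'I_N}) : degseq n := [ffun v => #|[set i | (v, i) \in U]|].

Lemma card_slot_deg n N (d : degseq n) :
  #|[set U : {set 'I_n * 'I_N} | slot_deg U == d]| = (\prod_v 'C(N, d v))%N.
Proof.
pose phi (U : {set 'I_n * 'I_N}) : {ffun 'I_n -> {set 'I_N}} := [ffun v => [set i | (v, i) \in U]].
have phiI : injective phi.
  move=> U V /ffunP E; apply/setP => -[v i]; have := E v.
  by rewrite !ffunE => /setP /(_ i); rewrite !inE.
rewrite -(card_imset _ phiI).
transitivity #|[set f : {ffun 'I_n -> {set 'I_N}} | [forall v, #|f v| == d v]]|.
  apply: eq_card => f; rewrite inE; apply/imsetP/forallP => [[U]|fd].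
    by rewrite inE => /eqP <- -> v; rewrite /slot_deg !ffunE.
  exists [set p | p.2 \in f p.1]; last by apply/ffunP => v; rewrite ffunE; apply/setP => i; rewrite !inE.
  rewrite inE; apply/eqP/ffunP => v; rewrite ffunE -(eqP (fd v)).
  by apply: eq_card => i; rewrite !inE.
transitivity (\sum_(f in family (fun v => [pred A : {set 'I_N} | #|A| == d v])) \prod_(v : 'I_n) 1)%N.
  rewrite -sum1_card; apply: eq_big => [f|f _]; last by rewrite big1.
  rewrite inE; apply/forallP/familyP => h v; exact: h.
rewrite -(bigA_distr_big_dep (fun v => [pred A : {set 'I_N} | #|A| == d v]) (fun _ _ => 1%N)).
apply: eq_bigr => v _; rewrite sum1_card -[N in RHS]card_ord -card_draws.
by apply: eq_card => A; rewrite !inE.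
Qed.

Lemma sum_slot_deg n N (U : {set 'I_n * 'I_N}) : (\sum_v slot_deg U v = #|U|)%N.
Proof.
rewrite -sum1_card (partition_big (fun p => p.1) predT) //=; apply: eq_bigr => v _.
rewrite ffunE sum1dep_card -(card_imset (f := fun i => (v, i))) => [|i j []] //.
apply: eq_card => -[w i]; rewrite !inE /=; apply/imsetP/andP => [[j]|[wi /eqP wv]].
  by rewrite inE => vj [-> ->].
by exists i; rewrite -wv // inE.
Qed.

Lemma slot_deg_le n N (U : {set 'I_n * 'I_N}) v : (slot_deg U v <= N)%N.
Proof. by rewrite ffunE -[X in (_ <= X)%N]card_ord max_card. Qed.

Lemma slot_deg_swap n N (U : {set 'I_n * 'I_N}) x y v : x \in U -> y \notin U ->
  (slot_deg (swapset x y U) v + (v == x.1) = slot_deg U v + (v == y.1))%N.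
Proof.
move=> xU yU; rewrite swapsetE // !ffunE.
have side (A : {set 'I_n * 'I_N}) z : z \notin A ->
    #|[set i | (v, i) \in z |: A]| = ((v == z.1) + #|[set i | (v, i) \in A]|)%N.
  case: z => w j zA /=; case: (eqVneq v w) => [->|vw] /=.
    rewrite (cardsD1 j) !inE eqxx /=; congr (_ + _)%N; apply: eq_card => i; rewrite !inE xpair_eqE eqxx /=.
    by case: (eqVneq i j) => [->|] //=; rewrite (negbTE zA).
  by apply: eq_card => i; rewrite !inE xpair_eqE (negbTE vw).
rewrite (side _ y); last by rewrite !inE negb_and yU orbT.
have e : #|[set i | (v, i) \in U]| = ((v == x.1) + #|[set i | (v, i) \in U :\ x]|)%N.
  by rewrite -(side _ x) ?setD1K // !inE eqxx.
by rewrite e addnAC [RHS]addnAC; congr (_ + _)%N; apply: addnC.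
Qed.

Section Ratio.
Variables (n k m : nat).
Hypotheses (k0 : (0 < k <= n)%N) (m0 : (0 < m < 'C(n, k))%N).
Let N := Nb n k.
Implicit Types (d : degseq n) (g : {set {set 'I_n}} -> R) (H : {set {set 'I_n}}).

Lemma n_Nb : (n * N = k * 'C(n, k))%N.
Proof.
case/andP: k0; rewrite /N /Nb; case: (n) => [|n']; first by case: (k).
by case: (k) => // k' _ _ /=; rewrite mul_bin_diag.
Qed.

Let T : finType := ('I_n * 'I_N)%type.

Lemma card_slots : #|T| = (n * N)%N.
Proof. by rewrite card_prod !card_ord. Qed.

Let M := (k * m)%N.

Lemma M_gt0 : (0 < M)%N.
Proof. by case/andP: k0 => k1 _; case/andP: m0 => m1 _; rewrite muln_gt0 k1. Qed.

Lemma M_lt_slots : (M < #|T|)%N.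
Proof.
by rewrite card_slots n_Nb /M ltn_mul2l; case/andP: k0 => -> _; case/andP: m0.
Qed.

Lemma card_khg_gt0 : (0 < #|khg n k m|)%N.
Proof.
case/andP: m0 => _ mE.
rewrite (_ : khg n k m = [set H : {set {set 'I_n}} | (H \subset edges n k) && (#|H| == m)]).
  by rewrite cards_draws card_edges bin_gt0 ltnW.
apply/setP => H; rewrite !inE; congr (_ && _).
by apply/forall_inP/subsetP => h e eH; move: (h e eH); rewrite inE.
Qed.

Let Kh : R := #|khg n k m|%:R.
Let Kh0 : 0 < Kh. Proof. by rewrite ltr0n card_khg_gt0. Qed.

Lemma slice0_slots : #|slice (T := T) M finset.set0| = 'C(n * N, M).
Proof.
rewrite -card_slots -(card_draws T); apply: eq_card => U.
by rewrite mem_slice0 in_set.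
Qed.

Let Ct : R := 'C(n * N, M)%:R.
Let Ct0 : 0 < Ct.
Proof. by rewrite ltr0n bin_gt0 -card_slots ltnW // M_lt_slots. Qed.

(* L(d) times the average of g over the hypergraphs with degree sequence d. *)
Definition Lr d g : R := (\sum_(H in khg n k m | degs n H == d) g H) / (Kh * PrB n k m d).

Lemma sum_degs H : H \in khg n k m -> (\sum_v degs n H v = M)%N.
Proof.
rewrite mem_khg => /andP[/forall_inP Hk /eqP Hm].
rewrite (eq_bigr (fun v => \sum_(e in H | v \in e) 1)%N) => [|v _]; last first.
  by rewrite ffunE -sum1dep_card.
rewrite (exchange_big_dep (mem H)) /= => [|v e _ /andP[]] //.
rewrite (eq_bigr (fun=> k)) => [|e eH]; first by rewrite sum_nat_const Hm mulnC.
by rewrite -(eqP (Hk e eH)) -sum1_card; apply: eq_bigl => v; rewrite eH.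
Qed.

Lemma LrE d : Lr d (fun=> 1) = PrD n k m d / PrB n k m d.
Proof.
rewrite /Lr /PrD sumr_const invfM mulrA; congr (_ / _ / _); congr (_%:R).
by apply: eq_card => H; rewrite [RHS]in_set.
Qed.

Lemma PrB_gt0 d : (forall v, d v <= N)%N -> 0 < PrB n k m d.
Proof.
move=> dN; rewrite /PrB divr_gt0 // ltr0n; apply: prodn_gt0 => v.
by rewrite bin_gt0 dN.
Qed.

Lemma degs_le_Nb H v : H \in khg n k m -> (degs n H v <= N)%N.
Proof.
move=> HK; have n0 : (0 < n)%N by apply: leq_ltn_trans (ltn_ord v).
have -> : N = #|edges_at k v| by apply/eqP; rewrite -(eqn_pmul2l n0) card_edges_at n_Nb.
rewrite ffunE; apply/subset_leq_card/subsetP => e; rewrite !inE => /andP[eH ->].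
by move: HK; rewrite mem_khg => /andP[/forall_inP /(_ e eH) ->].
Qed.

(** The number of U with a given degree vector is the product of binomials in [PrB], so it cancels
    the denominator of [Lr]. This is how averages over slots become uniform averages over
    hypergraphs. *)
Lemma slice_avg_Lr g :
  slice_avg M (fun U : {set T} => Lr (slot_deg U) g) = (\sum_(H in khg n k m) g H) / Kh.
Proof.
rewrite /slice_avg /slice_mean slice0_slots -/Ct.
have inner H : H \in khg n k m ->
    \sum_(U : {set T} | (U \in slice M finset.set0) && (degs n H == slot_deg U)) (Kh * PrB n k m (slot_deg U))^-1 = Ct / Kh.
  move=> HK.
  rewrite (eq_bigr (fun=> (Kh * PrB n k m (degs n H))^-1)) => [|U /andP[_ /eqP ->]] //.
  rewrite (eq_bigl (fun U : {set T} => slot_deg U == degs n H)) => [|U]; last first.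
    rewrite mem_slice0 [degs n H == _]eq_sym; case: (eqVneq (slot_deg U) (degs n H)) => [e|]; rewrite ?andbF ?andbT //.
    by rewrite -sum_slot_deg e sum_degs // eqxx.
  rewrite sumr_const.
  have -> : #|(fun U : {set T} => slot_deg U == degs n H)| = (\prod_v 'C(N, degs n H v))%N.
    by rewrite -card_slot_deg; apply: eq_card => U; rewrite [RHS]in_set.
  have P0 : (0 : R) < (\prod_v 'C(N, degs n H v))%:R.
    by rewrite ltr0n; apply: prodn_gt0 => v; rewrite bin_gt0 degs_le_Nb.
  rewrite -mulr_natl /PrB -/N -/Ct; field.
  by rewrite !gt_eqF.
transitivity ((\sum_(U in slice M finset.set0) \sum_(H in khg n k m | degs n H == slot_deg U)
    g H * (Kh * PrB n k m (slot_deg (U : {set T})))^-1) / Ct).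
  by congr (_ / _); apply: eq_bigr => U _; rewrite /Lr mulr_suml.
rewrite (exchange_big_dep (mem (khg n k m))) /= => [|U H _ /andP[]] //.
rewrite (eq_bigr (fun H => g H * (Ct / Kh))) => [|H HK].
  by rewrite -mulr_suml; field; rewrite !gt_eqF.
by rewrite -mulr_sumr -(inner H HK); congr (_ * _); apply: eq_bigl => U; rewrite HK.
Qed.

(** Passing from j to j + 1 multiplies 'C(N, j) by (N - j) / (j + 1). Since [N - d c] equals
    [N.+1 - d' c], the identity becomes symmetric in [d a] and [d' c]. *)
Lemma PrB_swap d (d' : degseq n) (a c : 'I_n) : a != c ->
  (forall v, (d' v + (v == a) = d v + (v == c))%N) -> (forall v, d v <= N)%N -> (forall v, d' v <= N)%N ->
  PrB n k m d * ((d a)%:R * (N.+1%:R - (d' c)%:R)) = PrB n k m d' * ((d' c)%:R * (N.+1%:R - (d a)%:R)).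
Proof.
move=> ac dd dN d'N.
have da : (d a = (d' a).+1)%N by have := dd a; rewrite eqxx (negbTE ac) addn1 addn0.
have dc : (d' c = (d c).+1)%N by have := dd c; rewrite eqxx eq_sym (negbTE ac) addn1 addn0.
have ca : c != a by rewrite eq_sym.
have binS j : (j < N)%N -> ('C(N, j.+1)%:R * j.+1%:R : R) = 'C(N, j)%:R * (N.+1%:R - j.+1%:R).
  move=> jN; have -> : (N.+1%:R - j.+1%:R : R) = (N - j)%:R by rewrite -subSS natrB // ltnW.
  by rewrite -!natrM mulnC mul_bin_left mulnC.
rewrite /PrB -/N !natr_prod (bigD1 a) //= (bigD1 c) //= [in RHS](bigD1 a) //= [in RHS](bigD1 c) //=.
rewrite [in RHS](eq_bigr (fun i => 'C(N, d i)%:R)) => [|v /andP[va vc]]; last first.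
  by have := dd v; rewrite (negbTE va) (negbTE vc) !addn0 => ->.
set P := \prod_(_ | _) _.
have ha := binS (d' a); have hc := binS (d c).
rewrite -da in ha; rewrite -dc in hc.
have {}ha := ha (dN a); have {}hc := hc (d'N c).
set Z := _%:R : R in ha hc *.
transitivity (('C(N, d a)%:R * (d a)%:R) * ('C(N, d c)%:R * (N.+1%:R - (d' c)%:R)) * (P / Ct)).
  by rewrite -/Ct; ring.
by rewrite ha -hc -/Ct; ring.
Qed.

(* Multiplying by a (M1 - b) resp. b (M1 - a), with M1 = N + 1, clears the ratio of the two binomial weights. *)
Lemma switch_Lr d (d' : degseq n) (a c : 'I_n) (phi : nat -> R) : a != c ->
  (forall v, (d' v + (v == a) = d v + (v == c))%N) -> (forall v, d v <= N)%N -> (forall v, d' v <= N)%N ->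
  let X := fixed_deg a c in
  Lr d (fun H => phi (X H) * (((d a)%:R - (X H)%:R) * ((d' c)%:R * (N.+1%:R - (d a)%:R)))) =
  Lr d' (fun H => phi (X H) * (((d' c)%:R - (X H)%:R) * ((d a)%:R * (N.+1%:R - (d' c)%:R)))).
Proof.
move=> ac dd dN d'N X.
have sw := one_switch (n := n) k m phi ac dd.
rewrite /Lr.
have B0 : PrB n k m d != 0 by rewrite gt_eqF // PrB_gt0.
have B0' : PrB n k m d' != 0 by rewrite gt_eqF // PrB_gt0.
have e := PrB_swap ac dd dN d'N.
set w := (d' c)%:R * _ in e *; set w' := (d a)%:R * (N.+1%:R - _) in e *.
have s1 : \sum_(H in khg n k m | degs n H == d) phi (X H) * (((d a)%:R - (X H)%:R) * w) =
  w * (\sum_(H in khg n k m | degs n H == d) phi (X H) * (d a)%:R -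
       \sum_(H in khg n k m | degs n H == d) phi (X H) * (X H)%:R).
  by rewrite -sumrB mulr_sumr; apply: eq_bigr => H _; ring.
have s2 : \sum_(H in khg n k m | degs n H == d') phi (X H) * (((d' c)%:R - (X H)%:R) * w') =
  w' * (\sum_(H in khg n k m | degs n H == d') phi (X H) * (d' c)%:R -
       \sum_(H in khg n k m | degs n H == d') phi (X H) * (X H)%:R).
  by rewrite -sumrB mulr_sumr; apply: eq_bigr => H _; ring.
rewrite s1 s2 -sw; set S := _ - _.
have KB := mulf_neq0 (lt0r_neq0 Kh0) B0; have KB' := mulf_neq0 (lt0r_neq0 Kh0) B0'.
apply/eqP; rewrite (eqr_div _ _ KB KB'); apply/eqP.
transitivity (S * Kh * (PrB n k m d' * w)); first by ring.
by rewrite -e; ring.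
Qed.

Lemma Lr_den_ge0 d : 0 <= Kh * PrB n k m d.
Proof. by rewrite mulr_ge0 ?divr_ge0 // ltW. Qed.

Lemma Lr_ge0 d g : (forall H, H \in khg n k m -> degs n H = d -> 0 <= g H) -> 0 <= Lr d g.
Proof.
move=> g0; apply: divr_ge0 (Lr_den_ge0 d).
by apply: sumr_ge0 => H /andP[HK /eqP]; apply: g0.
Qed.

Lemma ler_Lr d g g' : (forall H, H \in khg n k m -> degs n H = d -> g H <= g' H) -> Lr d g <= Lr d g'.
Proof.
move=> gg; rewrite ler_wpM2r ?invr_ge0 ?Lr_den_ge0 //.
by apply: ler_sum => H /andP[HK /eqP]; apply: gg.
Qed.

Lemma eq_Lr d g g' : (forall H, H \in khg n k m -> degs n H = d -> g H = g' H) -> Lr d g = Lr d g'.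
Proof.
by move=> gg; congr (_ / _); apply: eq_bigr => H /andP[HK /eqP]; apply: gg.
Qed.

Lemma LrD d g g' : Lr d (fun H => g H + g' H) = Lr d g + Lr d g'.
Proof. by rewrite /Lr big_split mulrDl. Qed.

Lemma LrZ d x g : Lr d (fun H => x * g H) = x * Lr d g.
Proof. by rewrite /Lr -mulr_sumr mulrA. Qed.

Lemma LrB d g g' : Lr d (fun H => g H - g' H) = Lr d g - Lr d g'.
Proof. by rewrite /Lr sumrB mulrBl. Qed.

(** Iterated Cauchy-Schwarz for a positive functional whose total mass S is not normalised and may
    be 0. *)
Lemma Lr_jensen d g j : (Lr d g) ^+ (2 ^ j.+1) <=
  (Lr d (fun=> 1)) ^+ (2 ^ j.+1).-1 * Lr d (fun H => g H ^+ (2 ^ j.+1)).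
Proof.
set S := Lr d (fun=> 1); have S0 : 0 <= S by apply: Lr_ge0.
have cs h : Lr d h ^+ 2 <= S * Lr d (fun H => h H ^+ 2).
  set A := Lr d (fun H => h H ^+ 2); set B := Lr d h.
  have quad x : 0 <= A - 2 * x * B + x ^+ 2 * S.
    have -> : A - 2 * x * B + x ^+ 2 * S = Lr d (fun H => (h H - x) ^+ 2).
      rewrite /A /B /S -!LrZ -LrB -LrD; apply: eq_Lr => H _ _; ring.
    by apply: Lr_ge0 => H _ _; apply: sqr_ge0.
  have A0 : 0 <= A by apply: Lr_ge0 => H _ _; apply: sqr_ge0.
  (* With S = 0 the nonnegative quadratic is affine in x, which forces B = 0: at [(A + 1) / B] it
     would be negative. *)
  case: (eqVneq S 0) => [Sz|Sn].
    case: (eqVneq B 0) => [->|Bn]; first by rewrite expr0n /= mulr_ge0.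
    have := quad ((A + 1) / B); rewrite Sz mulr0 addr0 -mulrA divfK //; lra.
  have Sp : 0 < S by rewrite lt_def Sn.
  have := mulr_ge0 S0 (quad (B / S)).
  have -> : S * (A - 2 * (B / S) * B + (B / S) ^+ 2 * S) = S * A - B ^+ 2 by field.
  by rewrite subr_ge0.
elim: j g => [|j IH] g; first by rewrite expn1 expr1; apply: cs.
set q := (2 ^ j.+1)%N in IH *; have q0 : (0 < q)%N by rewrite expn_gt0.
have -> : (2 ^ j.+2 = q * 2)%N by rewrite expnSr.
have ev (x : R) : 0 <= x ^+ q by rewrite /q expnSr mulnC exprM exprn_ge0 // sqr_ge0.
rewrite exprM; apply: (@le_trans _ _ ((S ^+ q.-1 * Lr d (fun H => g H ^+ q)) ^+ 2)).
  by rewrite lerXn2r ?nnegrE // mulr_ge0 ?exprn_ge0 // Lr_ge0.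
rewrite exprMn -exprM.
have -> : ((q * 2).-1 = q.-1 * 2 + 1)%N by move: q0; clear; case: q => // q _; lia.
rewrite exprD expr1 -mulrA ler_wpM2l ?exprn_ge0 //.
apply: (le_trans (cs _)); rewrite ler_wpM2l //.
by apply: ler_Lr => H _ _; rewrite -exprM.
Qed.

End Ratio.

(** * From switchings to concentration of the likelihood ratio *)

Definition root2 (j : nat) (x : R) : R := iter j Num.sqrt x.

Lemma root2_ge0 j x : 0 <= x -> 0 <= root2 j x.
Proof. by case: j => //= j _; apply: sqrtr_ge0. Qed.

Lemma root2K j x : 0 <= x -> root2 j x ^+ (2 ^ j) = x.
Proof.
move=> x0; elim: j => [|j IH] //=.
by rewrite expnS exprM sqr_sqrtr // root2_ge0.
Qed.

Lemma exprS_gap (f g : R) q : 0 <= f -> 0 <= g -> (0 < q)%N ->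
  `|f - g| * f ^+ q.-1 <= `|f ^+ q - g ^+ q|.
Proof.
case: q => // q f0 g0 _ /=; rewrite !exprS.
have [gf|fg] := leP g f.
  have h : g ^+ q <= f ^+ q by rewrite lerXn2r.
  have h2 := ler_wpM2l g0 h.
  have h3 : g * f ^+ q <= f * f ^+ q by rewrite ler_wpM2r // exprn_ge0.
  rewrite !ger0_norm; [|lra|lra].
  rewrite mulrBl; lra.
have h : f ^+ q <= g ^+ q by rewrite lerXn2r ?nnegrE // ltW.
have h2 := ler_wpM2l g0 h.
have h3 : f * f ^+ q <= g * f ^+ q by rewrite ler_wpM2r ?exprn_ge0 // ltW.
rewrite !ler0_norm; [|lra|lra].
rewrite mulNr mulrBl; lra.
Qed.

Lemma even_pow_ge0 (x : R) j : 0 <= x ^+ (2 ^ j.+1).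
Proof. by rewrite expnS exprM exprn_ge0 // sqr_ge0. Qed.

Lemma even_pow_norm (x : R) j : `|x| ^+ (2 ^ j.+1) = x ^+ (2 ^ j.+1).
Proof. by rewrite expnS !exprM real_normK ?num_real. Qed.

Lemma bernoulli_ineq (x : R) q : 0 <= x -> 1 + q%:R * (x - 1) <= x ^+ q.
Proof.
move=> x0; elim: q => [|q IH]; first by rewrite expr0 mul0r addr0.
rewrite exprS; have h := ler_wpM2l x0 IH; have h2 := sqr_ge0 (x - 1).
have h3 : 0 <= q%:R * (x - 1) ^+ 2 by rewrite mulr_ge0.
rewrite -natr1; lra.
Qed.

Section Transfer.
Variables (n k m j : nat).
Hypotheses (k0 : (0 < k <= n)%N) (m0 : (0 < m < 'C(n, k))%N).
Let N := Nb n k.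
Let M := (k * m)%N.
Let q := (2 ^ j.+1)%N.
Let T : finType := ('I_n * 'I_N)%type.
Let L (d : degseq n) := Lr k m d (fun=> 1).
Let F (U : {set T}) : R := root2 j.+1 (L (slot_deg U)).
Implicit Types (d : degseq n) (H : {set {set 'I_n}}).

Let q0 : (0 < q)%N. Proof. by rewrite expn_gt0. Qed.

Let L0 d : 0 <= L d. Proof. exact: Lr_ge0. Qed.

Let F0 U : 0 <= F U. Proof. exact: root2_ge0. Qed.

Let FK U : F U ^+ q = L (slot_deg U). Proof. exact: root2K. Qed.

(** By [exprS_gap] the left side times L(d)^(q-1) is at most the q-th power of [Lr k m d v], and
    Jensen bounds that power with the same factor L(d)^(q-1). The factor cancels, so the estimate
    holds however small L(d) is. *)
Let root_gap d (v : {set {set 'I_n}} -> R) (g : R) : 0 <= g ->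
  g ^+ q = Lr k m d (fun H => 1 - v H) ->
  (root2 j.+1 (L d) - g) ^+ q <= Lr k m d (fun H => v H ^+ q).
Proof.
move=> g0 gq; set f := root2 _ _.
have f0 : 0 <= f by apply: root2_ge0.
have fq : f ^+ q = L d by apply: root2K.
have gE : f ^+ q - g ^+ q = Lr k m d v by rewrite gq LrB fq /L; ring.
have gap := exprS_gap f0 g0 q0; rewrite gE in gap.
have jn := Lr_jensen k m d v j; rewrite -/q -/(L d) in jn.
have Lv0 : 0 <= Lr k m d (fun H => v H ^+ q) by apply: Lr_ge0 => H _ _; apply: even_pow_ge0.
case: (eqVneq (L d) 0) => [Lz|Ln].
  have fz : f = 0.
    by have /eqP := fq; rewrite Lz expf_eq0 q0 => /eqP.
  have : Lr k m d v ^+ q <= 0.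
    apply: le_trans jn _; rewrite Lz expr0n; case: eqP => [e|_]; last by rewrite mul0r.
    by exfalso; move: e; rewrite /q expnS; case: (2 ^ j)%N (expn_gt0 2 j) => // z _; clear; lia.
  move=> h; have /eqP : Lr k m d v ^+ q = 0 by apply/eqP; rewrite eq_le h even_pow_ge0.
  rewrite expf_eq0 q0 /= -gE fz expr0n (gtn_eqF q0) /= sub0r oppr_eq0 expf_eq0 q0 /= => /eqP ->.
  by rewrite subrr expr0n (gtn_eqF q0).
have Lp : 0 < L d by rewrite lt_def Ln L0.
rewrite -(ler_pM2l (exprn_gt0 q.-1 Lp)); apply: le_trans jn.
rewrite -even_pow_norm -[X in _ <= X]even_pow_norm -fq -exprM mulnC exprM -exprMn mulrC.
by rewrite lerXn2r ?nnegrE ?mulr_ge0 ?exprn_ge0.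
Qed.

Lemma root_step d (d' : degseq n) (v v' : {set {set 'I_n}} -> R) :
  Lr k m d (fun H => 1 - v H) = Lr k m d' (fun H => 1 - v' H) ->
  0 <= Lr k m d (fun H => 1 - v H) ->
  (root2 j.+1 (L d) - root2 j.+1 (L d')) ^+ q <=
  2 ^+ q * (Lr k m d (fun H => v H ^+ q) + Lr k m d' (fun H => v' H ^+ q)).
Proof.
move=> E pos; set g := root2 j.+1 (Lr k m d (fun H => 1 - v H)).
have g0 : 0 <= g by apply: root2_ge0.
have gq : g ^+ q = Lr k m d (fun H => 1 - v H) by apply: root2K.
have h := root_gap g0 gq.
have h' : (root2 j.+1 (L d') - g) ^+ q <= Lr k m d' (fun H => v' H ^+ q).
  by apply: root_gap; rewrite // gq.
move: h h'; set f := root2 _ _; set f' := root2 _ _ => h h'.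
set A := Lr _ _ _ _ in h *; set A' := Lr _ _ _ _ in h' *.
have A0 : 0 <= A by apply: le_trans h; apply: even_pow_ge0.
have A0' : 0 <= A' by apply: le_trans h'; apply: even_pow_ge0.
have tri : `|f - f'| <= `|f - g| + `|f' - g|.
  have -> : f - f' = (f - g) - (f' - g) by ring.
  exact: ler_normB.
rewrite -even_pow_norm.
have [le|/ltW le] := leP `|f - g| `|f' - g|.
  apply: (@le_trans _ _ ((2 * `|f' - g|) ^+ q)).
    by rewrite lerXn2r ?nnegrE ?mulr_ge0 //; lra.
  by rewrite exprMn even_pow_norm ler_wpM2l ?exprn_ge0 //; lra.
apply: (@le_trans _ _ ((2 * `|f - g|) ^+ q)).
  by rewrite lerXn2r ?nnegrE ?mulr_ge0 //; lra.
by rewrite exprMn even_pow_norm ler_wpM2l ?exprn_ge0 //; lra.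
Qed.

Variable b : {set {set 'I_n}} -> R.

(** What a regime must supply to the moment method. The common average has to be nonnegative because
    its q-th root is the intermediate point between the roots at d and d'. The bound [b] may be
    large on rare hypergraphs, since it enters only through its mean. *)
Definition switch_bound := forall d (d' : degseq n) (a c : 'I_n), a != c ->
  (forall v, (d' v + (v == a) = d v + (v == c))%N) ->
  (forall v, d v <= N)%N -> (forall v, d' v <= N)%N ->
  (\sum_v d v = M)%N -> (\sum_v d' v = M)%N ->
  exists v v' : {set {set 'I_n}} -> R,
  [/\ Lr k m d (fun H => 1 - v H) = Lr k m d' (fun H => 1 - v' H),
      0 <= Lr k m d (fun H => 1 - v H),
      forall H, H \in khg n k m -> degs n H = d -> v H ^+ q <= b H &
      forall H, H \in khg n k m -> degs n H = d' -> v' H ^+ q <= b H].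

Hypotheses (b0 : forall H, 0 <= b H) (sb : switch_bound).

Let Mt : (M < #|T|)%N. Proof. exact: (M_lt_slots k0 m0). Qed.
Let Mp : (0 < M)%N. Proof. exact: (M_gt0 k0 m0). Qed.

Let bbar : R := (\sum_(H in khg n k m) b H) / #|khg n k m|%:R.

Lemma swap_avg_root_le :
  swap_avg M (fun U V => (F U - F V) ^+ q) <= 2 * 2 ^+ q * bbar.
Proof.
pose rho (U : {set T}) := Lr k m (slot_deg U) b.
apply: (@le_trans _ _ (swap_avg M (fun U V => 2 ^+ q * (rho U + rho V)))).
  apply: ler_swap_avg => // x y U UM xU yU.
  (* A swap of two slots of the same vertex does not change the degree vector. *)
  case: (eqVneq x.1 y.1) => [xy|xy].
    have e : slot_deg (swapset x y U) = slot_deg U.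
      by apply/ffunP => v; have := slot_deg_swap v xU yU; rewrite xy; apply: addIn.
    by rewrite /F /rho e subrr expr0n (gtn_eqF q0) mulr_ge0 ?exprn_ge0 // addr_ge0 // Lr_ge0.
  have dd v := slot_deg_swap v xU yU.
  have [||||v [v' [E pos h h']]] := sb xy dd.
  - exact: slot_deg_le.
  - exact: slot_deg_le.
  - by rewrite sum_slot_deg.
  - by rewrite sum_slot_deg card_swapset.
  apply: (le_trans (root_step E pos)); rewrite ler_wpM2l ?exprn_ge0 //.
  by apply: lerD; apply: ler_Lr.
rewrite swap_avgZ swap_avgD (swap_avgl Mp Mt) (swap_avgr Mp Mt) /rho slice_avg_Lr // -/bbar.
by rewrite le_eqVlt; apply/orP; left; apply/eqP; ring.
Qed.

Lemma ler_slice_avg (h h' : {set T} -> R) :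
  (forall U : {set T}, #|U| = M -> h U <= h' U) -> slice_avg M h <= slice_avg M h'.
Proof.
move=> hh; rewrite ler_wpM2r ?invr_ge0 //; apply: ler_sum => U.
by rewrite mem_slice0 => /eqP; apply: hh.
Qed.

Lemma slice_avgZ (x : R) (h : {set T} -> R) : slice_avg M (fun U => x * h U) = x * slice_avg M h.
Proof. by rewrite /slice_avg /slice_mean -mulr_sumr mulrA. Qed.

Lemma slice_avgB (h h' : {set T} -> R) :
  slice_avg M (fun U => h U - h' U) = slice_avg M h - slice_avg M h'.
Proof. by rewrite /slice_avg /slice_mean sumrB mulrBl. Qed.

Lemma slice_avgC (x : R) : slice_avg M (fun _ : {set T} => x) = x.
Proof.
rewrite /slice_avg /slice_mean sumr_const -(mulr_natr x) mulfK // pnatr_eq0 -lt0n.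
exact: slice0_gt0.
Qed.

Definition deviation : R := slice_avg M (fun U => (F U - slice_avg M F) ^+ q).

Lemma PrB_evE (P : degseq n -> bool) :
  PrB_ev n k m P = slice_avg M (fun U : {set T} => (P (slot_deg U))%:R).
Proof.
rewrite /slice_avg /slice_mean slice0_slots // -/N /PrB_ev.
pose phi (U : {set T}) : {ffun 'I_n -> 'I_N.+1} := [ffun v => inord (slot_deg U v)].
have phiE (U : {set T}) : lift_deg n N (phi U) = slot_deg U.
  by apply/ffunP => v; rewrite ffunE [phi U v]ffunE inordK // ltnS slot_deg_le.
rewrite [X in _ = X / _](partition_big phi predT) //= mulr_suml big_mkcond /=.
apply: eq_bigr => d _.
have eqphi (U : {set T}) : (phi U == d) = (slot_deg U == lift_deg n N d).
  apply/eqP/eqP => [<-|e]; first by rewrite phiE.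
  by apply/ffunP => v; apply: val_inj; rewrite /= ffunE inordK ?e ?ffunE // ltnS slot_deg_le.
have sumd (U : {set T}) : slot_deg U == lift_deg n N d -> #|U| = (\sum_v (d v : nat))%N.
  by move=> /eqP e; rewrite -sum_slot_deg e; apply: eq_bigr => v _; rewrite ffunE.
case: ifP => [/andP[/eqP dM Pd]|nd].
  rewrite (eq_bigr (fun=> 1)) => [|U /andP[_]]; last by rewrite eqphi => /eqP ->; rewrite Pd.
  rewrite (eq_bigl (fun U : {set T} => slot_deg U == lift_deg n N d)) => [|U]; last first.
    rewrite mem_slice0 eqphi; case: (boolP (slot_deg U == _)) => [e|]; rewrite ?andbF ?andbT //.
    by rewrite (sumd _ e) dM eqxx.
  rewrite sumr_const /PrB -/N; congr (_%:R / _); rewrite -card_slot_deg.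
  by apply: eq_card => U; rewrite in_set.
rewrite big1 ?mul0r // => U /andP[UM]; rewrite eqphi => e.
case: (boolP (P (slot_deg U))) => // PU; case/negP: nd.
by rewrite -(sumd _ e) -(eqP e) PU andbT -mem_slice0.
Qed.

Lemma PrD_evE (P : degseq n -> bool) :
  PrD_ev n k m P = slice_avg M (fun U : {set T} => L (slot_deg U) * (P (slot_deg U))%:R).
Proof.
transitivity (slice_avg M (fun U : {set T} => Lr k m (slot_deg U) (fun H => (P (degs n H))%:R))).
  rewrite slice_avg_Lr // /PrD_ev; congr (_ / _).
  rewrite -sum1dep_card natr_sum big_mkcondr /=; apply: eq_bigr => H _.
  by case: (P _).
rewrite /slice_avg /slice_mean; congr (_ / _); apply: eq_bigr => U _.
rewrite mulrC -LrZ; apply: eq_Lr => H _ <-; by rewrite mulr1.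
Qed.

Lemma slice_avg_L : slice_avg M (fun U : {set T} => L (slot_deg U)) = 1.
Proof.
rewrite slice_avg_Lr // sumr_const divff // pnatr_eq0 -lt0n; exact: card_khg_gt0.
Qed.

Definition ratio_close (g : R) (d : degseq n) : bool :=
  ((\sum_v d v)%N == M) && (`|PrD n k m d - PrB n k m d| <= g * PrB n k m d).

(** As F^q = L has mean 1, the mean c of F is pinned between 1 - t and 1. Far from c, both 1 and L
    are dominated by the same multiple of (F - c)^q, so one Markov argument bounds the exceptional
    probability in B and, with L as density, in D. *)
Lemma close_prob (t g : R) : 0 < t -> t <= 1 / 2 -> (3 / t) ^+ q * deviation < t / 2 ->
  q%:R * 2 ^+ q * t <= g ->
  1 - PrB_ev n k m (ratio_close g) <= (3 / t) ^+ q * deviation /\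
  1 - PrD_ev n k m (ratio_close g) <= (3 / t) ^+ q * deviation.
Proof.
move=> t0 t1 small tg; set c := slice_avg M F.
have t3 : 3 <= 3 / t by rewrite ler_pdivlMr //; lra.
have cdef : c = slice_avg M F by [].
have dE : deviation = slice_avg M (fun U => (F U - c) ^+ q) by [].
have c0 : 0 <= c by apply: slice_avg_ge0.
have Fq1 : slice_avg M (fun U => F U ^+ q) = 1.
  rewrite -slice_avg_L; apply: le_anti; apply/andP; split;
  by apply: ler_slice_avg => U _; rewrite FK.
have c1 : c <= 1.
  have h : q%:R * (c - 1) <= 0.
    have -> : q%:R * (c - 1) = slice_avg M (fun U => q%:R * (F U - 1)).
      by rewrite slice_avgZ slice_avgB slice_avgC.
    apply: (@le_trans _ _ (slice_avg M (fun U => F U ^+ q - 1))).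
      by apply: ler_slice_avg => U _; have := bernoulli_ineq q (F0 U); lra.
    by rewrite slice_avgB Fq1 slice_avgC subrr.
  by move: h; rewrite pmulr_rle0 ?ltr0n // subr_le0.
(* Since c <= 1 and the distance [|F U - c|] exceeds t / 2, the bound [c + |F U - c|] for [F U] is
   at most 2 / t + 1 / t times the distance; this is the 3 in 3 / t. *)
have far (U : {set T}) s : t / 2 <= s -> s <= t -> s < `|F U - c| ->
    1 <= (3 / t) ^+ q * (F U - c) ^+ q /\ F U ^+ q <= (3 / t) ^+ q * (F U - c) ^+ q.
  move=> ts st sF.
  have u1 : 1 <= 3 / t * `|F U - c|.
    rewrite mulrAC ler_pdivlMr // mul1r; lra.
  have u2 : F U <= 3 / t * `|F U - c|.
    have : F U <= c + `|F U - c| by have := ler_norm (F U - c); lra.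
    move=> h; apply: (le_trans h).
    have h2 : c <= 2 / t * `|F U - c| by rewrite (le_trans c1) // mulrAC ler_pdivlMr // mul1r; lra.
    have h3 : `|F U - c| <= 1 / t * `|F U - c|.
      by rewrite mulrAC ler_pdivlMr // mul1r ler_piMr //; lra.
    have -> : 3 / t * `|F U - c| = 2 / t * `|F U - c| + 1 / t * `|F U - c| by field; rewrite gt_eqF.
    lra.
  rewrite -(even_pow_norm (F U - c)) -exprMn; split; first by rewrite exprn_ege1.
  by rewrite lerXn2r ?nnegrE // mulr_ge0 // divr_ge0 // ltW.
have c2 : 1 - t < c.
  (* If c <= 1 - t, then F^q <= F <= 1 - t / 2 wherever F is within t / 2 of c, and the remaining
     points add at most the deviation term, which is below t / 2: the mean of F^q could not be 1. *)
  rewrite ltNge; apply/negP => ct.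
  have : 1 <= 1 - t / 2 + (3 / t) ^+ q * deviation.
    have -> : 1 - t / 2 + (3 / t) ^+ q * deviation =
       slice_avg M (fun U => (1 - t / 2) - (- ((3 / t) ^+ q) * (F U - c) ^+ q)).
      by rewrite slice_avgB slice_avgC slice_avgZ -dE; ring.
    rewrite -[X in X <= _]Fq1.
    apply: ler_slice_avg => U _; rewrite mulNr opprK.
    have p0 : 0 <= (3 / t) ^+ q * (F U - c) ^+ q.
      by rewrite mulr_ge0 ?even_pow_ge0.
    have [le|lt] := leP `|F U - c| (t / 2); last first.
      have tt : t / 2 <= t by lra.
      have [_ h] := far U (t / 2) (lexx _) tt lt; lra.
    have FU : F U <= 1 - t / 2 by have := ler_norm (F U - c); lra.
    have : F U ^+ q <= F U ^+ 1 by rewrite ler_wiXn2l //; lra.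
    rewrite expr1; lra.
  lra.
have near (U : {set T}) : #|U| = M -> ~~ ratio_close g (slot_deg U) -> t < `|F U - c|.
  move=> UM; rewrite /ratio_close sum_slot_deg UM eqxx /= -ltNge => h; rewrite ltNge; apply/negP => le.
  move: h; rewrite ltNge => /negP; apply.
  have P0 : 0 < PrB n k m (slot_deg U) by apply: PrB_gt0 => // v; apply: slot_deg_le.
  have LE : PrD n k m (slot_deg U) = L (slot_deg U) * PrB n k m (slot_deg U).
    by rewrite /L LrE divfK // gt_eqF.
  rewrite LE -{2}[PrB n k m _]mul1r -mulrBl normrM (ger0_norm (ltW P0)) ler_wpM2r ?(ltW P0) //.
  apply: le_trans tg; rewrite -FK -[1 in X in X <= _](expr1n _ q).
  have F1 : `|F U - 1| <= 2 * t.
    by have := ler_norm (F U - c); move: le; rewrite !ler_norml => /andP[l1 l2]; lra.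
  have F2 : `|F U| <= 2.
    by rewrite ger0_norm //; move: F1; rewrite ler_norml => /andP[l1 l2]; lra.
  have n2 : `|1 : R| <= 2 by rewrite normr1; lra.
  apply: (le_trans (subrX_le q F2 n2)).
  have e2 : 2 ^+ q = 2 * 2 ^+ q.-1 :> R by rewrite -exprS prednK.
  have p2 : 0 <= q%:R * 2 ^+ q.-1 :> R by rewrite mulr_ge0 ?exprn_ge0.
  rewrite e2; have h := ler_wpM2l p2 F1; lra.
have fin (w : {set T} -> R) : slice_avg M w = 1 ->
  (forall U : {set T}, t < `|F U - c| -> w U <= (3 / t) ^+ q * (F U - c) ^+ q) ->
  1 - slice_avg M (fun U : {set T} => w U * (ratio_close g (slot_deg U))%:R) <= (3 / t) ^+ q * deviation.
  move=> w1 wU; rewrite -[X in X - _]w1 -slice_avgB dE -slice_avgZ; apply: ler_slice_avg => U UM.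
  case: (boolP (ratio_close g (slot_deg U))) => cl; first by rewrite mulr1 subrr mulr_ge0 ?even_pow_ge0.
  by rewrite mulr0 subr0 wU // near.
have tt : t / 2 <= t by lra.
split.
  rewrite PrB_evE.
  have -> : slice_avg M (fun U : {set T} => (ratio_close g (slot_deg U))%:R : R) =
     slice_avg M (fun U : {set T} => (1 : R) * (ratio_close g (slot_deg U))%:R).
    by rewrite /slice_avg /slice_mean; congr (_ / _); apply: eq_bigr => U _; rewrite mul1r.
  apply: fin; first exact: slice_avgC.
  by move=> U lt; have [] := far U t tt (lexx _) lt.
rewrite PrD_evE; apply: fin; first exact: slice_avg_L.
by move=> U lt; have [_] := far U t tt (lexx _) lt; rewrite FK.
Qed.

End Transfer.

(** * Sparse and dense regimes *)

(* The deviation at which the Chernoff bound for mean nu is exp(-tau). *)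
Definition dev (nu tau : R) : R := 4 * (Num.sqrt (nu * tau) + tau).

Section MeanDegrees.
Variables (n k m : nat) (tau : R).

Definition avg_deg : R := k%:R * m%:R / n%:R.
Definition pair_frac : R := k.-1%:R / n.-1%:R.
(* The mean of fixed_deg a b when the k-sets are edges independently with probability m / 'C(n, k). *)
Definition fixed_mean : R := avg_deg * (pair_frac + m%:R / 'C(n, k)%:R * (1 - pair_frac)).

Definition typical (H : {set {set 'I_n}}) : bool :=
  [forall v : 'I_n, `|(degs n H v)%:R - avg_deg| <= dev avg_deg tau] &&
  [forall a : 'I_n, forall b : 'I_n,
     (a != b) ==> (`|(fixed_deg a b H)%:R - fixed_mean| <= dev fixed_mean tau)].

Lemma avg_deg_ge0 : 0 <= avg_deg.
Proof. by rewrite divr_ge0 // mulr_ge0. Qed.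

Lemma pair_frac_ge0 : 0 <= pair_frac.
Proof. by rewrite divr_ge0. Qed.

Lemma pair_frac_le1 : (1 < n)%N -> (0 < k <= n)%N -> pair_frac <= 1.
Proof.
move=> n1 /andP[_ kn].
rewrite ler_pdivrMr ?mul1r ?ler_nat ?ltr0n; last by case: (n) n1 => // -[].
by rewrite -!subn1 leq_sub2r.
Qed.

Lemma fixed_mean_ge0 : (1 < n)%N -> (0 < k <= n)%N -> (m <= 'C(n, k))%N -> 0 <= fixed_mean.
Proof.
move=> n1 k0 mE; rewrite mulr_ge0 ?avg_deg_ge0 // addr_ge0 ?pair_frac_ge0 //.
by rewrite mulr_ge0 ?divr_ge0 // subr_ge0 pair_frac_le1.
Qed.

End MeanDegrees.

Lemma deviation_le (j : nat) : exists2 C : R, 0 < C &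
  forall (n k m : nat) (b : {set {set 'I_n}} -> R),
  (0 < k <= n)%N -> (0 < m < 'C(n, k))%N -> (forall H, 0 <= b H) -> switch_bound k m j b ->
  deviation n k m j <= C * (k * m)%:R ^+ (2 ^ j) *
     ((\sum_(H in khg n k m) b H) / #|khg n k m|%:R).
Proof.
have [C C0 mom] := slice_moment R j.
exists (C * (2 * 2 ^+ (2 ^ j.+1))); first by rewrite !mulr_gt0 // exprn_gt0.
move=> n k m b k0 m0 b0 sb; have sw := swap_avg_root_le k0 m0 b0 sb.
rewrite /deviation.
set F := fun U : {set 'I_n * 'I_(Nb n k)} => root2 j.+1 (Lr k m (slot_deg U) (fun=> 1)); set c := slice_avg _ F.
have zero : slice_avg (k * m) (fun U => F U - c) = 0.
  by rewrite (slice_avgB) slice_avgC // subrr.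
have mm := mom _ _ (fun U => F U - c) (M_gt0 k0 m0) (M_lt_slots k0 m0) zero.
have e : swap_avg (k * m) (fun U V => (F U - c - (F V - c)) ^+ (2 ^ j.+1)) =
          swap_avg (k * m) (fun U V => (F U - F V) ^+ (2 ^ j.+1)).
  rewrite /swap_avg /swap_energy; congr (_ / _).
  by do 3 (apply: eq_bigr => ? _); congr (_ ^+ _); ring.
rewrite e in mm; apply: (le_trans mm).
rewrite -[swap_avg _ _]/(swap_avg (k * m) (fun U V => (F U - F V) ^+ (2 ^ j.+1))) in sw.
set S := swap_avg _ _ in sw *; set B := _ / _ in sw *.
have M0 : (0 : R) <= (k * m)%:R ^+ (2 ^ j) by rewrite exprn_ge0.
have := ler_wpM2l (mulr_ge0 (ltW C0) M0) sw; lra.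
Qed.

(** * Switching errors for small average degree *)

Section Regimes.
Variables (n k m j : nat).
Hypotheses (k0 : (0 < k <= n)%N) (m0 : (0 < m < 'C(n, k))%N).
Let N := Nb n k.
Let M := (k * m)%N.
Let q := (2 ^ j.+1)%N.
Implicit Types (d : degseq n) (H : {set {set 'I_n}}).

Section Sparse.
Variable Delta : nat.
Hypotheses (k3 : (2 < k)%N) (sparse : (2 * (2 * (k * Delta) + 2 * Delta ^ 2) <= k * m)%N).

(** The first term comes from the binomial weight 1 - d_a / (N + 1); the second bounds the mean of
    [fixed_deg] divided by [d a]. *)
Definition sparse_bound : R :=
  Delta%:R / N.+1%:R + Delta%:R * (2 * k%:R / M%:R + 4 * k%:R ^+ 4 * Delta%:R ^+ 2 / (M%:R ^+ 2 * k.-1%:R)).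

Let Mp : (0 : R) < M%:R. Proof. by rewrite ltr0n; apply: M_gt0 m0. Qed.
Let k1p : (0 : R) < k.-1%:R. Proof. by rewrite ltr0n; case: (k) k3 => // -[]. Qed.

Lemma Lr_fixed_deg_le d (a c : 'I_n) : a != c -> (forall v, d v <= Delta)%N ->
  Lr k m d (fun H => (fixed_deg a c H)%:R) <=
  (d a)%:R * Delta%:R * (2 * k%:R / M%:R + 4 * k%:R ^+ 4 * Delta%:R ^+ 2 / (M%:R ^+ 2 * k.-1%:R)) *
   Lr k m d (fun=> 1).
Proof.
move=> ac dD; have := sum_fixed_deg_le dD k3 sparse ac.
set RR := realizations k m d; rewrite -/M; clearbody M; rewrite -(ler_nat R) !natrM natrD !natrM ?natrX => h.
rewrite /Lr; set den := (#|khg n k m|%:R * PrB n k m d)^-1.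
have den0 : 0 <= den by rewrite invr_ge0 Lr_den_ge0.
have e1 : \sum_(H in khg n k m | degs n H == d) (fixed_deg a c H)%:R =
    (\sum_(H in RR) fixed_deg a c H)%N%:R :> R.
  by rewrite natr_sum; apply: eq_bigl => H; rewrite [RHS]in_set.
have e2 : \sum_(H in khg n k m | degs n H == d) 1 = #|RR|%:R :> R.
  by rewrite -sum1_card natr_sum; apply: eq_bigl => H; rewrite [RHS]in_set.
rewrite e1 e2 mulrA ler_wpM2r //.
set S := (\sum_(H in RR) _)%N%:R in h *.
have P : (0 : R) < M%:R * M%:R * k.-1%:R by rewrite !mulr_gt0.
rewrite -(ler_pM2l P); apply: (@le_trans _ _ (M%:R * M%:R * (k.-1%:R * S))); first by lra.
apply: (le_trans h).
have dc : ((d c)%:R : R) <= Delta%:R by rewrite ler_nat.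
set Z := 2 * k%:R * k.-1%:R * M%:R + 4 * k%:R ^+ 4 * Delta%:R ^+ 2.
have Z0 : 0 <= Z by rewrite /Z addr_ge0 // !mulr_ge0 ?exprn_ge0.
have W0 : 0 <= #|RR|%:R * (d a)%:R * Z by rewrite !mulr_ge0.
apply: (@le_trans _ _ (#|RR|%:R * (d a)%:R * Z * Delta%:R)).
  have := ler_wpM2l W0 dc; rewrite /Z; lra.
rewrite le_eqVlt; apply/orP; left; apply/eqP; rewrite /Z; field.
by rewrite !gt_eqF.
Qed.

(* The average of 1 - (1 - a/M1)(1 - X/a) over the realisations of d. *)
Let defect d (a c : 'I_n) : R :=
  Lr k m d (fun H => 1 - (1 - (d a)%:R / N.+1%:R) * (1 - (fixed_deg a c H)%:R / (d a)%:R)) / Lr k m d (fun=> 1).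

Let weight0 d (a c : 'I_n) H : (0 < d a)%N -> (d a <= N)%N -> degs n H = d ->
  0 <= ((1 - (d a)%:R / N.+1%:R) * (1 - (fixed_deg a c H)%:R / (d a)%:R) : R) <= 1.
Proof.
move=> da dN dH.
have X : ((fixed_deg a c H)%:R : R) <= (d a)%:R by rewrite ler_nat -dH fixed_deg_le.
have dap : (0 : R) < (d a)%:R by rewrite ltr0n.
have N1 : (0 : R) < N.+1%:R by rewrite ltr0n.
have x1 : (fixed_deg a c H)%:R / (d a)%:R <= 1 :> R by rewrite ler_pdivrMr // mul1r.
have x0 : 0 <= (fixed_deg a c H)%:R / (d a)%:R :> R by rewrite divr_ge0.
have y1 : (d a)%:R / N.+1%:R <= 1 :> R by rewrite ler_pdivrMr // mul1r ler_nat ltnW.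
have y0 : 0 <= (d a)%:R / N.+1%:R :> R by rewrite divr_ge0.
by rewrite mulr_ge0 ?subr_ge0 //= mulr_ile1 ?subr_ge0 // gerBl.
Qed.

Let defect_LrE d (a c : 'I_n) : (0 < d a)%N -> (d a <= N)%N ->
  Lr k m d (fun _ => 1 - defect d a c) =
  Lr k m d (fun H => (1 - (d a)%:R / N.+1%:R) * (1 - (fixed_deg a c H)%:R / (d a)%:R)).
Proof.
move=> da dN; set g := fun H => (1 - (d a)%:R / N.+1%:R) * _.
have gE : Lr k m d (fun H => 1 - g H) = Lr k m d (fun=> 1) - Lr k m d g by rewrite LrB.
have -> : Lr k m d (fun _ => 1 - defect d a c) = Lr k m d (fun=> 1) - defect d a c * Lr k m d (fun=> 1).
  by rewrite LrB -LrZ; congr (_ - _); apply: eq_Lr => H _ _; rewrite mulr1.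
(* If the mass is 0, [defect] is 0 by the convention on division, and both sides vanish because the
   weight lies between 0 and 1. *)
case: (eqVneq (Lr k m d (fun=> 1)) 0) => [L0|Ln].
  rewrite L0 mulr0 subr0; apply/esym/le_anti; apply/andP; split.
    by rewrite -L0; apply: ler_Lr => H _ dH; have /andP[] := weight0 c da dN dH.
  by apply: Lr_ge0 => H _ dH; have /andP[] := weight0 c da dN dH.
by rewrite /defect divfK // gE; ring.
Qed.

Let defect_pow d (a c : 'I_n) : a != c -> (0 < d a)%N -> (d a <= N)%N ->
  defect d a c ^+ q <= sparse_bound ^+ q + (~~ [forall v, d v <= Delta]%N)%:R.
Proof.
move=> ac da dN.
have L0 : 0 <= Lr k m d (fun=> 1) by apply: Lr_ge0.
have w0 H : degs n H = d -> 0 <= (1 - (1 - (d a)%:R / N.+1%:R) * (1 - (fixed_deg a c H)%:R / (d a)%:R) : R) <= 1.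
  by move=> dH; have /andP[h1 h2] := weight0 c da dN dH; rewrite subr_ge0 h2 gerBl h1.
have u0 : 0 <= defect d a c.
  by rewrite divr_ge0 //; apply: Lr_ge0 => H _ /w0 /andP[].
have z0 : 0 <= sparse_bound.
  by rewrite addr_ge0 ?divr_ge0 // mulr_ge0 // addr_ge0 // divr_ge0 ?mulr_ge0 ?exprn_ge0.
have u1 : defect d a c <= 1.
  case: (eqVneq (Lr k m d (fun=> 1)) 0) => [e|Ln]; first by rewrite /defect e invr0 mulr0.
  have Lp : 0 < Lr k m d (fun=> 1) by rewrite lt_def Ln.
  by rewrite ler_pdivrMr // mul1r; apply: ler_Lr => H _ /w0 /andP[].
case: (boolP [forall v, d v <= Delta]%N) => [/forallP dD|_] /=; last first.
  by apply: (@le_trans _ _ 1); [rewrite exprn_ile1|rewrite lerDr exprn_ge0].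
rewrite addr0 lerXn2r ?nnegrE // /defect.
case: (eqVneq (Lr k m d (fun=> 1)) 0) => [->|Ln]; first by rewrite invr0 mulr0.
have Lp : 0 < Lr k m d (fun=> 1) by rewrite lt_def Ln.
rewrite ler_pdivrMr //.
have dap : (0 : R) < (d a)%:R by rewrite ltr0n.
have N1 : (0 : R) < N.+1%:R by rewrite ltr0n.
have ax := Lr_fixed_deg_le ac dD.
apply: (@le_trans _ _ (Lr k m d (fun H => (d a)%:R / N.+1%:R * 1 + (d a)%:R^-1 * (fixed_deg a c H)%:R))).
  apply: ler_Lr => H _ _.
  have x0 : 0 <= (fixed_deg a c H)%:R / (d a)%:R :> R by rewrite divr_ge0.
  have y0 : 0 <= (d a)%:R / N.+1%:R :> R by rewrite divr_ge0.
  rewrite [(d a)%:R^-1 * _]mulrC mulr1; have := mulr_ge0 x0 y0.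
  set x := (fixed_deg a c H)%:R / _; set y := (d a)%:R / _; lra.
rewrite LrD !LrZ mulrDl; apply: lerD.
  by rewrite ler_wpM2r // ler_wpM2r ?invr_ge0 // ler_nat.
rewrite mulrC ler_pdivrMr //; apply: (le_trans ax).
by rewrite le_eqVlt; apply/orP; left; apply/eqP; ring.
Qed.

(** Only the average of [fixed_deg] is under control here, so the errors are taken constant over the
    realisations of d and of d'. A sequence with a degree above [Delta] gets the trivial bound 1,
    charged to the indicator. *)
Lemma sparse_switch_bound :
  switch_bound k m j (fun H => sparse_bound ^+ q + (~~ [forall v, degs n H v <= Delta]%N)%:R).
Proof.
move=> d d' a c ac dd dN d'N _ _.
have ca : c != a by rewrite eq_sym.
have da : (d a = (d' a).+1)%N by have := dd a; rewrite eqxx (negbTE ac) addn1 addn0.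
have dc : (d' c = (d c).+1)%N by have := dd c; rewrite eqxx (negbTE ca) addn1 addn0.
have da0 : (0 < d a)%N by rewrite da.
have dc0 : (0 < d' c)%N by rewrite dc.
exists (fun=> defect d a c), (fun=> defect d' c a); split.
- rewrite !defect_LrE //.
  have dap : (0 : R) < (d a)%:R by rewrite ltr0n.
  have dcp : (0 : R) < (d' c)%:R by rewrite ltr0n.
  have N1 : (0 : R) < N.+1%:R by rewrite ltr0n.
  have := switch_Lr k0 m0 (fun=> ((d a)%:R * (d' c)%:R * N.+1%:R)^-1) ac dd dN d'N.
  rewrite /= -/N; move: (N.+1%:R : R) N1 => NN N1 e.
  transitivity (Lr k m d (fun H => ((d a)%:R * (d' c)%:R * NN)^-1 *
     (((d a)%:R - (fixed_deg a c H)%:R) * ((d' c)%:R * (NN - (d a)%:R))))).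
    by apply: eq_Lr => H _ _; field; rewrite !lt0r_neq0.
  by rewrite e; apply: eq_Lr => H _ _; rewrite (fixed_degC c a); field; rewrite !lt0r_neq0.
- rewrite defect_LrE //; apply: Lr_ge0 => H _ dH; by have /andP[] := weight0 c da0 (dN a) dH.
- by move=> H _ ->; apply: defect_pow.
- by move=> H _ ->; apply: defect_pow.
Qed.

End Sparse.

End Regimes.

(** * Switching errors for large average degree *)

Lemma ratio_gap_le (D r e a b X M1 : R) : 0 < D -> 0 <= r -> 0 <= e -> r + 1 <= D / 4 ->
  `|a - D| <= r -> `|b - D| <= r + 1 -> 2 * X <= b -> 2 * (D + r + 1) <= M1 -> 0 <= X ->
  `|a * b - M1 * X| <= e * M1 ->
  `|1 - (a - X) * (b * (M1 - a)) / ((b - X) * (a * (M1 - b)))| <= 16 * (2 * r + 1) * e / D ^+ 2.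
Proof.
move=> D0 r0 e0 rD; rewrite !ler_norml => /andP[a1 a2] /andP[b1 b2] Xb DM X0 /andP[h1 h2].
have pa : D / 2 <= a by lra.
have pb : D / 4 <= b - X by lra.
have M0 : 0 < M1 by lra.
have pM : M1 / 2 <= M1 - b by lra.
have a0 : 0 < a by lra.
have bX : 0 < b - X by lra.
have Mb : 0 < M1 - b by lra.
have den : 0 < (b - X) * (a * (M1 - b)) by rewrite !mulr_gt0.
(* The numerator factors exactly into two small differences, a - b and a b - M1 X. The first alone
   would give an error of order r / D, too large to be multiplied by sqrt(km). The 16 comes from the
   lower bound [D / 4 * (D / 2 * (M1 / 2))] for the denominator. *)
have -> : 1 - (a - X) * (b * (M1 - a)) / ((b - X) * (a * (M1 - b))) =
   (a - b) * (a * b - M1 * X) / ((b - X) * (a * (M1 - b))).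
  by field; rewrite !lt0r_neq0.
rewrite -ler_norml normrM (ger0_norm (_ : 0 <= _^-1)) ?invr_ge0 ?(ltW den) // ler_pdivrMr // normrM.
have n1 : `|a - b| <= 2 * r + 1 by rewrite ler_norml; apply/andP; split; lra.
have n2 : `|a * b - M1 * X| <= e * M1 by rewrite ler_norml h1 h2.
have dl : D / 4 * (D / 2 * (M1 / 2)) <= (b - X) * (a * (M1 - b)).
  by apply: ler_pM; rewrite ?mulr_ge0 ?ler_pM //; lra.
apply: (@le_trans _ _ ((2 * r + 1) * (e * M1))).
  by apply: ler_pM.
have c0 : 0 <= 16 * (2 * r + 1) * e / D ^+ 2.
  by rewrite divr_ge0 ?sqr_ge0 // !mulr_ge0 //; lra.
apply: le_trans (ler_wpM2l c0 dl).
rewrite le_eqVlt; apply/orP; left; apply/eqP; field; by rewrite lt0r_neq0.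
Qed.

Lemma twice_codegree_le (D r nu s b X : R) : 2 * (nu + s) <= D - r -> `|b - D| <= r ->
  `|X - nu| <= s -> 2 * X <= b.
Proof. by rewrite !ler_norml => ? /andP[? ?] /andP[? ?]; lra. Qed.

(** Since D = p N, the mean nu of X is close to D p = D^2 / N. The error terms come from passing
    from a b to D^2, then to (N + 1) nu, then to (N + 1) X; [D * kappa] is the share of the edges
    containing both vertices. *)
Lemma codegree_err_le (p N D kappa nu r s a b X : R) : 0 <= p <= 1 -> 0 <= N -> 0 <= kappa ->
  D = p * N -> nu = D * (kappa + p * (1 - kappa)) -> 0 <= r <= D ->
  `|a - D| <= r -> `|b - D| <= r + 1 -> `|X - nu| <= s ->
  `|a * b - (N + 1) * X| <= (s + D * kappa + 3 * p * (r + 1) + p ^+ 2) * (N + 1).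
Proof.
move=> /andP[p0 p1] N0 kap0 DE nuE /andP[r0 rD] ha hb hX.
have D0 : 0 <= D := le_trans r0 rD.
have x1 : `|a * b - D ^+ 2| <= 3 * D * (r + 1).
  have -> : a * b - D ^+ 2 = D * (a - D) + D * (b - D) + (a - D) * (b - D) by ring.
  apply: (le_trans (ler_normD _ _)); apply: (@le_trans _ _ (D * r + D * (r + 1) + r * (r + 1))).
    apply: lerD; last by rewrite normrM ler_pM.
    apply: (le_trans (ler_normD _ _)).
    by rewrite !normrM (ger0_norm D0) lerD // ler_wpM2l.
  have : r * (r + 1) <= D * (r + 1) by apply: ler_wpM2r => //; rewrite addr_ge0.
  lra.
have x2 : `|D ^+ 2 - (N + 1) * nu| <= (p ^+ 2 + D * kappa) * (N + 1).
  have -> : D ^+ 2 - (N + 1) * nu = - (p * D + (N + 1) * (D * kappa) * (1 - p)).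
    by rewrite nuE DE; ring.
  have N10 : 0 <= N + 1 by rewrite addr_ge0.
  have q0 : 0 <= (N + 1) * (D * kappa) by rewrite !mulr_ge0.
  have q1 : 0 <= p * D by rewrite mulr_ge0.
  have q2 : 0 <= p * ((N + 1) * (D * kappa)) by rewrite mulr_ge0.
  have q3 : 0 <= (N + 1) * (D * kappa) * (1 - p) by rewrite mulr_ge0 // subr_ge0.
  rewrite normrN (ger0_norm (addr_ge0 q1 q3)).
  have : p * D <= p ^+ 2 * (N + 1).
    by rewrite DE mulrA -expr2 ler_wpM2l ?sqr_ge0 // lerDl.
  lra.
have x3 : `|(N + 1) * nu - (N + 1) * X| <= s * (N + 1).
  by rewrite -mulrBr normrM ger0_norm ?addr_ge0 // mulrC distrC ler_wpM2r // addr_ge0.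
have x4 : 3 * D * (r + 1) <= 3 * p * (r + 1) * (N + 1).
  have g0 : 0 <= 3 * p * (r + 1) by rewrite !mulr_ge0 // addr_ge0.
  have -> : 3 * D * (r + 1) = 3 * p * (r + 1) * N by rewrite DE; ring.
  by rewrite ler_wpM2l // lerDl.
have -> : a * b - (N + 1) * X = (a * b - D ^+ 2) + (D ^+ 2 - (N + 1) * nu) + ((N + 1) * nu - (N + 1) * X).
  by ring.
apply: (le_trans (ler_normD _ _)); apply: (@le_trans _ _ (3 * D * (r + 1) + (p ^+ 2 + D * kappa) * (N + 1) + s * (N + 1))).
  by apply: lerD x3; apply: (le_trans (ler_normD _ _)); apply: lerD.
lra.
Qed.

Section Dense.
Variables (n k m j : nat) (tau : R).
Hypotheses (n1 : (1 < n)%N) (k0 : (0 < k <= n)%N) (m0 : (0 < m < 'C(n, k))%N) (tau0 : 0 <= tau).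
Let N := Nb n k.
Let M := (k * m)%N.
Let q := (2 ^ j.+1)%N.
Let p : R := m%:R / 'C(n, k)%:R.
Let D := avg_deg n k m.
Let nu := fixed_mean n k m.
Let kappa := pair_frac n k.
Let r := dev D tau.
Let s := dev nu tau.
Implicit Types (d : degseq n) (H : {set {set 'I_n}}).

Definition dense_err : R := s + D * kappa + 3 * p * (r + 1) + p ^+ 2.
Definition dense_bound : R := 16 * (2 * r + 1) * dense_err / D ^+ 2.

Let mE : (m <= 'C(n, k))%N. Proof. by case/andP: m0 => _ /ltnW. Qed.
Let E0 : (0 : R) < 'C(n, k)%:R. Proof. by rewrite ltr0n; case/andP: m0 => _; apply: leq_ltn_trans. Qed.
Let p0 : 0 <= p. Proof. by rewrite divr_ge0. Qed.
Let p1 : p <= 1. Proof. by rewrite ler_pdivrMr // mul1r ler_nat. Qed.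
Let D0 : 0 <= D. Proof. exact: avg_deg_ge0. Qed.
Let nu0 : 0 <= nu. Proof. exact: fixed_mean_ge0. Qed.
Let kap0 : 0 <= kappa. Proof. exact: pair_frac_ge0. Qed.

Lemma dev_ge0 (x t : R) : 0 <= t -> 0 <= dev x t.
Proof. by move=> t0; rewrite /dev mulr_ge0 // addr_ge0 // sqrtr_ge0. Qed.

Let r0 : 0 <= r. Proof. exact: dev_ge0. Qed.
Let s0 : 0 <= s. Proof. exact: dev_ge0. Qed.

Lemma avg_degE : avg_deg n k m = p * N%:R.
Proof.
have nR : (0 : R) < n%:R by rewrite ltr0n (ltn_trans _ n1).
have /(congr1 (fun i => i%:R : R)) := n_Nb k0; rewrite !natrM => h.
apply: (mulfI (lt0r_neq0 nR)).
have -> : n%:R * (p * N%:R) = p * (n%:R * (Nb n k)%:R) by rewrite mulrCA.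
rewrite h /avg_deg /p; field.
by rewrite !lt0r_neq0.
Qed.

Hypotheses (Dp : 0 < D) (rD : r + 1 <= D / 4) (Xsmall : 2 * (nu + s) <= D - r)
  (DN : 2 * (D + r + 1) <= N.+1%:R).

Let err0 : 0 <= dense_err.
Proof.
apply: addr_ge0 (sqr_ge0 _); apply: addr_ge0; first exact: addr_ge0 s0 (mulr_ge0 D0 kap0).
exact: mulr_ge0 (mulr_ge0 (ler0n _ 3) p0) (addr_ge0 r0 ler01).
Qed.

Let err_bound (a b X : R) : `|a - D| <= r -> `|b - D| <= r + 1 -> `|X - nu| <= s ->
  `|a * b - N.+1%:R * X| <= dense_err * N.+1%:R.
Proof.
move=> ha hb hX; rewrite -natr1; apply: codegree_err_le hX => //; first by rewrite p0 p1.
- exact: avg_degE.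
- rewrite r0 /=; move: rD (D0); rewrite -/r; move: (r) (D) => x y; lra.
Qed.

Lemma dense_switch_bound :
  switch_bound k m j (fun H : {set {set 'I_n}} => dense_bound ^+ q + (2 * N.+1%:R + 1) ^+ q * (~~ typical k m tau H)%:R).
Proof.
move=> d d' a c ac dd dN d'N _ _.
have ca : c != a by rewrite eq_sym.
have da : (d a = (d' a).+1)%N by have := dd a; rewrite eqxx (negbTE ac) addn1 addn0.
have dc : (d' c = (d c).+1)%N by have := dd c; rewrite eqxx (negbTE ca) addn1 addn0.
pose al : R := (d a)%:R; pose be : R := (d' c)%:R; pose M1 : R := N.+1%:R.
have al0 : 0 < al by rewrite ltr0n da.
have be0 : 0 < be by rewrite ltr0n dc.
have M1be : 1 <= M1 - be.
  by have := d'N c; rewrite -(ler_nat R) /M1 -natr1 -/be; lra.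
have M1al : 0 <= M1 - al <= M1.
  by have := dN a; rewrite -(ler_nat R) /M1 -natr1 -/al; lra.
have be1 : 0 <= be by apply: ltW.
(* [phi] inverts the weight on the side of d', so that the error there is just the indicator of the
   cut-off. The cut-off keeps [be - x] at least be / 2, which bounds the quotient on the side of d
   by [2 * M1] even for atypical hypergraphs; this is the source of the factor [2 * N.+1%:R + 1]. *)
pose phi (x : nat) : R := if (2 * x <= d' c)%N then ((be - x%:R) * (al * (M1 - be)))^-1 else 0.
have den x : (2 * x <= d' c)%N -> 0 < (be - x%:R) * (al * (M1 - be)) /\ be <= 2 * (be - x%:R).
  rewrite -(ler_nat R) natrM -/be => h; split; last lra.
  by rewrite !mulr_gt0 //; lra.
have sw := switch_Lr k0 m0 phi ac dd dN d'N; rewrite /= -/N -/al -/be -/M1 in sw.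
pose X H : R := (fixed_deg a c H)%:R.
exists (fun H => 1 - phi (fixed_deg a c H) * ((al - X H) * (be * (M1 - al)))),
       (fun H => (~~ (2 * fixed_deg a c H <= d' c)%N)%:R).
have pos H : degs n H = d -> 0 <= phi (fixed_deg a c H) * ((al - X H) * (be * (M1 - al))) <= 2 * M1.
  move=> dH; have Xa : X H <= al by rewrite ler_nat -dH fixed_deg_le.
  have X0 : 0 <= X H by [].
  have [m1 _] := andP M1al.
  have num0 : 0 <= (al - X H) * (be * (M1 - al)) by rewrite !mulr_ge0 // subr_ge0.
  rewrite /phi; case: ifP => [h|_]; last by rewrite mul0r lexx mulr_ge0 // (le_trans m1).
  have [dp bb] := den _ h; rewrite mulr_ge0 ?invr_ge0 ?(ltW dp) //= mulrC ler_pdivrMr //.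
  rewrite -/(X H) in dp bb *.
  have s1 : (al - X H) * (be * (M1 - al)) <= al * ((2 * (be - X H)) * M1).
    have m3 : M1 - al <= M1 by rewrite gerBl ltW.
    have x1 : al - X H <= al by rewrite gerBl.
    have x0 : 0 <= al - X H by rewrite subr_ge0.
    exact: ler_pM x0 (mulr_ge0 be1 m1) x1 (ler_pM be1 m1 bb m3).
  apply: (le_trans s1).
  have b0 : 0 <= al * ((be - X H) * M1) by rewrite !mulr_ge0 //; lra.
  have -> : 2 * M1 * ((be - X H) * (al * (M1 - be))) = 2 * (al * ((be - X H) * M1)) * (M1 - be) by ring.
  have -> : al * (2 * (be - X H) * M1) = 2 * (al * ((be - X H) * M1)) by ring.
  rewrite ler_peMr // mulr_ge0 //.
have z0 : 0 <= dense_bound by rewrite divr_ge0 ?sqr_ge0 // !mulr_ge0 // addr_ge0 // mulr_ge0.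
have typH H (v w : 'I_n) : typical k m tau H -> v != w ->
   [/\ `|(degs n H v)%:R - D| <= r, `|(degs n H w)%:R - D| <= r & `|(fixed_deg v w H)%:R - nu| <= s].
  move=> /andP[/forallP h1 /forallP h2] vw; split; rewrite ?h1 //.
  by have /forallP /(_ w) := h2 v; rewrite vw.
have M10 : 0 <= M1 by [].
split.
- transitivity (Lr k m d (fun H => phi (fixed_deg a c H) * ((al - X H) * (be * (M1 - al))))).
    by apply: eq_Lr => H _ _; ring.
  rewrite /X sw; apply: eq_Lr => H _ _; rewrite /phi; case: ifP => [h|_] /=; last by rewrite mul0r subrr.
  by have [dp _] := den _ h; rewrite mulVf ?lt0r_neq0 // subr0.
- by apply: Lr_ge0 => H _ dH; have /andP[h _] := pos H dH; rewrite opprB addrCA subrr addr0.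
- move=> H _ dH; have /andP[h1 h2] := pos H dH.
  case: (boolP (typical k m tau H)) => [ty|_] /=; last first.
    rewrite mulr1; apply: (@le_trans _ _ ((2 * M1 + 1) ^+ q)); last by rewrite lerDr exprn_ge0.
    rewrite -even_pow_norm lerXn2r ?nnegrE ?addr_ge0 ?mulr_ge0 //.
    by rewrite ler_norml; apply/andP; split; lra.
  rewrite mulr0 addr0 -even_pow_norm lerXn2r ?nnegrE //.
  have [ta tc tX] := typH H a c ty ac; rewrite dH -/al -/(X H) in ta tc tX.
  have be_c : be = (d c)%:R + 1 by rewrite /be dc natr1.
  have tb : `|be - D| <= r + 1.
    by move: tc; rewrite be_c !ler_norml => /andP[u1 u2]; apply/andP; split; lra.
  have X0 : 0 <= X H by [].
  have Xb : 2 * X H <= be.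
    by apply: le_trans (twice_codegree_le Xsmall tc tX) _; rewrite be_c lerDl.
  rewrite /phi ifT; last by rewrite -(ler_nat R) natrM.
  rewrite mulrC; apply: ratio_gap_le => //.
  exact: err_bound.
move=> H _ dH; case: (boolP (typical k m tau H)) => [ty|_] /=; last first.
  rewrite mulr1; apply: (@le_trans _ _ 1); first by rewrite exprn_ile1 // lern1 leq_b1.
  apply: (@le_trans _ _ ((2 * M1 + 1) ^+ q)); last by rewrite lerDr exprn_ge0.
  by rewrite exprn_ege1 // lerDr mulr_ge0.
have [ta tc tX] := typH H a c ty ac; rewrite dH -/be -/(X H) in ta tc tX.
suff -> : (2 * fixed_deg a c H <= d' c)%N.
  by rewrite /= expr0n expn_eq0 /= mulr0 addr0 exprn_ge0.
rewrite -(ler_nat R) natrM -/(X H) -/be.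
exact: twice_codegree_le Xsmall tc tX.
Qed.

End Dense.

(** * Numerical bounds *)

Section Numerics.
Variables y n k m p kappa nu N Delta : R.
Hypotheses (y1000 : 1000 <= y) (nE : n = y ^+ 144) (k3 : 3 <= k) (ky : k <= y ^+ 16)
  (NE : n ^+ 2 / 8 <= N).
Let z := y^-1.

Let y0 : 0 < y. Proof. by apply: lt_le_trans y1000; rewrite ltr0n. Qed.
Let y_ge1 : 1 <= y. Proof. by apply: le_trans y1000; rewrite ler1n. Qed.
Let z0 : 0 < z. Proof. by rewrite invr_gt0. Qed.
Let z_le : 1000 * z <= 1. Proof. by rewrite ler_pdivrMr // mul1r. Qed.
Let z_le1 : z <= 1. Proof. by rewrite invf_le1. Qed.
Let k0 : 0 < k. Proof. by apply: lt_le_trans k3; rewrite ltr0n. Qed.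
Let yX a : 0 < y ^+ a. Proof. exact: exprn_gt0. Qed.
Let zX a : 0 < z ^+ a. Proof. exact: exprn_gt0. Qed.
Let n0 : 0 < n. Proof. by rewrite nE. Qed.

Let yzX a b : y ^+ (a + b) * z ^+ b = y ^+ a.
Proof. by rewrite exprD -mulrA -exprMn divff ?lt0r_neq0 // expr1n mulr1. Qed.
Let zyX a b : z ^+ (a + b) * y ^+ b = z ^+ a.
Proof. by rewrite exprD -mulrA -exprMn mulVf ?lt0r_neq0 // expr1n mulr1. Qed.
Let zXS a : 1000 * z ^+ a.+1 <= z ^+ a.
Proof. by rewrite exprS mulrA ler_piMl // ltW. Qed.
Let N0 : 0 < N.
Proof. by apply: lt_le_trans NE; rewrite divr_gt0 // exprn_gt0. Qed.
Let NinvE : N^-1 <= z ^+ 287.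
Proof.
apply: (@le_trans _ _ (n ^+ 2 / 8)^-1); first by rewrite lef_pV2 ?posrE // divr_gt0 ?exprn_gt0.
rewrite invf_div -(@ler_pM2r _ (n ^+ 2)) ?exprn_gt0 // mulfVK ?lt0r_neq0 ?exprn_gt0 //.
have -> : z ^+ 287 * n ^+ 2 = y.
  rewrite nE -exprM -[(144 * 2)%N]/(1 + 287)%N mulrC yzX //.
by apply: le_trans y1000; rewrite ler_nat.
Qed.

Section Sparse.
Let tau := y ^+ 18.
Let D := k * m / n.
Hypotheses (my : y ^+ 72 <= m) (Dy : D <= y ^+ 104) (Delta0 : 0 <= Delta)
  (DeltaE : Delta <= 6 * (D + tau)).
Let S := Num.sqrt (k * m).

Let m0 : 0 < m. Proof. exact: lt_le_trans my. Qed.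
Let S0 : 0 < S. Proof. by rewrite sqrtr_gt0 mulr_gt0. Qed.
Let S2 : S ^+ 2 = k * m. Proof. by rewrite sqr_sqrtr // ltW ?mulr_gt0. Qed.
Let S1 : 1 <= S.
Proof.
rewrite -(@ler_pXn2r _ 2) ?nnegrE ?(ltW S0) // expr1n S2.
have k1 : 1 <= k by apply: le_trans k3; rewrite ler1n.
have m1 : 1 <= m by apply: le_trans my; rewrite exprn_ege1.
by rewrite -[1]mulr1 ler_pM.
Qed.
Let Sy : S <= y ^+ 124.
Proof.
rewrite -(@ler_pXn2r _ 2) ?nnegrE ?(ltW S0) ?(ltW (yX _)) // S2 -exprM.
have -> : k * m = n * D by rewrite /D [RHS]mulrC divfK ?lt0r_neq0.
by rewrite -[(124 * 2)%N]/(144 + 104)%N exprD -nE ler_pM2l.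
Qed.
(** The exponent count is tight: 16 from k and 124 from sqrt(km), against 144 from n, leave exactly
    the fourth power of z. *)
Let kD : k * D <= z ^+ 4 * S.
Proof.
have -> : k * D = k * S / n * S by rewrite /D -S2; field; rewrite lt0r_neq0.
rewrite ler_pM2r // ler_pdivrMr // nE -[144%N]/(140 + 4)%N [leRHS]mulrC yzX.
rewrite -[140%N]/(16 + 124)%N exprD; exact: ler_pM (ltW k0) (ltW S0) ky Sy.
Qed.
Let ktau : k * tau <= z ^+ 4 * S.
Proof.
have kt0 : 0 <= k * tau := mulr_ge0 (ltW k0) (ltW (yX 18)).
have zS0 : 0 <= z ^+ 4 * S := mulr_ge0 (ltW (zX 4)) (ltW S0).
rewrite -(@ler_pXn2r _ 2) //.
have -> : (k * tau) ^+ 2 = k * (k * y ^+ 36) by rewrite exprMn /tau -(exprM y) mulrA -expr2.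
have -> : (z ^+ 4 * S) ^+ 2 = k * (z ^+ 8 * m) by rewrite (exprMn 2 (z ^+ 4) S) S2 -(exprM z) mulrCA.
rewrite ler_pM2l //.
apply: (@le_trans _ _ (y ^+ 52)).
  by rewrite -[52%N]/(16 + 36)%N exprD ler_pM2r.
apply: (@le_trans _ _ (z ^+ 8 * y ^+ 72)); last by rewrite ler_pM2l.
by rewrite mulrC -[72%N]/(64 + 8)%N yzX ler_weXn2l.
Qed.
Let kDelta : k * Delta <= 12 * z ^+ 4 * S.
Proof.
have h : k * Delta <= k * (6 * (D + tau)) by rewrite ler_pM2l.
apply: (le_trans h); rewrite mulrCA mulrDr; move: kD ktau; lra.
Qed.
Let Delta_le : Delta <= k * Delta.
Proof. by rewrite ler_peMl //; apply: le_trans k3; rewrite ler1n. Qed.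
Let z4 : 1000 * z ^+ 4 <= 1.
Proof. by apply: le_trans (zXS 3) _; rewrite exprn_ile1 // ltW. Qed.

Lemma sparse_numeric_hyp : 2 * (2 * (k * Delta) + 2 * Delta ^+ 2) <= k * m.
Proof.
have kD0 : 0 <= k * Delta by rewrite mulr_ge0 // ltW.
have l : k * Delta <= (12 / 1000) * S.
  by apply: le_trans kDelta _; rewrite ler_pM2r //; move: z4; lra.
have SS : S <= S ^+ 2 by rewrite expr2 ler_peMl // ltW.
have l2 : Delta ^+ 2 <= (12 / 1000) ^+ 2 * S ^+ 2.
  have d := le_trans Delta_le l.
  by rewrite -exprMn; apply: lerXn2r => //; rewrite nnegrE (le_trans Delta0).
by rewrite -S2; move: l l2 SS; lra.
Qed.

Lemma sparse_numeric :
  (Delta / (N + 1) + Delta * (2 * k / (k * m) + 4 * k ^+ 4 * Delta ^+ 2 / ((k * m) ^+ 2 * (k - 1)))) * S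
  <= z ^+ 3.
Proof.
have kD0 : 0 <= k * Delta by rewrite mulr_ge0 // ltW.
(* In terms of w the two switching terms are 2 w and at most 8 w^3, so the bound [12 * z ^+ 4] for w
   settles both; the term with N is far smaller because N is of order at least n^2. *)
pose w := k * Delta / S.
have w0 : 0 <= w by rewrite divr_ge0 // ltW.
have wz : w <= 12 * z ^+ 4 by rewrite ler_pdivrMr.
have wE : k * Delta = w * S by rewrite divfK ?lt0r_neq0.
have k1 : 0 < k - 1 by rewrite subr_gt0; apply: lt_le_trans k3; rewrite ltr1n.
have t1 : Delta / (N + 1) * S <= z ^+ 4.
  apply: (@le_trans _ _ (12 * z ^+ 4 * S / N * S)).
    rewrite ler_pM2r // ler_pM //; first by rewrite invr_ge0 addr_ge0 // ltW.
      exact: le_trans Delta_le kDelta.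
    by rewrite lef_pV2 ?posrE ?lerDl // addr_gt0.
  have -> : 12 * z ^+ 4 * S / N * S = z ^+ 4 * (12 * (S ^+ 2 / N)) by ring.
  rewrite ler_piMr ?(ltW (zX _)) //.
  have : S ^+ 2 / N <= z.
    apply: (@le_trans _ _ (y ^+ 248 * z ^+ 287)).
      apply: ler_pM => //; rewrite ?invr_ge0 ?sqr_ge0 ?(ltW N0) //.
      by rewrite -[248%N]/(124 * 2)%N exprM lerXn2r ?nnegrE ?(ltW S0) ?(ltW (yX _)).
    rewrite mulrC -[287%N]/(39 + 248)%N zyX -[leRHS]expr1 ler_wiXn2l // ltW //.
  by move: z_le; lra.
have t2 : Delta * (2 * k / (k * m)) * S = 2 * w.
  rewrite /w -S2; field; rewrite lt0r_neq0 //.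
have t3 : Delta * (4 * k ^+ 4 * Delta ^+ 2 / ((k * m) ^+ 2 * (k - 1))) * S <= 8 * w ^+ 3.
  have -> : Delta * (4 * k ^+ 4 * Delta ^+ 2 / ((k * m) ^+ 2 * (k - 1))) * S = 4 * w ^+ 3 * (k / (k - 1)).
    rewrite /w -S2; field; rewrite !lt0r_neq0 //.
  have -> : 8 * w ^+ 3 = 4 * w ^+ 3 * 2 by ring.
  apply: ler_wpM2l; first by rewrite mulr_ge0 // exprn_ge0.
  by rewrite ler_pdivrMr //; move: k3; lra.
have w1 : 8 * w ^+ 3 <= w.
  rewrite exprS mulrCA ler_piMr //.
  have : w <= 12 / 1000 by apply: le_trans wz _; move: z4; lra.
  move=> h; have : w ^+ 2 <= (12/1000) ^+ 2 by apply: lerXn2r => //; rewrite nnegrE (le_trans w0).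
  lra.
rewrite mulrDl mulrDr mulrDl t2.
have := zXS 3; move: t1 t3 w1 wz; lra.
Qed.

End Sparse.

Section Dense.
Let tau := y ^+ 18.
(** [sigma] is the square root of the average degree; since km = n D, the factor sqrt(km) becomes
    y^72 sigma. *)
Variables (sigma : R).
Let D := sigma ^+ 2.
Hypotheses (sig : y ^+ 52 <= sigma) (p0 : 0 <= p) (p1 : p <= 1 / 30) (DE : D = p * N)
  (kapE : kappa = (k - 1) / (n - 1)) (nuE : nu = D * (kappa + p * (1 - kappa))).
Let dv x := 4 * (Num.sqrt (x * tau) + tau).
Let r := dv D.
Let s := dv nu.

Let sg0 : 0 < sigma. Proof. exact: lt_le_trans sig. Qed.
Let Dp : 0 < D. Proof. exact: exprn_gt0. Qed.
Let sqtau : Num.sqrt tau = y ^+ 9.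
Proof. by rewrite /tau -[18%N]/(9 * 2)%N exprM sqrtr_sqr ger0_norm // ltW. Qed.
Let rE : r = 4 * (sigma * y ^+ 9 + tau).
Proof. by rewrite /r /dv sqrtrM ?sqr_ge0 // sqtau sqrtr_sqr ger0_norm // ltW. Qed.
Let tau_le : tau <= sigma * y ^+ 9.
Proof.
rewrite /tau -[18%N]/(9 + 9)%N exprD ler_pM2r //; apply: le_trans sig.
by rewrite ler_weXn2l.
Qed.
Let r_le : r <= 8 * (sigma * y ^+ 9). Proof. by rewrite rE; move: tau_le; lra. Qed.
Let r0 : 0 <= r. Proof.
rewrite rE; exact: mulr_ge0 (ler0n _ 4) (addr_ge0 (mulr_ge0 (ltW sg0) (ltW (yX 9))) (ltW (yX 18))).
Qed.
Let sy1 : 1 <= sigma * y ^+ 9.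
Proof.
have h : 1 <= sigma by apply: le_trans sig; rewrite exprn_ege1.
by rewrite -[1]mulr1 ler_pM // exprn_ege1.
Qed.
Let sigD : sigma <= D * z ^+ 52.
Proof.
rewrite /D expr2 -mulrA ler_peMr ?(ltW sg0) //.
by rewrite -(expr0 y) -(yzX 0 52) ler_pM2r.
Qed.
Let DX : y ^+ 104 <= D.
Proof. by rewrite /D -[104%N]/(52 * 2)%N exprM lerXn2r ?nnegrE ?(ltW sg0) ?(ltW (yX _)). Qed.
Let z52 : sigma * y ^+ 9 <= D * z ^+ 43.
Proof. by rewrite -(zyX 43 9) [leRHS]mulrA (ler_pM2r (yX 9)). Qed.
Let zsmall a : 1000 * z ^+ a.+1 <= 1.
Proof. by apply: le_trans (zXS a) _; rewrite exprn_ile1 // ltW. Qed.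
Let sy_le : 1000 * (sigma * y ^+ 9) <= D.
Proof.
apply: (@le_trans _ _ (1000 * (D * z ^+ 43))); first by rewrite ler_pM2l.
by rewrite mulrCA ler_piMr // ltW.
Qed.

Lemma dense_numeric_r : r + 1 <= D / 4.
Proof. by move: r_le sy_le sy1; lra. Qed.

Let kap0 : 0 <= kappa.
Proof.
have n1 : 1 <= n by rewrite nE exprn_ege1.
by rewrite kapE divr_ge0 ?subr_ge0 //; apply: le_trans k3; rewrite ler1n.
Qed.
Let kap_le : kappa <= 2 * z ^+ 128.
Proof.
have n2 : 2 <= n.
  by rewrite nE; apply: (@le_trans _ _ y); [apply: le_trans y1000; rewrite ler_nat|rewrite ler_eXnr].
rewrite kapE ler_pdivrMr; last by rewrite subr_gt0; apply: lt_le_trans n2; rewrite ltr1n.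
have e : z ^+ 128 * n = y ^+ 16 by rewrite nE mulrC -(yzX 16 128).
have h : z ^+ 128 * 2 <= z ^+ 128 * n by rewrite ler_pM2l.
by move: ky; rewrite -e; lra.
Qed.
Let pDE : p = D / N. Proof. by rewrite DE mulfK ?lt0r_neq0. Qed.
Let p_le : p <= D * z ^+ 287. Proof. by rewrite pDE ler_pM2l. Qed.
Let kap1 : kappa <= 1.
Proof. by apply: le_trans kap_le _; have := zsmall 127; lra. Qed.
Let nu_le : nu <= D * (kappa + p).
Proof. by rewrite nuE ler_pM2l // lerD2l ler_piMr // gerBl. Qed.
Let nu0 : 0 <= nu.
Proof. by rewrite nuE mulr_ge0 ?(ltW Dp) // addr_ge0 // mulr_ge0 // subr_ge0. Qed.
Let nuD : nu <= D.
Proof. by apply: le_trans nu_le _; rewrite ler_piMr ?(ltW Dp) //; have := zsmall 127; move: kap_le p1; lra. Qed.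
Let s_le_r : s <= r.
Proof.
have h : Num.sqrt (nu * tau) <= Num.sqrt (D * tau) by rewrite ler_wsqrtr // (ler_pM2r (yX 18)).
by rewrite /s /r /dv ler_wpM2l // lerD2r.
Qed.

Lemma dense_numeric_nu : 2 * (nu + s) <= D - r.
Proof.
have : nu <= D * (1 / 20).
  by apply: le_trans nu_le _; rewrite ler_pM2l //; have := zsmall 127; move: kap_le p1; lra.
by move: s_le_r r_le sy_le Dp; lra.
Qed.

Lemma dense_numeric_N : 2 * (D + r + 1) <= N + 1.
Proof.
have : D <= 1 / 30 * N by rewrite DE ler_pM2r.
by move: dense_numeric_r N0; lra.
Qed.

Let nu2 : nu <= (D * z ^+ 115) ^+ 2.
Proof.
have -> : (D * z ^+ 115) ^+ 2 = D * (D * z ^+ 230).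
  by rewrite (exprMn 2 D (z ^+ 115)) -(exprM z) (expr2 D) mulrA.
apply: (le_trans nu_le); rewrite (ler_pM2l Dp).
have a : z ^+ 126 <= D * z ^+ 230 by rewrite -(zyX 126 104) mulrC ler_pM2r.
have b : D * z ^+ 287 <= D * z ^+ 231 by rewrite ler_pM2l // ler_wiXn2l // ltW.
have c : 1000 * (D * z ^+ 231) <= D * z ^+ 230 by rewrite mulrCA ler_pM2l.
have e := zXS 127; have f := zXS 126; have g := zX 126.
by move: p_le kap_le a b c e f g; lra.
Qed.
Let s_le : s <= 4 * (D * z ^+ 106 + D * z ^+ 86).
Proof.
rewrite /s /dv ler_wpM2l // lerD //.
  rewrite sqrtrM // sqtau -(zyX 106 9) [leRHS]mulrA (ler_pM2r (yX 9)) -(@ger0_norm _ (D * z ^+ (106 + 9))).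
    by rewrite -sqrtr_sqr ler_wsqrtr.
  by rewrite mulr_ge0 ?ltW.
by rewrite /tau -(yzX 18 86) -[(18 + 86)%N]/104%N ler_pM2r.
Qed.
Let prE : 3 * p * (r + 1) <= 27 * (D * z ^+ 134).
Proof.
(* From p <= 1 one has p^2 <= p <= D z^287, so p is at most sigma z^143; this factor sigma pairs
   with the one in r to give D. *)
have h : p <= sigma * z ^+ 143.
  have sz0 : 0 <= sigma * z ^+ 143 := mulr_ge0 (ltW sg0) (ltW (zX 143)).
  have e : (sigma * z ^+ 143) ^+ 2 = D * z ^+ 286 by rewrite (exprMn 2 sigma (z ^+ 143)) -(exprM z).
  have := @ler_pXn2r R 2 isT p (sigma * z ^+ 143); rewrite !nnegrE => <- //; rewrite e.
  apply: (@le_trans _ _ (D * z ^+ 287)); last by rewrite ler_pM2l // ler_wiXn2l // ltW.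
  apply: le_trans p_le; rewrite expr2 ler_piMr //; apply: le_trans p1 _; lra.
have h2 : r + 1 <= 9 * (sigma * y ^+ 9) by move: r_le sy1; lra.
have -> :
    27 * (D * z ^+ 134) = 3 * (sigma * z ^+ 143) * (9 * (sigma * y ^+ 9)).
  by rewrite -(zyX 134 9) /D; ring.
by apply: ler_pM h2; rewrite ?mulr_ge0 ?addr_ge0 // ler_pM2l.
Qed.

(** The deviation s dominates the error, through tau <= D z^86. All powers of sigma cancel, leaving
    1360 = 16 * 17 * 5 times z^86 y^81 = z^5, and 1360 is absorbed by two powers of z. *)
Lemma dense_numeric : 16 * (2 * r + 1) * (s + D * kappa + 3 * p * (r + 1) + p ^+ 2) / D ^+ 2 *
   (y ^+ 72 * sigma) <= z ^+ 3.
Proof.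
have p2 : p ^+ 2 <= D * z ^+ 287.
  by apply: le_trans p_le; rewrite expr2 ler_piMr //; apply: le_trans p1 _; lra.
have m1 a b : (a <= b)%N -> D * z ^+ b <= D * z ^+ a.
  by move=> ab; rewrite ler_pM2l // ler_wiXn2l // ltW.
have m2 a : 1000 * (D * z ^+ a.+1) <= D * z ^+ a by rewrite mulrCA ler_pM2l.
have dk : D * kappa <= 2 * (D * z ^+ 128) by rewrite mulrCA ler_pM2l.
have err : s + D * kappa + 3 * p * (r + 1) + p ^+ 2 <= 5 * (D * z ^+ 86).
  have := m1 87%N 106%N isT; have := m1 87%N 128%N isT; have := m1 87%N 134%N isT.
  have := m1 87%N 287%N isT; have := m2 86%N.
  have := mulr_gt0 Dp (zX 86); move: s_le dk prE p2; lra.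
have r1 : 2 * r + 1 <= 17 * (sigma * y ^+ 9) by move: r_le sy1; lra.
have r10 : 0 <= 2 * r + 1 by rewrite addr_ge0 // mulr_ge0.
have c0 : 0 <= 16 * (y ^+ 72 * sigma) / D ^+ 2.
  exact: divr_ge0 (mulr_ge0 (ler0n _ 16) (mulr_ge0 (ltW (yX 72)) (ltW sg0))) (sqr_ge0 D).
have -> : 16 * (2 * r + 1) * (s + D * kappa + 3 * p * (r + 1) + p ^+ 2) / D ^+ 2 * (y ^+ 72 * sigma) =
   16 * (y ^+ 72 * sigma) / D ^+ 2 * ((2 * r + 1) * (s + D * kappa + 3 * p * (r + 1) + p ^+ 2)) by ring.
apply: (@le_trans _ _ (16 * (y ^+ 72 * sigma) / D ^+ 2 * (17 * (sigma * y ^+ 9) * (5 * (D * z ^+ 86))))).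
  apply: ler_wpM2l => //; apply: (@le_trans _ _ ((2 * r + 1) * (5 * (D * z ^+ 86)))).
    exact: ler_wpM2l.
  by rewrite ler_wpM2r // !mulr_ge0 // ltW.
have -> : 16 * (y ^+ 72 * sigma) / D ^+ 2 * (17 * (sigma * y ^+ 9) * (5 * (D * z ^+ 86))) =
   1360 * (z ^+ 86 * y ^+ (9 + 72)).
  by rewrite exprD /D; field; rewrite lt0r_neq0.
rewrite (zyX 5 81).
have := zXS 4; have := zXS 3; have := zX 5; have := zX 4; lra.
Qed.

End Dense.
End Numerics.

Lemma leq_bin_left (n a b : nat) : (a <= b)%N -> (b.*2 <= n)%N -> ('C(n, a) <= 'C(n, b))%N.
Proof.
elim: b => [|b IH]; first by rewrite leqn0 => /eqP ->.
rewrite leq_eqVlt => /orP[/eqP -> //|]; rewrite ltnS doubleS => ab bn.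
apply: leq_trans (IH ab _) _; first by lia.
rewrite -(leq_pmul2l (ltn0Sn b)) mul_bin_left leq_mul2r; apply/orP; right; lia.
Qed.

(** [k.-1] lies between 2 and half of [n.-1], where binomial coefficients increase, so it suffices
    to compare with 'C(n.-1, 2). *)
Lemma Nb_ge_square (n k : nat) : (2 < k)%N -> (4 * k <= n)%N -> n%:R ^+ 2 / 8 <= (Nb n k)%:R :> R.
Proof.
move=> k3 kn.
have h : ('C(n.-1, 2) <= Nb n k)%N by apply: leq_bin_left; lia.
apply: le_trans (_ : 'C(n.-1, 2)%:R <= _); last by rewrite ler_nat.
rewrite ler_pdivrMr // -natrX -natrM ler_nat.
have := bin2 n.-1; have := odd_double_half (n.-1 * n.-2); rewrite oddM.
case: n kn {h} => [|[|n]] kn //=; first lia.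
rewrite andNb add0n => <- ->; rewrite -muln2; nia.
Qed.

(** * The two regimes combined *)

Lemma switch_bound_le n k m j (b b' : {set {set 'I_n}} -> R) :
  (forall H, H \in khg n k m -> b H <= b' H) -> switch_bound k m j b -> switch_bound k m j b'.
Proof.
move=> bb sb d d' a c ac dd dN d'N sd sd'; have [v [v' [h1 h2 h3 h4]]] := sb _ _ _ _ ac dd dN d'N sd sd'.
exists v, v'; split=> // H HK dH; apply: le_trans (bb _ HK); first exact: h3.
exact: h4.
Qed.

Section Assemble.
Variables (n k m j : nat) (y eta : R).
Let q := (2 ^ j.+1)%N.
Let tau := y ^+ 18.
Let Wt : R := (2 * (Nb n k).+1%:R + 1) ^+ q.
Let p : R := m%:R / 'C(n, k)%:R.
Let D := avg_deg n k m.
Let S : R := Num.sqrt (k * m)%:R.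
Hypotheses (y1000 : 1000 <= y) (nE : n%:R = y ^+ 144) (k3 : (2 < k)%N) (ky : k%:R <= y ^+ 16)
  (my : y ^+ 72 <= m%:R) (pk : p <= 1 / 30).

Let y0 : 0 < y. Proof. by apply: lt_le_trans y1000; rewrite ltr0n. Qed.
Let y1 : 1 <= y. Proof. by apply: le_trans y1000; rewrite ler1n. Qed.
Let tau0 : 0 <= tau. Proof. by rewrite exprn_ge0 // ltW. Qed.
Let kn4 : (4 * k <= n)%N.
Proof.
rewrite -(ler_nat R) natrM nE; apply: (@le_trans _ _ (y * y ^+ 16)).
  apply: ler_pM => //; apply: le_trans y1000; by rewrite ler_nat.
by rewrite -exprS ler_weXn2l.
Qed.
Let kn : (0 < k <= n)%N. Proof. by rewrite (ltn_trans _ k3) //= (leq_trans _ kn4) // leq_pmull. Qed.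
Let n1 : (1 < n)%N. Proof. by case/andP: kn => _; apply: leq_trans; apply: ltnW. Qed.
Let E0 : (0 : R) < 'C(n, k)%:R. Proof. by rewrite ltr0n bin_gt0; case/andP: kn. Qed.
Let m0 : (0 < m < 'C(n, k))%N.
Proof.
rewrite -(ltr_nat R) (lt_le_trans _ my) ?exprn_gt0 //= -(ltr_nat R).
have := pk; rewrite ler_pdivrMr // => h; apply: le_lt_trans h _; rewrite gtr_pMl //; lra.
Qed.
Let p0 : 0 <= p. Proof. by rewrite divr_ge0. Qed.
Let NE : n%:R ^+ 2 / 8 <= (Nb n k)%:R :> R. Proof. exact: Nb_ge_square. Qed.
Let k1E : (k.-1%:R : R) = k%:R - 1. Proof. by rewrite -subn1 natrB //; case/andP: kn. Qed.
Let n1E : (n.-1%:R : R) = n%:R - 1. Proof. by rewrite -subn1 natrB // ltnW. Qed.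
Let k3R : 3 <= k%:R :> R. Proof. by rewrite ler_nat. Qed.
Let DN : D = p * (Nb n k)%:R. Proof. exact: avg_degE. Qed.
Let D0 : 0 < D.
Proof.
case/andP: kn => kp _; case/andP: m0 => mp _.
by rewrite /D /avg_deg divr_gt0 ?mulr_gt0 ?ltr0n // ltnW.
Qed.
Let Wt1 : 1 <= Wt. Proof. by rewrite exprn_ege1 // lerDr mulr_ge0. Qed.

(** Both regimes are brought to one shape, a constant B with B sqrt(km) small plus a weight on
    atypical hypergraphs. In the sparse regime the exceptional event is a large degree, which
    atypicality covers. *)
Lemma switch_bound_cases : exists2 B : R, 0 <= B /\ B * S <= y^-1 ^+ 3 &
  switch_bound k m j (fun H : {set {set 'I_n}} => B ^+ q + Wt * (~~ typical k m tau H)%:R).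
Proof.
have [Dy|Dy] := lerP D (y ^+ 104).
  have u0 : 0 <= 6 * (D + tau) by rewrite mulr_ge0 // addr_ge0 // ltW.
  (* By sqrt(D tau) <= (D + tau) / 2, a typical degree is at most D + [dev D tau] <= 3 D + 6 tau,
     hence below this cut-off. *)
  pose Delta := Num.trunc (6 * (D + tau)).
  have DeltaE : Delta%:R <= 6 * (D + tau) by rewrite Num.Theory.truncn_le.
  have hyp : (2 * (2 * (k * Delta) + 2 * Delta ^ 2) <= k * m)%N.
    have := sparse_numeric_hyp y1000 nE k3R ky my Dy (ler0n _ _) DeltaE; rewrite expr2 => h.
    by rewrite -(ler_nat R) !(natrM, natrD).
  exists (sparse_bound n k m Delta); first split.
  - have s0 : 0 <= 4 * k%:R ^+ 4 * Delta%:R ^+ 2 :> R.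
      by rewrite mulr_ge0 ?sqr_ge0 // mulr_ge0 // exprn_ge0.
    have s1 : 0 <= (k * m)%:R ^+ 2 * k.-1%:R :> R by rewrite mulr_ge0 ?sqr_ge0.
    have s2 : 0 <= 2 * k%:R / (k * m)%:R :> R by rewrite divr_ge0 ?mulr_ge0.
    exact: addr_ge0 (divr_ge0 _ _) (mulr_ge0 _ (addr_ge0 s2 (divr_ge0 s0 s1))).
  - have := sparse_numeric y1000 nE k3R ky NE my Dy (ler0n _ _) DeltaE.
    by rewrite -k1E -[k%:R * m%:R]natrM natr1.
  apply: switch_bound_le (sparse_switch_bound j kn m0 k3 hyp) => H HK.
  rewrite lerD2l; apply: (@le_trans _ _ (~~ typical k m tau H)%:R); last by rewrite ler_peMl.
  rewrite ler_nat; case: (boolP (typical k m tau H)) => [ty|_]; last exact: leq_b1.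
  rewrite leqn0 eqb0 negbK; apply/forallP => v.
  case/andP: ty => /forallP /(_ v); rewrite ler_norml => /andP[_ h] _.
  rewrite /Delta Num.Theory.truncn_ge_nat //.
  have am : Num.sqrt (D * tau) <= (D + tau) / 2.
    have pp : 0 <= (D + tau) / 2 by rewrite divr_ge0 // addr_ge0 // ltW.
    rewrite -[leRHS]ger0_norm // -sqrtr_sqr ler_wsqrtr //.
    have := sqr_ge0 (D - tau); lra.
  by move: h am (ltW D0) tau0; rewrite /dev -/D; lra.
pose sg := Num.sqrt D.
have sg2 : sg ^+ 2 = D by rewrite sqr_sqrtr // ltW.
have sy : y ^+ 52 <= sg.
  have e : y ^+ 104 = (y ^+ 52) ^+ 2 by rewrite -exprM.
  have sg0 : 0 <= sg := sqrtr_ge0 D.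
  have y52 : 0 <= y ^+ 52 by rewrite exprn_ge0 // ltW.
  have := @ler_pXn2r R 2 isT (y ^+ 52) sg; rewrite !nnegrE -e sg2 => <- //.
  exact: ltW.
have kE : pair_frac n k = (k%:R - 1) / (n%:R - 1) by rewrite -k1E -n1E.
have nuE : fixed_mean n k m = sg ^+ 2 * (pair_frac n k + p * (1 - pair_frac n k)) by rewrite sg2.
have DN2 : sg ^+ 2 = p * (Nb n k)%:R by rewrite sg2.
have rr := dense_numeric_r y1000 sy; rewrite !sg2 in rr.
have hnu := dense_numeric_nu y1000 nE k3R ky sy p0 pk kE nuE; rewrite !sg2 in hnu.
have hN := dense_numeric_N y1000 nE NE sy pk DN2; rewrite !sg2 natr1 in hN.
have hB := dense_numeric y1000 nE k3R ky NE sy p0 pk DN2 kE nuE; rewrite !sg2 in hB.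
exists (dense_bound n k m tau); last exact: dense_switch_bound.
split; last first.
  have -> : S = y ^+ 72 * sg; last exact: hB.
  rewrite /S natrM; have -> : k%:R * m%:R = n%:R * D :> R.
    by rewrite /D /avg_deg [RHS]mulrC divfK // pnatr_eq0 -lt0n ltnW.
  rewrite sqrtrM ?nE ?exprn_ge0 ?(ltW y0) // -[144%N]/(72 * 2)%N exprM sqrtr_sqr ger0_norm //.
  by rewrite exprn_ge0 // ltW.
have r0 x : 0 <= dev x tau by apply: dev_ge0.
rewrite /dense_bound /dense_err divr_ge0 ?sqr_ge0 // mulr_ge0 //.
  by rewrite mulr_ge0 // addr_ge0 // mulr_ge0.
apply: addr_ge0 (sqr_ge0 _); apply: addr_ge0.
  exact: addr_ge0 (r0 _) (mulr_ge0 (ltW D0) (pair_frac_ge0 _ _)).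
exact: mulr_ge0 (mulr_ge0 (ler0n _ 3) p0) (addr_ge0 (r0 _) ler01).
Qed.

Hypotheses (atyp : #|[set H in khg n k m | ~~ typical k m tau H]|%:R <= eta * #|khg n k m|%:R)
  (eta_small : (k * m)%:R ^+ (2 ^ j) * (Wt * eta) <= (y^-1 ^+ 3) ^+ q).

Lemma deviation_small (C : R) : 0 < C ->
  (forall b : {set {set 'I_n}} -> R, (forall H, 0 <= b H) -> switch_bound k m j b ->
    deviation n k m j <= C * (k * m)%:R ^+ (2 ^ j) * ((\sum_(H in khg n k m) b H) / #|khg n k m|%:R)) ->
  deviation n k m j <= C * (2 * (y^-1 ^+ 3) ^+ q).
Proof.
move=> C0 dev_le; have [B [B0 BS] sb] := switch_bound_cases.
have h0 (H : {set {set 'I_n}}) : 0 <= B ^+ q + Wt * (~~ typical k m tau H)%:R.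
  by rewrite addr_ge0 ?exprn_ge0 // mulr_ge0 // (le_trans _ Wt1).
apply: (le_trans (dev_le _ h0 sb)); rewrite -mulrA ler_wpM2l ?(ltW C0) //.
have K0 : (0 : R) < #|khg n k m|%:R by rewrite ltr0n; apply: card_khg_gt0.
have M0 : 0 <= (k * m)%:R ^+ (2 ^ j) :> R by rewrite exprn_ge0.
have Sq : (k * m)%:R ^+ (2 ^ j) = S ^+ q.
  by rewrite /q expnS exprM sqr_sqrtr.
apply: (@le_trans _ _ ((k * m)%:R ^+ (2 ^ j) * (B ^+ q + Wt * eta))).
  rewrite ler_wpM2l // ler_pdivrMr // big_split /= sumr_const -mulr_sumr mulrDl -[B ^+ q *+ _]mulr_natr.
  rewrite lerD2l -mulrA ler_wpM2l ?(le_trans _ Wt1) //.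
  apply: le_trans atyp; rewrite -sum1dep_card natr_sum big_mkcondr /=.
  by apply: ler_sum => H _; case: (typical k m tau H).
have -> : 2 * (y^-1 ^+ 3) ^+ q = (y^-1 ^+ 3) ^+ q + (y^-1 ^+ 3) ^+ q by rewrite mulr_natl mulr2n.
rewrite mulrDr lerD // Sq -exprMn mulrC lerXn2r // nnegrE.
  by rewrite mulr_ge0 // sqrtr_ge0.
by rewrite exprn_ge0 // invr_ge0 ltW.
Qed.

End Assemble.

(** * Tail bounds *)

From mathcomp Require Import all_classical all_reals all_analysis.
Import Order.TTheory GRing.Theory Num.Theory.
Local Open Scope ring_scope.

Lemma expR_le_quad (x : R) : `|x| <= 1 / 2 -> expR x <= 1 + x + 2 * x ^+ 2.
Proof.
move=> xh; have [xl xu] : -(1/2) <= x /\ x <= 1 / 2 by move: xh; rewrite ler_norml => /andP.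
have h : 1 - x <= expR (- x) by have := expR_ge1Dx (- x); lra.
have x1 : 0 < 1 - x by lra.
have : expR x * (1 - x) <= 1.
  by rewrite -[X in _ <= X](expRxMexpNx_1 x) ler_wpM2l ?expR_ge0.
rewrite -ler_pdivlMr // => /le_trans; apply.
rewrite ler_pdivrMr //.
have := mulr_ge0 (sqr_ge0 x) (_ : 0 <= 1 - 2 * x); lra.
Qed.

(** The hypothesis is a Poisson-type bound on the generating function at every real l, so l and -l
    give both tails. By the quadratic bound on [expR], it suffices to find l in [0, 1/2] with 2 nu
    l^2 - l r <= - tau; the factor 4 in [dev] makes room for one. *)
Lemma chernoff (I : finType) (w Y : I -> R) (nu tau : R) :
  (forall i, 0 <= w i) -> 0 <= nu -> 0 <= tau ->
  (forall l, \sum_i w i * expR (l * Y i) <= expR (nu * (expR l - 1))) ->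
  \sum_(i | dev nu tau < `|Y i - nu|) w i <= 2 * expR (- tau).
Proof.
move=> w0 nu0 tau0 mgf; set r := dev nu tau.
have [l [l0 lh lr]] : exists l, [/\ 0 <= l, l <= 1 / 2 & 2 * nu * l ^+ 2 - l * r <= - tau].
  have s0 : 0 <= Num.sqrt (nu * tau) by apply: sqrtr_ge0.
  (* The natural l is of order sqrt(tau / nu), admissible when tau <= nu. For larger tau, l = 1/2
     works thanks to the linear term of [dev]. *)
  have [tn|nt] := leP tau nu; last first.
    exists (1 / 2); split; rewrite /r /dev; lra.
  case: (eqVneq nu 0) => [n0|nn].
    exists 0; split; [lra|lra|]; rewrite n0 in tn; lra.
  have np : 0 < nu by rewrite lt_def nn.
  have q0 : 0 <= Num.sqrt (tau / nu) by apply: sqrtr_ge0.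
  have q2 : Num.sqrt (tau / nu) ^+ 2 = tau / nu by rewrite sqr_sqrtr // divr_ge0.
  have qs : Num.sqrt (tau / nu) * Num.sqrt (nu * tau) = tau.
    rewrite -sqrtrM ?divr_ge0 // mulrA divfK // -expr2 sqrtr_sqr ger0_norm //.
  exists (Num.sqrt (tau / nu) / 2); split; first lra.
    have : Num.sqrt (tau / nu) <= 1.
      by rewrite -[X in _ <= X]sqrtr1 ler_wsqrtr // ler_pdivrMr // mul1r.
    lra.
  have -> : 2 * nu * (Num.sqrt (tau / nu) / 2) ^+ 2 = nu * Num.sqrt (tau / nu) ^+ 2 / 2 by field.
  rewrite q2 (mulrC nu) divfK //.
  have -> : Num.sqrt (tau / nu) / 2 * r = 2 * (Num.sqrt (tau / nu) * Num.sqrt (nu * tau)) + 2 * tau * Num.sqrt (tau / nu).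
    by rewrite /r /dev; field.
  rewrite qs; have := mulr_ge0 tau0 q0; lra.
have bnd s : s = 1 \/ s = -1 -> \sum_i w i * expR (s * l * (Y i - nu) - l * r) <= expR (- tau).
  move=> s1.
  have -> : \sum_i w i * expR (s * l * (Y i - nu) - l * r) =
      expR (- (s * l * nu) - l * r) * \sum_i w i * expR (s * l * Y i).
    rewrite mulr_sumr; apply: eq_bigr => i _; rewrite [RHS]mulrCA -exp.expRD; congr (_ * expR _); ring.
  apply: (le_trans (ler_wpM2l (expR_ge0 _) (mgf _))); rewrite -exp.expRD ler_expR.
  have e : expR (s * l) <= 1 + s * l + 2 * (s * l) ^+ 2.
    apply: expR_le_quad; rewrite normrM (ger0_norm l0).
    have -> : `|s| = 1 by case: s1 => ->; rewrite ?normrN1 ?normr1.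
    lra.
  have s2 : (s * l) ^+ 2 = l ^+ 2 by case: s1 => ->; ring.
  rewrite s2 in e.
  have := ler_wpM2l nu0 e; lra.
rewrite big_mkcond /=.
apply: (@le_trans _ _ (\sum_i w i * expR (1 * l * (Y i - nu) - l * r) +
                      \sum_i w i * expR (-1 * l * (Y i - nu) - l * r))); last first.
  have := bnd 1 (or_introl erefl); have := bnd (-1) (or_intror erefl); lra.
rewrite -big_split; apply: ler_sum => i _ /=.
case: ifP => [|_]; last by rewrite addr_ge0 // mulr_ge0 ?expR_ge0.
rewrite lter_normr => big.
have pos s : 0 <= w i * expR (s * l * (Y i - nu) - l * r) by rewrite mulr_ge0 ?expR_ge0.
have one s : r <= s * (Y i - nu) -> w i <= w i * expR (s * l * (Y i - nu) - l * r).
  move=> h; rewrite ler_peMr //; apply: le_trans (expR_ge1Dx _).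
  have := ler_wpM2l l0 h; lra.
case/orP: big => h.
  by apply: (le_trans (one 1 _)); [rewrite mul1r ltW|rewrite lerDl pos].
by apply: (le_trans (one (-1) _)); [rewrite mulN1r ltW|rewrite lerDr pos].
Qed.

(** m is a mode of the binomial law with parameters E and m / E: consecutive probabilities rise up
    to m and fall after it. Being the largest of [E.+1] probabilities it is at least their mean, so
    conditioning independent edges on having m of them costs at most the factor [E.+1]. *)
Lemma binomial_mode (E m : nat) : (m <= E)%N -> (0 < E)%N ->
  1 <= E.+1%:R * ('C(E, m)%:R * (m%:R / E%:R) ^+ m * (1 - m%:R / E%:R) ^+ (E - m)) :> R.
Proof.
move=> mE E0; set p : R := m%:R / E%:R; pose f j : R := 'C(E, j)%:R * p ^+ j * (1 - p) ^+ (E - j).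
have ER : (0 : R) < E%:R by rewrite ltr0n.
have p0 : 0 <= p by rewrite divr_ge0.
have q0 : 0 <= 1 - p by rewrite subr_ge0 ler_pdivrMr // mul1r ler_nat.
have step j : (j < E)%N ->
    exists2 c : R, 0 <= c & f j.+1 = c * (p * (E - j)%:R) /\ f j = c * ((1 - p) * j.+1%:R).
  move=> jE; exists ('C(E, j)%:R * p ^+ j * (1 - p) ^+ (E - j.+1) / j.+1%:R).
    by rewrite divr_ge0 // !mulr_ge0 ?exprn_ge0.
  have j0 : (j.+1%:R : R) != 0 by rewrite pnatr_eq0.
  have bin : ('C(E, j.+1)%:R : R) = 'C(E, j)%:R * (E - j)%:R / j.+1%:R.
    by apply: (canRL (mulfK j0)); rewrite -!natrM mulnC mul_bin_left mulnC.
  split; first by rewrite /f bin exprS; field.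
  rewrite /f (_ : E - j = (E - j.+1).+1)%N; last by rewrite subnSK.
  by rewrite exprS; field.
have pE : p * E%:R = m%:R by rewrite /p divfK // gt_eqF.
have up j : (j < m)%N -> f j <= f j.+1.
  move=> jm; have jE := leq_trans jm mE.
  have [c c0 [-> ->]] := step _ jE; rewrite ler_wpM2l // natrB ?(ltnW jE) //.
  have : (j.+1%:R : R) <= m%:R by rewrite ler_nat.
  have jr : (j.+1%:R : R) = j%:R + 1 by rewrite natr1.
  rewrite jr -pE => h.
  rewrite mulrBr pE -/p mulrDr mulrBl; rewrite pE in h; nra.
have down j : (m <= j)%N -> (j < E)%N -> f j.+1 <= f j.
  move=> mj jE; have [c c0 [-> ->]] := step _ jE; rewrite ler_wpM2l // natrB ?(ltnW jE) //.
  have : (m%:R : R) <= j%:R by rewrite ler_nat.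
  have jr : (j.+1%:R : R) = j%:R + 1 by rewrite natr1.
  rewrite mulrBr pE jr; nra.
have mode j : (j <= E)%N -> f j <= f m.
  move=> jE; have [jm|mj] := leqP j m.
    have h i : (i <= m)%N -> f (m - i)%N <= f m.
      elim: i => [|i IH] im; first by rewrite subn0.
      by apply: le_trans (up _ _) _; [lia|rewrite subnSK //; apply: IH; apply: ltnW].
    by rewrite -(subKn jm); apply: h; apply: leq_subr.
  have h i : (m + i <= E)%N -> f (m + i)%N <= f m.
    elim: i => [|i IH] im; first by rewrite addn0.
    by rewrite addnS; apply: le_trans (down _ _ _) (IH _); lia.
  by rewrite -(subnKC (ltnW mj)); apply: h; rewrite subnKC // ltnW.
have tot : \sum_(i < E.+1) f i = 1.
  rewrite -[RHS](expr1n _ E) -[X in X ^+ E](subrK p) exprDn; apply: eq_bigr => i _.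
  by rewrite /f -mulr_natl; ring.
have -> : E.+1%:R * ('C(E, m)%:R * p ^+ m * (1 - p) ^+ (E - m)) = \sum_(i < E.+1) f m.
  by rewrite sumr_const card_ord mulr_natl.
rewrite -tot; apply: ler_sum => i _.
by apply: mode; rewrite -ltnS.
Qed.

Lemma card_khg n k m : #|khg n k m| = 'C('C(n, k), m).
Proof.
rewrite -(card_edges n k) -cards_draws /=.
apply: eq_card => H; rewrite !inE; congr (_ && _).
by apply/forall_inP/fintype.subsetP => h e eH; move: (h e eH); rewrite inE.
Qed.

Section Tails.
Variables (n k m : nat) (tau : R).
Hypotheses (n1 : (1 < n)%N) (k0 : (0 < k <= n)%N) (mE : (m <= 'C(n, k))%N) (tau0 : 0 <= tau).
Let E := 'C(n, k).
Let p : R := m%:R / E%:R.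

Let E0 : (0 < E)%N. Proof. by rewrite bin_gt0; case/andP: k0. Qed.
Let ER : (0 : R) < E%:R. Proof. by rewrite ltr0n. Qed.
Let p01 : 0 <= p <= 1.
Proof. by rewrite divr_ge0 //= ler_pdivrMr // mul1r ler_nat. Qed.

Lemma khg_sub_edges (H : {set {set 'I_n}}) : H \in khg n k m -> H \subset edges n k /\ #|H| = m.
Proof.
rewrite mem_khg => /andP[/forall_inP Hk /eqP Hm]; split => //.
by apply/fintype.subsetP => e /Hk; rewrite inE.
Qed.

(** In the independent model all hypergraphs with m edges have the same weight u, so the Chernoff
    bound on weight is a bound on their number; [binomial_mode] removes u. *)
Lemma khg_tail (Y : {set {set 'I_n}} -> R) (nu : R) : 0 <= nu ->
  (forall l, \sum_(H : {set {set 'I_n}} | H \subset edges n k)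
      bweight p (edges n k) H * expR (l * Y H) <= expR (nu * (expR l - 1))) ->
  #|[set H in khg n k m | dev nu tau < `|Y H - nu|]|%:R <=
     2 * E.+1%:R * expR (- tau) * #|khg n k m|%:R.
Proof.
move=> nu0 mgf.
pose w (H : {set {set 'I_n}}) := if H \subset edges n k then bweight p (edges n k) H else 0.
have w0 H : 0 <= w H by rewrite /w; case: ifP => // _; apply: bweight_ge0.
have mgf' l : \sum_H w H * expR (l * Y H) <= expR (nu * (expR l - 1)).
  apply: le_trans (mgf l); rewrite [X in _ <= X]big_mkcond /=; apply: ler_sum => H _.
  by rewrite /w; case: ifP; rewrite ?mul0r.
have ch := chernoff w0 nu0 tau0 mgf'.
pose u : R := p ^+ m * (1 - p) ^+ (E - m).
set bad := [set H in khg n k m | _].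
have bu : #|bad|%:R * u <= 2 * expR (- tau).
  apply: le_trans ch; rewrite mulr_natl -sumr_const big_mkcond [X in _ <= X]big_mkcond /=.
  apply: ler_sum => H _; rewrite inE; case: (boolP (H \in khg n k m)) => [HK|_] /=; last by case: ifP.
  case: ifP => // _; have [HD Hm] := khg_sub_edges HK.
  by rewrite /w HD bweight_card // Hm card_edges.
have md := binomial_mode mE E0; rewrite -/p -/E -mulrA -/u in md.
rewrite card_khg -/E.
apply: (@le_trans _ _ (#|bad|%:R * (E.+1%:R * ('C(E, m)%:R * u)))).
  by rewrite -[X in X <= _]mulr1 ler_wpM2l.
have -> : #|bad|%:R * (E.+1%:R * ('C(E, m)%:R * u)) = (#|bad|%:R * u) * (E.+1%:R * 'C(E, m)%:R) by ring.
have -> : 2 * E.+1%:R * expR (- tau) * 'C(E, m)%:R = 2 * expR (- tau) * (E.+1%:R * 'C(E, m)%:R) by ring.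
by rewrite ler_wpM2r // mulr_ge0.
Qed.

Lemma exprM_expR (l : R) (j : nat) : expR (l * j%:R) = expR l ^+ j.
Proof. by rewrite mulrC expRM_natl. Qed.

Lemma powX_le_expR (x : R) (j : nat) : -1 <= x -> (1 + x) ^+ j <= expR (j%:R * x).
Proof.
move=> x1; rewrite mulrC exprM_expR lerXn2r ?nnegrE ?expR_ge0 //; first lra.
exact: expR_ge1Dx.
Qed.

Let pt_ge (l : R) : -1 <= p * (expR l - 1).
Proof. by case/andP: p01 => p0 p1; have := expR_ge0 l; nra. Qed.

Let nR : (0 : R) < n%:R. Proof. by rewrite ltr0n (ltn_trans _ n1). Qed.

Local Notation avg_deg := (avg_deg n k m).
Local Notation pair_frac := (pair_frac n k).
Local Notation fixed_mean := (fixed_mean n k m).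
Local Notation typical := (typical k m tau).

Lemma card_edges_atR (v : 'I_n) : p * #|edges_at k v|%:R = avg_deg.
Proof.
have /(congr1 (fun j => j%:R : R)) := card_edges_at k v; rewrite !natrM -/E => h.
have -> : (#|edges_at k v|%:R : R) = k%:R * E%:R / n%:R.
  by apply: (canRL (mulfK _)); rewrite ?gt_eqF // mulrC.
by rewrite /p /avg_deg; field; rewrite !gt_eqF.
Qed.

Lemma card_edges_bothR (a b : 'I_n) : a != b -> p * #|edges_both k a b|%:R = avg_deg * pair_frac.
Proof.
move=> ab; have /(congr1 (fun j => j%:R : R)) := card_edges_both k ab; rewrite !natrM => h.
have n1R : (n.-1%:R : R) != 0 by rewrite pnatr_eq0; case: (n) n1 => // -[].
have -> : (#|edges_both k a b|%:R : R) = k.-1%:R * #|edges_at k a|%:R / n.-1%:R.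
  by apply: (canRL (mulfK _)); rewrite // mulrC.
by rewrite -(card_edges_atR a) /pair_frac; field.
Qed.

Lemma degs_tail (v : 'I_n) :
  #|[set H in khg n k m | dev avg_deg tau < `|(degs n H v)%:R - avg_deg|]|%:R <=
     2 * E.+1%:R * expR (- tau) * #|khg n k m|%:R.
Proof.
apply: khg_tail (avg_deg_ge0 n k m) _ => l.
rewrite (eq_bigr (fun H => bweight p (edges n k) H * expR l ^+ degs n H v)); last first.
  by move=> H _; rewrite exprM_expR.
rewrite degs_mgf; apply: le_trans (powX_le_expR _ (pt_ge l)) _.
by rewrite -(card_edges_atR v) ler_expR mulrA (mulrC p).
Qed.

Lemma fixed_deg_tail (a b : 'I_n) : a != b ->
  #|[set H in khg n k m | dev fixed_mean tau < `|(fixed_deg a b H)%:R - fixed_mean|]|%:R <=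
     2 * E.+1%:R * expR (- tau) * #|khg n k m|%:R.
Proof.
move=> ab; apply: khg_tail (fixed_mean_ge0 n1 k0 mE) _ => l.
rewrite (eq_bigr (fun H => bweight p (edges n k) H * expR l ^+ fixed_deg a b H)); last first.
  by move=> H _; rewrite exprM_expR.
rewrite fixed_deg_mgf //; set t := expR l - 1.
have pt := pt_ge l; rewrite -/t in pt.
have ppt : -1 <= p * (p * t) by case/andP: p01 => p0 p1; nra.
apply: le_trans (ler_pM _ _ (powX_le_expR _ pt) (powX_le_expR _ ppt)) _;
  rewrite ?exprn_ge0 //; [lra|lra|].
rewrite -exp.expRD ler_expR le_eqVlt; apply/orP; left; apply/eqP.
have e1 := card_edges_bothR ab; have e2 := card_edges_atR a.
have e3 : (#|edges_at k a|%:R : R) = #|edges_both k a b|%:R + #|edges_but k a b|%:R.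
  by rewrite -natrD card_edges_but.
have e4 : p * #|edges_but k a b|%:R = avg_deg - avg_deg * pair_frac.
  by rewrite -e1 -e2 e3; ring.
rewrite /fixed_mean -/E -/p.
transitivity (t * (p * #|edges_both k a b|%:R) + p * t * (p * #|edges_but k a b|%:R)); first by ring.
by rewrite e1 e4; ring.
Qed.

Lemma atypical_le : #|[set H in khg n k m | ~~ typical H]|%:R <=
  4 * n%:R ^+ 2 * E.+1%:R * expR (- tau) * #|khg n k m|%:R.
Proof.
set B := [set H in khg n k m | _].
pose B1 v := [set H in khg n k m | dev avg_deg tau < `|(degs n H v)%:R - avg_deg|].
pose B2 (c : 'I_n * 'I_n) := [set H in khg n k m | (c.1 != c.2) &&
   (dev fixed_mean tau < `|(fixed_deg c.1 c.2 H)%:R - fixed_mean|)].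
have sub : (#|B| <= \sum_v #|B1 v| + \sum_c #|B2 c|)%N.
  rewrite -sum1_card.
  under [X in (_ <= X + _)%N]eq_bigr => v _ do rewrite /B1 -sum1dep_card.
  under [X in (_ <= _ + X)%N]eq_bigr => v _ do rewrite /B2 -sum1dep_card.
  rewrite (exchange_big_dep (mem (khg n k m))) /=; last by move=> v H _ /andP[].
  rewrite [X in (_ <= _ + X)%N](exchange_big_dep (mem (khg n k m))) /=; last by move=> v H _ /andP[].
  rewrite -big_split /= [X in (_ <= X)%N]big_mkcond [X in (X <= _)%N]big_mkcond; apply: leq_sum => H _ /=.
  rewrite inE; case: (boolP (H \in khg n k m)) => //= HK.
  case: ifP => //; rewrite /typical negb_and => /orP[/forallPn[v]|/forallPn[a /forallPn[b]]].
    by rewrite -ltNge => h; rewrite (bigD1 v) //= -addnA.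
  rewrite negb_imply -ltNge => /andP[ab h].
  rewrite [X in (_ <= _ + X)%N](bigD1 (a, b)) /= ?ab ?h //.
  by rewrite addnCA.
have b0 : 0 <= 2 * E.+1%:R * expR (- tau) * #|khg n k m|%:R.
  by rewrite !mulr_ge0 // expR_ge0.
apply: (@le_trans _ _ (n%:R * (2 * E.+1%:R * expR (- tau) * #|khg n k m|%:R) +
                       n%:R ^+ 2 * (2 * E.+1%:R * expR (- tau) * #|khg n k m|%:R))).
  apply: (@le_trans _ _ ((\sum_v #|B1 v| + \sum_c #|B2 c|)%N%:R)); first by rewrite ler_nat.
  rewrite natrD !natr_sum; apply: lerD.
    set z := 2 * _ * _ * _; have -> : n%:R * z = \sum_(v < n) z by rewrite sumr_const card_ord mulr_natl.
    by apply: ler_sum => v _; apply: degs_tail.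
  set z := 2 * _ * _ * _; have -> : n%:R ^+ 2 * z = \sum_(c : 'I_n * 'I_n) z.
    by rewrite sumr_const card_prod card_ord -(mulr_natl z) natrM expr2.
  apply: ler_sum => -[a b] _.
  case: (eqVneq a b) => [ab|ab].
    by rewrite /B2 ab eqxx (_ : [set _ in _ | _] = finset.set0) ?cards0 //; apply/setP => H; rewrite !inE andbF.
  apply: le_trans (fixed_deg_tail ab); rewrite ler_nat subset_leq_card //.
  by apply/fintype.subsetP => H; rewrite !inE /= ab.
have : n%:R <= (n%:R ^+ 2 : R).
  by rewrite expr2 ler_peMr // ler1n (ltn_trans _ n1).
move=> /(ler_wpM2r b0); set z := 2 * _ * _ * _ => h.
have -> : 4 * n%:R ^+ 2 * E.+1%:R * expR (- tau) * #|khg n k m|%:R = 2 * (n%:R ^+ 2 * z).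
  by rewrite /z; ring.
lra.
Qed.

End Tails.

(** * Superpolynomial tails and the choice of parameters *)

Lemma leq_bin_expn (n k : nat) : ('C(n, k) <= n ^ k)%N.
Proof.
apply: (@leq_trans (n ^_ k)); first by rewrite -bin_ffact leq_pmulr // fact_gt0.
elim: k n => [|k IH] n; first by rewrite ffactn0 expn0.
by rewrite ffactnSr expnSr leq_mul // leq_subr.
Qed.

Lemma Nb_le_bin (n k : nat) : (0 < k <= n)%N -> (Nb n k <= 'C(n, k))%N.
Proof.
move=> k0; have n0 : (0 < n)%N by case/andP: k0 => /leq_trans; apply.
by rewrite -(leq_pmul2l n0) n_Nb // leq_mul2r; case/andP: k0 => _ ->; rewrite orbT.
Qed.

(** Each factor before the exponential is bounded through G = n^(k+3). Since y <= expR y and k <=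
    y^16, all powers of G together are at most exp(864 q y^17), where 864 = 144 * 6. For y >= 867 q
    the term y^18 exceeds this exponent by at least 3 q y, which pays for the right side. *)
Lemma tail_small (n k m j : nat) (y : R) : let q := (2 ^ j.+1)%N in
  867 * q%:R <= y -> n%:R = y ^+ 144 -> (2 < k <= n)%N -> (m <= 'C(n, k))%N -> k%:R <= y ^+ 16 ->
  (k * m)%:R ^+ (2 ^ j) * ((2 * (Nb n k).+1%:R + 1) ^+ q *
     (4 * n%:R ^+ 2 * 'C(n, k).+1%:R * expR (- y ^+ 18))) <= (y^-1 ^+ 3) ^+ q.
Proof.
move=> q yq nE /andP[k3 kn] mE ky.
have q1 : (1 <= q)%N by rewrite expn_gt0.
have y867 : 867 <= y.
  have : 1 <= q%:R :> R by rewrite ler1n.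
  by move: yq; lra.
have y0 : 0 < y by apply: lt_le_trans _ y867; rewrite ltr0n.
have y1 : 1 <= y by apply: le_trans _ y867; rewrite ler1n.
have n8 : (8 <= n)%N.
  rewrite -(ler_nat R) nE; apply: (@le_trans _ _ y); last by rewrite ler_eXnr.
  by apply: le_trans _ y867; rewrite ler_nat.
have NbE : (Nb n k <= n ^ k)%N.
  apply: leq_trans (Nb_le_bin _) (leq_bin_expn n k); by rewrite kn andbT ltnW // ltnW.
have Ek := leq_bin_expn n k.
have k1 : (1 <= n ^ k)%N by rewrite expn_gt0; case: (n) n8.
have n3 : (512 <= n ^ 3)%N by rewrite (@leq_exp2r 8 n 3).
pose G : R := n%:R ^+ (k + 3).
have GE : G = (n ^ k * n ^ 3)%N%:R by rewrite /G -natrX expnD.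
have G1 : 1 <= G by rewrite GE ler1n muln_gt0 k1 (leq_trans _ n3).
have h1 : (k * m)%:R <= G.
  rewrite GE ler_nat mulnC leq_mul ?(leq_trans mE) // (leq_trans kn) //.
  by rewrite -[leqLHS]expn1 leq_pexp2l // (leq_trans _ n8).
have h2 : 2 * (Nb n k).+1%:R + 1 <= G.
  rewrite GE -natrM natr1 ler_nat.
  apply: (@leq_trans (n ^ k * 512)); last by rewrite leq_mul2l n3 orbT.
  by clear -NbE k1; lia.
have h3 : 4 * n%:R ^+ 2 * 'C(n, k).+1%:R <= G.
  rewrite GE -natrX -!natrM ler_nat.
  have u : (4 * 'C(n, k).+1 <= n ^ k * 8)%N by clear -Ek k1; lia.
  rewrite (_ : n ^ k * n ^ 3 = n ^ 2 * (n ^ k * n))%N; last by rewrite (expnSr n 2) mulnCA.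
  rewrite -mulnA mulnCA leq_mul2l; apply/orP; right; apply: leq_trans u _.
  by rewrite leq_mul2l n8 orbT.
have G0 : 0 <= G by rewrite (le_trans _ G1).
have e0 := expR_ge0 (- y ^+ 18).
apply: (@le_trans _ _ (G ^+ (2 ^ j) * (G ^+ q * (G * expR (- y ^+ 18))))).
  apply: ler_pM; rewrite ?exprn_ge0 ?mulr_ge0 ?exprn_ge0 //.
    by rewrite lerXn2r ?nnegrE.
  apply: ler_pM; rewrite ?exprn_ge0 ?mulr_ge0 ?exprn_ge0 //.
    by rewrite lerXn2r ?nnegrE // ?addr_ge0 // ?mulr_ge0.
  by rewrite ler_wpM2r.
have -> : G ^+ (2 ^ j) * (G ^+ q * (G * expR (- y ^+ 18))) = G ^+ (2 ^ j + q).+1 * expR (- y ^+ 18).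
  by rewrite [G ^+ _.+1]exprSr exprD; ring.
have yexp : y <= expR y by apply: le_trans (expR_ge1Dx y); rewrite lerDr.
have Gexp : G ^+ (2 ^ j + q).+1 <= expR (864 * q%:R * y ^+ 17).
  apply: (@le_trans _ _ (expR y ^+ (864 * k * q))).
    rewrite /G nE -!exprM.
    apply: (@le_trans _ _ (y ^+ (864 * k * q))); last by rewrite lerXn2r ?nnegrE ?expR_ge0 // ltW.
    rewrite ler_weXn2l // -[864%N]/(144 * (2 * 3))%N -!mulnA leq_mul2l /=.
    rewrite (_ : 2 * (3 * (k * q)) = (2 * k) * (3 * q))%N; last by ring.
    apply: leq_mul; first by clear -k3; lia.
    have : (2 ^ j <= q)%N by rewrite leq_exp2l.
    by clear -q1; lia.
  rewrite -expRM_natl ler_expR 2!natrM.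
  have -> : 864%:R * k%:R * q%:R * y = 864 * q%:R * (k%:R * y) by ring.
  apply: ler_wpM2l; first exact: mulr_ge0 (ler0n _ _) (ler0n _ _).
  by rewrite exprSr; apply: ler_wpM2r ky; exact: ltW.
have zexp : expR (- (3 * q%:R * y)) <= (y^-1 ^+ 3) ^+ q.
  rewrite -exprM exprVn expRN -natrM expRM_natl lef_pV2 ?posrE ?exprn_gt0 ?expR_gt0 //.
  by rewrite lerXn2r ?nnegrE ?expR_ge0 // ltW.
apply: le_trans zexp; apply: (@le_trans _ _ (expR (864 * q%:R * y ^+ 17) * expR (- y ^+ 18))).
  exact: ler_wpM2r.
rewrite -exp.expRD ler_expR.
have y17 : 867 * q%:R * y ^+ 17 <= y ^+ 18 by rewrite [leRHS]exprS ler_wpM2r // exprn_ge0 // ltW.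
have yy : q%:R * y <= q%:R * y ^+ 17 by rewrite ler_wpM2l // ler_eXnr.
by move: y17 yy; lra.
Qed.

(** With z = 1 / y the deviation is of order z^(3q). Testing closeness of F at scale t = z^2 costs
    (3 / t)^q, so z^q remains, and q = 2^(j+2) exceeds j. The constants depend on j only and are
    absorbed by the threshold on y. *)
Lemma close_tail (j : nat) : exists Y : R, forall (n k m : nat) (y : R),
  Y <= y -> n%:R = y ^+ 144 -> (2 < k)%N -> k%:R <= y ^+ 16 -> y ^+ 72 <= m%:R ->
  m%:R / 'C(n, k)%:R <= 1 / 30 :> R ->
  1 - PrB_ev n k m (ratio_close k m y^-1) <= y^-1 ^+ j /\ 1 - PrD_ev n k m (ratio_close k m y^-1) <= y^-1 ^+ j.
Proof.
have [C C0 dev_le] := deviation_le j.+1.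
set q := (2 ^ j.+2)%N.
have q4 : (4 <= q)%N by rewrite (@leq_exp2l 2 2).
pose K : R := 2 * C * 3 ^+ q.
have K0 : 0 < K by rewrite !mulr_gt0 // exprn_gt0.
pose L : R := q%:R * 2 ^+ q.
have L0 : 0 <= L by rewrite mulr_ge0 // exprn_ge0.
exists (1000 + 867 * q%:R + 2 * K + L) => n k m y Yy nE k3 ky my pk.
have q0 : (0 : R) <= q%:R by [].
have y1000 : 1000 <= y by lra.
have yq : 867 * q%:R <= y by lra.
have yK : 2 * K <= y by lra.
have yL : L <= y by lra.
have y0 : 0 < y by lra.
pose z := y^-1.
have z0 : 0 < z by rewrite invr_gt0.
have z1 : z < 1 by rewrite invf_lt1 //; lra.
have Kz : 2 * K * z <= 1 by rewrite ler_pdivrMr // mul1r.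
have Lz : L * z <= 1 by rewrite ler_pdivrMr // mul1r.
have kn : (k <= n)%N.
  by rewrite -(ler_nat R) nE (le_trans ky) // ler_weXn2l //; lra.
have k0 : (0 < k <= n)%N by rewrite kn andbT ltnW // ltnW.
have E0 : (0 : R) < 'C(n, k)%:R by rewrite ltr0n bin_gt0.
have m0 : (0 < m < 'C(n, k))%N.
  rewrite -(ltr_nat R) (lt_le_trans _ my) ?exprn_gt0 //= -(ltr_nat R).
  move: pk; rewrite ler_pdivrMr // => h; apply: le_lt_trans h _; rewrite gtr_pMl //; lra.
have mE : (m <= 'C(n, k))%N by case/andP: m0 => _ /ltnW.
have n1 : (1 < n)%N by apply: leq_trans kn; apply: ltnW.
have dev : deviation n k m j.+1 <= C * (2 * (z ^+ 3) ^+ q).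
  have tau0 : 0 <= y ^+ 18 by rewrite exprn_ge0 // ltW.
  have kn3 : (2 < k <= n)%N by rewrite k3.
  apply: (deviation_small y1000 nE k3 ky my pk (atypical_le n1 k0 mE tau0) _ C0) => [|b b0 sb].
    exact: tail_small yq nE kn3 mE ky.
  exact: dev_le.
have err : (3 / z ^+ 2) ^+ q * deviation n k m j.+1 <= K * z ^+ q.
  apply: (@le_trans _ _ ((3 / z ^+ 2) ^+ q * (C * (2 * (z ^+ 3) ^+ q)))).
    by rewrite ler_wpM2l // exprn_ge0 // divr_ge0 // exprn_ge0 // ltW.
  have zq : (z ^+ 3) ^+ q = (z ^+ 2) ^+ q * z ^+ q by rewrite -exprMn -exprSr.
  have w0 : (z ^+ 2) ^+ q != 0 by rewrite !expf_neq0 // lt0r_neq0.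
  rewrite expr_div_n zq /K; move: w0; move: ((z ^+ 2) ^+ q) (z ^+ q) (3 ^+ q) => w v u w0.
  by rewrite le_eqVlt; apply/orP; left; apply/eqP; field.
have z4 : z ^+ q <= z ^+ 4 by rewrite ler_wiXn2l // ltW.
have z2 : 0 < z ^+ 2 by rewrite exprn_gt0.
have [//||//|b1 b2] := @close_prob n k m j.+1 k0 m0 (z ^+ 2) z z2.
- rewrite (@le_trans _ _ z) //; first by rewrite expr2 ler_piMl // ltW.
  by rewrite invf_ple ?posrE //; lra.
- apply: le_lt_trans err _; apply: (@le_lt_trans _ _ (K * z ^+ 4)); first by rewrite ler_pM2l.
  have -> : K * z ^+ 4 = 2 * K * z * (z ^+ 3 / 2) by field.
  apply: (@le_lt_trans _ _ (z ^+ 3 / 2)); first by rewrite ler_piMl // divr_ge0 // exprn_ge0 // ltW.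
  by rewrite ltr_pM2r // exprS gtr_pMl.
- by rewrite -/q -/L expr2 mulrA ler_piMl // ltW.
have fin : K * z ^+ q <= z ^+ j.
  have jq : (j < q)%N by rewrite (ltn_trans _ (ltn_expl j.+2 (isT : (1 < 2)%N))).
  apply: (@le_trans _ _ (K * z ^+ j.+1)).
    by rewrite ler_wpM2l ?ler_wiXn2l ?ltW.
  by rewrite exprS mulrA ler_piMl ?exprn_ge0 ?(ltW z0) //; lra.
by split; [apply: le_trans b1 _|apply: le_trans b2 _]; apply: le_trans err fin.
Qed.

(* With y = root144 n, the bounds k < n^(1/9), sqrt n < m read k < y^16, y^72 < m. *)
Definition root144 (n : nat) : R := powR n%:R (1 / 144).

Lemma root144_exprn n i : root144 n ^+ i = powR n%:R (i%:R / 144).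
Proof. by rewrite -powR_mulrn ?powR_ge0 // -powRrM; congr powR; field. Qed.

Lemma root144E n : root144 n ^+ 144 = n%:R.
Proof. by rewrite root144_exprn divff ?powRr1 // pnatr_eq0. Qed.

Lemma root144_ge (Y : R) : exists N, forall n, (N <= n)%N -> Y <= root144 n.
Proof.
exists (Num.truncn (Num.max Y 0 ^+ 144)).+1 => n Nn.
have Y0 : 0 <= Num.max Y 0 by rewrite le_max lexx orbT.
apply: (@le_trans _ _ (Num.max Y 0)); first by rewrite le_max lexx.
rewrite -(@ler_pXn2r _ 144) ?nnegrE ?powR_ge0 // root144E.
by apply: ltW; rewrite -truncn_lt_nat ?exprn_ge0.
Qed.

(** The constant c = 1/10 is chosen for the last bound: with k >= 3 it makes the edge density at
    most 1/30, as the dense regime requires. *)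
Lemma admissibleE (C : R) (n k m : nat) : C < 1 / 9 -> admissible (1 / 10) C n k m ->
  [/\ (2 < k)%N, k%:R <= root144 n ^+ 16, root144 n ^+ 72 <= m%:R :> R &
      m%:R / 'C(n, k)%:R <= 1 / 30 :> R].
Proof.
(* For n = 0 the binomial coefficient vanishes and the upper bound on m fails; n >= 1 is what makes
   powers of n monotone in the exponent. *)
move=> C9 [k3 kC mn mE]; have n0 : (0 < n)%N.
  case: (n) kC mE => // _; rewrite bin0n; case: (k) k3 => // k' _ /=.
  by rewrite mulr0 ltNge ler0n.
have k3R : 3 <= k%:R :> R by rewrite ler_nat.
split=> //.
- apply: ltW (lt_le_trans kC _); rewrite root144_exprn ler_powR ?ler1n //.
  by apply: le_trans (ltW C9) _; lra.
- have h : 72%:R / 144 = 2^-1 :> R by lra.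
  by rewrite root144_exprn h powR12_sqrt // ltW.
have E0 : (0 : R) < 'C(n, k)%:R.
  rewrite lt0r ler0n andbT; apply/eqP => E; move: mE; rewrite E mulr0 ltNge ler0n //.
rewrite ler_pdivrMr //; apply: ltW (lt_le_trans mE _); rewrite ler_pM2r //.
by rewrite ler_pdivrMr ?(lt_le_trans _ k3R) //; lra.
Qed.

Theorem theorem1p1 :
  exists c : R, 0 < c /\
  forall C : R, 0 < C -> C < 1 / 9 ->
  exists W : forall n : nat, nat -> nat -> degseq n -> bool,
    (* W(n,k,m) is a subset of Omega *)
    (forall (n k m : nat) (d : degseq n), W n k m d -> inOmega n k m d) /\
    (* W has probability 1 - O(n^{-omega(1)}) in both B_k(n,m) and D_k(n,m),
       uniformly over admissible k, m *)
    (exists f : nat -> R,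
       (forall A : R, exists N : nat, forall n : nat, (N <= n)%N -> A <= f n) /\
       exists (K : R) (N : nat), forall n k m : nat, (N <= n)%N ->
         admissible c C n k m ->
         1 - PrB_ev n k m (W n k m) <= K * powR (n%:R : R) (- f n) /\
         1 - PrD_ev n k m (W n k m) <= K * powR (n%:R : R) (- f n)) /\
    (* uniformly for admissible k, m and d in W: Pr_D(d) = Pr_B(d)(1 + o(1)) *)
    (exists g : nat -> R,
       (forall eps : R, 0 < eps -> exists N : nat, forall n : nat, (N <= n)%N -> `|g n| <= eps) /\
       exists N : nat, forall n k m : nat, (N <= n)%N ->
         admissible c C n k m ->
         forall d : degseq n, W n k m d ->
           exists e : R, `|e| <= g n /\ PrD n k m d = PrB n k m d * (1 + e)).
Proof.
exists (1 / 10); split=> [|C C0 C9]; first lra.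
(* W is defined by the closeness of the two probabilities, so the final assertion is nearly
   immediate and the content lies in the probability of W. *)
exists (fun n k m => ratio_close k m (root144 n)^-1); split; last split.
- by move=> n k m d /andP[/eqP h _].
- have tail i : exists N : nat, forall n k m, (N <= n)%N -> admissible (1 / 10) C n k m ->
      1 - PrB_ev n k m (ratio_close k m (root144 n)^-1) <= powR n%:R (- (i%:R / 144)) /\
      1 - PrD_ev n k m (ratio_close k m (root144 n)^-1) <= powR n%:R (- (i%:R / 144)).
    have [Y tailY] := close_tail i; have [N YN] := root144_ge Y.
    exists N => n k m Nn /(admissibleE C9)[k3 ky my pk].
    rewrite powRN -root144_exprn -exprVn; exact: tailY (YN _ Nn) (esym (root144E n)) k3 ky my pk.
  have [Nf tailN] := choice tail.
  (* The diagonal choice: the largest exponent index l <= n whose threshold [Nf l] has been passed.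
     The bound is used at that single l, so the thresholds may come in any order. *)
  pose i n : nat := \max_(l < n.+1 | (Nf l <= n)%N) l.
  exists (fun n => (i n)%:R / 144); split.
    move=> A; pose a := (Num.truncn (Num.max A 0 * 144)).+1.
    exists (maxn a (Nf a)) => n; rewrite geq_max => /andP[an Nn].
    have ai : (a <= i n)%N by rewrite /i (@leq_bigmax_cond _ _ (fun l : 'I_n.+1 => l : nat) (Ordinal (an : (a < n.+1)%N))).
    rewrite ler_pdivlMr //; apply: (@le_trans _ _ (Num.max A 0 * 144)).
      by rewrite ler_wpM2r // le_max lexx.
    apply: (@le_trans _ _ a%:R); last by rewrite ler_nat.
    by apply: ltW; rewrite -truncn_lt_nat // mulr_ge0 // le_max lexx orbT.
  exists 1, (Nf 0%N) => n k m Nn adm; rewrite mul1r.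
  (* Starting at [Nf 0] ensures that the maximum is taken over a nonempty set and is therefore
     attained at an index satisfying the condition. *)
  have c0 : (0 < #|[pred l : 'I_n.+1 | (Nf l <= n)%N]|)%N.
    by apply/card_gt0P; exists ord0; rewrite inE.
  have [l ln lE] := eq_bigmax_cond (fun l : 'I_n.+1 => l : nat) c0.
  by rewrite /i lE; apply: tailN.
exists (fun n => (root144 n)^-1); split.
  move=> eps eps0; have [N YN] := root144_ge eps^-1.
  exists N => n Nn; rewrite ger0_norm ?invr_ge0 ?powR_ge0 // invf_ple ?posrE ?YN //.
  by apply: lt_le_trans (YN _ Nn); rewrite invr_gt0.
(* When the B-probability is 0, closeness forces the D-probability to be 0 too, and e = 0 serves;
   otherwise e is the relative error. *)
exists 0%N => n k m _ _ d /andP[_]; have [->|PB0] := eqVneq (PrB n k m d) 0.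
  rewrite mulr0 normr_le0 subr0 => /eqP ->; exists 0.
  by rewrite normr0 invr_ge0 powR_ge0 mul0r.
move=> h; exists (PrD n k m d / PrB n k m d - 1); split; last by field.
have P0 : 0 < PrB n k m d by rewrite lt0r PB0 divr_ge0.
rewrite -(ler_pM2r P0) -{2}(ger0_norm (ltW P0)) -normrM mulrBl mul1r divfK //.
Qed.
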